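(* Let $X\subseteq \mathbb{P}^r$ be an irreducible, non-degenerate, projective complex variety of dimension $n$ with $r\geq 3n+2$. Suppose that: (i) for every $0$-dimensional, curvilinear scheme $\gamma$ of length $3$ contained in the smooth locus of $X$, $X$ is special along $\gamma$; (ii) $X$ is $2$-osculating regular. Then $X$ is $2$-defective.
   Context: The ground field is $\mathbb{C}$. Non-degenerate means not contained in a hyperplane. **Secant defect.** For $k\ge 0$, $\mathrm{Sec}_k(X)$ is the Zariski closure of the union of all $k$-dimensional linear spaces which are $(k+1)$-secant to $X$ at linearly independent points, i.e. the spans $\langle p_0,\dots,p_k\rangle$ of $k+1$ linearly independent points of $X$. One has $\dim \mathrm{Sec}_k(X)\le \min\{r, kn+n+k\}$, and $X$ is called $k$-defective if this inequality is strict. Thus, for $k=2$ and $r\ge 3n+2$, $X$ is $2$-defective if and only if $\dim \mathrm{Sec}_2(X)<3n+2$. **Osculating regularity.** $\mathrm{Osc}_m(X)$ is the Zariski closure of the union of all the $m$-dimensional osculating spaces to smooth curves contained in the smooth locus of $X$. One has $\dim \mathrm{Osc}_m(X)\le \min\{(m+1)n, r\}$, and $X$ is called $m$-osculating regular if equality holds. For $m=2$ and $r\ge 3n$ this means $\dim \mathrm{Osc}_2(X)=3n$. **Tangent space along a curvilinear scheme.** The $0$-dimensional curvilinear schemes $\gamma$ of length $3$ considered are supported at a single smooth point $p\in X$ (so $\gamma\cong \mathrm{Spec}\,\mathbb{C}[t]/(t^3)$). Such a $\gamma$ determines infinitely near points $p_1,p_2$ to $p$: $p_1$ lies on the blow-up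 $\sigma_1:X_1\to X$ at $p$ and is the support of the strict transform $\gamma_1$ (of length $2$) of $\gamma$; $p_2$ lies on the blow-up $\sigma_2:X_2\to X_1$ at $p_1$ and is the support of the strict transform of $\gamma_1$. Let $E_1\subset X_1$, $E_2\subset X_2$ be the exceptional divisors of $\sigma_1,\sigma_2$. For a hyperplane $\pi$ of $\mathbb{P}^r$ let $X_\pi$ be the scheme-theoretic intersection $X\cap \pi$. We say $X_\pi$ is singular along $\gamma$ if $X_\pi$ has multiplicity at least $2$ at $p$ (i.e. $\pi$ is tangent to $X$ at $p$), its transform $D_1=\sigma_1^*X_\pi-2E_1$ has multiplicity at least $2$ at $p_1$, and the transform $D_2=\sigma_2^*D_1-2E_2$ has multiplicity at least $2$ at $p_2$. The tangent space $T_{X,\gamma}$ to $X$ along $\gamma$ is the intersection of all hyperplanes $\pi$ such that $X_\pi$ is singular along $\gamma$ (it is $\mathbb{P}^r$ if there are none). One has $\dim T_{X,\gamma}\le \min\{r, 3(n+1)-1\}$, which equals $3n+2$ when $r\ge 3n+2$; $X$ is called special along $\gamma$ if this inequality is strict, i.e. $\dim T_{X,\gamma}<3n+2$ when $r\geq 3n+2$. *)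

(* Defs.v *)
From HB Require Import structures.
From mathcomp Require Import all_boot all_order all_algebra.
From mathcomp Require Export mpoly.
From mathcomp Require Export classical_sets reals complex.

Set Implicit Arguments.
Unset Strict Implicit.
Unset Printing Implicit Defensive.

Import GRing.Theory.
Local Open Scope ring_scope.
Local Open Scope classical_set_scope.

(* A subset of P^r is encoded by the set of the nonzero vectors of K^(r+1)
   that represent its points, i.e. by its cone with the origin removed. *)

Definition pclosure {K : fieldType} {r : nat} (S : set 'rV[K]_r.+1) :
    set 'rV[K]_r.+1 :=
  [set v : 'rV[K]_r.+1 | v != 0 /\ forall (f : {mpoly K[r.+1]}) (d : nat),
    f \is d.-homog for mdeg -> (forall u, S u -> f.@[u 0] = 0) ->
    f.@[v 0] = 0].

Definition pclosed {K : fieldType} {r : nat} (Z : set 'rV[K]_r.+1) : Prop :=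
  pclosure Z = Z.

Definition pirreducible {K : fieldType} {r : nat} (Z : set 'rV[K]_r.+1) :
    Prop :=
  Z !=set0 /\ forall A B : set 'rV[K]_r.+1, pclosed A -> pclosed B ->
    Z `<=` A `|` B -> Z `<=` A \/ Z `<=` B.

Definition has_chain {K : fieldType} {r : nat} (Y : set 'rV[K]_r.+1)
    (d : nat) : Prop :=
  exists Z : nat -> set 'rV[K]_r.+1,
    (forall i, (i <= d)%N -> [/\ pclosed (Z i), pirreducible (Z i)
                               & Z i `<=` Y]) /\
    (forall i, (i < d)%N -> Z i `<` Z i.+1).

(* Krull dimension of a closed set *)
Definition has_dim {K : fieldType} {r : nat} (Y : set 'rV[K]_r.+1)
    (d : nat) : Prop :=
  has_chain Y d /\ ~ has_chain Y d.+1.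

Definition has_lin_dim {K : fieldType} {r : nat} (S : set 'rV[K]_r.+1)
    (d : nat) : Prop :=
  exists U : {vspace 'rV[K]_r.+1},
    \dim U = d.+1 /\ S = [set v : 'rV[K]_r.+1 | v != 0 /\ v \in U].

Definition linform {K : fieldType} {r : nat} (h : 'rV[K]_r.+1) :
    {mpoly K[r.+1]} :=
  \sum_(k < r.+1) h 0 k *: 'X_k.

Definition hyperplane {K : fieldType} {r : nat} (h : 'rV[K]_r.+1) :
    set 'rV[K]_r.+1 :=
  [set v : 'rV[K]_r.+1 | v != 0 /\ (linform h).@[v 0] = 0].

Definition pnondegenerate {K : fieldType} {r : nat} (X : set 'rV[K]_r.+1) :
    Prop :=
  forall h : 'rV[K]_r.+1, h != 0 -> ~ (X `<=` hyperplane h).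

(* The ideal I(Y) of a set of points of affine space; for the cone of a
   projective set it is generated by the homogeneous polynomials it contains. *)
Definition vanishing {K : fieldType} {N : nat} (Y : set 'rV[K]_N) :
    set {mpoly K[N]} :=
  [set f | forall y, Y y -> f.@[y 0] = 0].

(* embedded projective tangent space *)
Definition tangent_space {K : fieldType} {r : nat} (X : set 'rV[K]_r.+1)
    (p : 'rV[K]_r.+1) : set 'rV[K]_r.+1 :=
  [set v : 'rV[K]_r.+1 | v != 0 /\ forall f, vanishing X f ->
    \sum_(k < r.+1) (f^`M(k)).@[p 0] * v 0 k = 0].

(* Here n is the dimension of X, which is assumed to be irreducible. *)
Definition smooth_locus {K : fieldType} {r : nat} (n : nat)
    (X : set 'rV[K]_r.+1) : set 'rV[K]_r.+1 :=
  [set p | X p /\ has_lin_dim (tangent_space X p) n].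

Definition aclosure {K : fieldType} {N : nat} (S : set 'rV[K]_N) :
    set 'rV[K]_N :=
  [set v : 'rV[K]_N | forall f, vanishing S f -> f.@[v 0] = 0].

(* The chart {x_i <> 0} of P^r is identified with the affine hyperplane x_i = 1
   of K^(r+1); on it linform h is an equation of hyperplane h. *)
Definition affine_piece {K : fieldType} {r : nat} (X : set 'rV[K]_r.+1)
    (i : 'I_r.+1) : set 'rV[K]_r.+1 :=
  [set v | X v /\ v 0 i = 1].

Definition taylor {K : fieldType} {N : nat} (f : {mpoly K[N]})
    (p : 'rV[K]_N) : {mpoly K[N]} :=
  f \mPo [tuple 'X_k + (p 0 k)%:MP | k < N].

(* The restriction of f to Y lies in the k-th power of the maximal ideal of the
   local ring of Y at p, i.e. f belongs to I(Y) + m_p^k. No localization is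
   needed because this ideal is m_p-primary (or the unit ideal). *)
Definition ord_ge {K : fieldType} {N : nat} (k : nat) (Y : set 'rV[K]_N)
    (p : 'rV[K]_N) (f : {mpoly K[N]}) : Prop :=
  exists2 g : {mpoly K[N]}, vanishing Y (f - g) &
    forall m : 'X_{1..N}, (mdeg m < k)%N -> (taylor g p)@_m = 0.


Definition secant_union {K : fieldType} {r : nat} (k : nat)
    (X : set 'rV[K]_r.+1) : set 'rV[K]_r.+1 :=
  [set v : 'rV[K]_r.+1 | v != 0 /\ exists P : 'M[K]_(k.+1, r.+1),
    [/\ forall i, X (row i P), row_free P & (v <= P)%MS]].

Definition Sec {K : fieldType} {r : nat} (k : nat) (X : set 'rV[K]_r.+1) :
    set 'rV[K]_r.+1 :=
  pclosure (secant_union k X).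

Definition defective {K : fieldType} {r : nat} (k n : nat)
    (X : set 'rV[K]_r.+1) : Prop :=
  exists2 d, has_dim (Sec k X) d & (d < minn r (k * n + n + k))%N.


Definition smooth_curve {K : fieldType} {r : nat} (C : set 'rV[K]_r.+1) :
    Prop :=
  [/\ exists Z W : set 'rV[K]_r.+1, [/\ pclosed Z, pclosed W & C = Z `\` W],
      pirreducible C,
      has_dim (pclosure C) 1 &
      C `<=` smooth_locus 1 C].

(* The linear span of the divisor (m+1)p of the curve C, for p in the chart
   x_i = 1: the intersection of the hyperplanes that meet C at p with
   multiplicity at least m+1. *)
Definition osculating_space {K : fieldType} {r : nat} (m : nat)
    (C : set 'rV[K]_r.+1) (i : 'I_r.+1) (p : 'rV[K]_r.+1) :
    set 'rV[K]_r.+1 :=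
  [set v : 'rV[K]_r.+1 | v != 0 /\ forall h : 'rV[K]_r.+1,
    ord_ge m.+1 (affine_piece C i) p (linform h) -> (linform h).@[v 0] = 0].

Definition osculating_union {K : fieldType} {r : nat} (m n : nat)
    (X : set 'rV[K]_r.+1) : set 'rV[K]_r.+1 :=
  [set v | exists (C : set 'rV[K]_r.+1) (i : 'I_r.+1) (p : 'rV[K]_r.+1),
    [/\ smooth_curve C, C `<=` smooth_locus n X, affine_piece C i p,
        has_lin_dim (osculating_space m C i p) m &
        osculating_space m C i p v]].

Definition Osc {K : fieldType} {r : nat} (m n : nat) (X : set 'rV[K]_r.+1) :
    set 'rV[K]_r.+1 :=
  pclosure (osculating_union m n X).

Definition osculating_regular {K : fieldType} {r : nat} (m n : nat)
    (X : set 'rV[K]_r.+1) : Prop :=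
  has_dim (Osc m n X) (minn (m.+1 * n) r).


(* A vector of polynomials in t is used as a morphism Spec K[t]/(t^e) -> A^N:
   only its class modulo t^e matters. *)
Definition jet_eq {K : fieldType} {N : nat} (e : nat)
    (a b : 'rV[{poly K}]_N) : Prop :=
  forall k, 'X^e %| a 0 k - b 0 k.

Definition jet_point {K : fieldType} {N : nat} (a : 'rV[{poly K}]_N) :
    'rV[K]_N :=
  map_mx (fun q : {poly K} => q`_0) a.

Definition jet_in {K : fieldType} {N : nat} (e : nat) (Y : set 'rV[K]_N)
    (a : 'rV[{poly K}]_N) : Prop :=
  forall f, vanishing Y f -> 'X^e %| mmap (@polyC K) (a 0) f.

(* A subscheme of Y isomorphic to Spec K[t]/(t^3), given by a closed immersion
   of Spec K[t]/(t^3) in Y: a jet is a closed immersion if and only if its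
   derivative at t = 0 does not vanish. *)
Definition curvilinear3 {K : fieldType} {N : nat} (Y : set 'rV[K]_N)
    (gamma : 'rV[{poly K}]_N) : Prop :=
  jet_in 3 Y gamma /\ exists j, (gamma 0 j)`_1 != 0.

(* The j-th standard affine chart of the blow-up of A^N at p, with its
   projection to A^N; the exceptional divisor is y_j = 0. *)
Definition blowup_chart {A : comNzRingType} {N : nat} (j : 'I_N)
    (p y : 'rV[A]_N) : 'rV[A]_N :=
  \row_k (p 0 k + y 0 j * (if k == j then 1 else y 0 k)).

(* In this chart, the blow-up of Y at p *)
Definition blowup {K : fieldType} {N : nat} (j : 'I_N) (p : 'rV[K]_N)
    (Y : set 'rV[K]_N) : set 'rV[K]_N :=
  aclosure (blowup_chart j p @^-1` (Y `\ p)).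

(* a' is the lift of the jet a (of order e and nonzero derivative along the
   j-th coordinate) to the blow-up at its point p. This determines a' modulo
   t^(e-1) only, which is the strict transform. *)
Definition jet_strict_transform {K : fieldType} {N : nat} (e : nat)
    (j : 'I_N) (a a' : 'rV[{poly K}]_N) : Prop :=
  jet_eq e (blowup_chart j (map_mx (@polyC K) (jet_point a)) a') a.

(* If D is the divisor with equation f on Y, then g is an equation of
   sigma^* D - 2 E on the blow-up of Y at p. *)
Definition divisor_transform {K : fieldType} {N : nat} (j : 'I_N)
    (p : 'rV[K]_N) (Y : set 'rV[K]_N) (f g : {mpoly K[N]}) : Prop :=
  forall y, blowup j p Y y ->
    f.@[(blowup_chart j p y) 0] = y 0 j ^+ 2 * g.@[y 0].

(* Both infinitely near points lie in the j-th charts as soon as the derivative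
   of gamma along the j-th coordinate is nonzero; the choice of j, gamma1,
   gamma2, g1 and g2 is immaterial. *)
Definition singular_along {K : fieldType} {N : nat} (Y : set 'rV[K]_N)
    (gamma : 'rV[{poly K}]_N) (f : {mpoly K[N]}) : Prop :=
  exists (j : 'I_N) (gamma1 gamma2 : 'rV[{poly K}]_N) (g1 g2 : {mpoly K[N]}),
    let p  := jet_point gamma in
    let p1 := jet_point gamma1 in
    let p2 := jet_point gamma2 in
    let Y1 := blowup j p Y in
    let Y2 := blowup j p1 Y1 in
    [/\ (gamma 0 j)`_1 != 0,
        jet_strict_transform 3 j gamma gamma1 /\
          jet_strict_transform 2 j gamma1 gamma2,
        ord_ge 2 Y p f,
        divisor_transform j p Y f g1 /\ ord_ge 2 Y1 p1 g1 &
        divisor_transform j p1 Y1 g1 g2 /\ ord_ge 2 Y2 p2 g2].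

Definition tangent_along {K : fieldType} {r : nat} (X : set 'rV[K]_r.+1)
    (i : 'I_r.+1) (gamma : 'rV[{poly K}]_r.+1) : set 'rV[K]_r.+1 :=
  [set v : 'rV[K]_r.+1 | v != 0 /\ forall h : 'rV[K]_r.+1, h != 0 ->
    singular_along (affine_piece X i) gamma (linform h) -> hyperplane h v].

Definition special_along {K : fieldType} {r : nat} (n : nat)
    (X : set 'rV[K]_r.+1) (i : 'I_r.+1) (gamma : 'rV[{poly K}]_r.+1) : Prop :=
  exists2 d, has_lin_dim (tangent_along X i gamma) d &
    (d < minn r (3 * n.+1 - 1))%N.

(* Main.v *)
(* Let t |-> x be a generic arc of X, with coordinates u = u0 + u1 t + u2 t^2 +
   u3 t^3 (mod t^4) in a system of etale coordinates of the cone over X, let d_k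
   and b_k be the derivations along u0_k and u2_k, and D the infinitesimal
   translation of t. Let W be spanned by the vectors D^j (d_k x), j <= 2. The
   derivatives of D^2 x lie in W and the points D^2 x fill Osc_2(X), so that
   osculating regularity gives rank W >= 3n+1. A hyperplane section that is
   singular along a scheme of length 3 vanishes to order 6 on the arcs through
   this scheme, so that condition (i) gives rank <W, D^4 x, D^5 x> <= 3n+2.
   Differentiating the linear relation implied by these two bounds shows that
   T = W + <D^4 x> is stable under D' = D + sum_k rho_k b_k for some functions
   rho_k. Then T lies in a hyperplane H of a coordinate space of dimension 3n+3
   with D' H = 0, so that along the formal curve x(tau) = exp(tau D') x all the
   tangent spaces of X remain in H.

   If Sec_2(X) had dimension 3n+2, then by Terracini's lemma the determinant of
   the tangent spaces of X at three points would be a nonzero function on X^3,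
   algebraic over the coordinates u of these points. As it vanishes at
   x(0), x(tau), x(2 tau), the coordinates u of these three points would be
   algebraically dependent. But their Jacobian matrix with respect to u0, u1, u2
   is, up to higher order in tau, a Vandermonde matrix. *)
Require Import Defs.
From HB Require Import structures.
From mathcomp Require Import all_boot all_order all_algebra.
From mathcomp Require Import boolp classical_sets.
From mathcomp Require Import ring zify.
Set Implicit Arguments.
Unset Strict Implicit.
Unset Printing Implicit Defensive.
Import GRing.Theory Num.Theory.
Local Open Scope ring_scope.

(** * Derivations and generic points *)

Section Evaluation.
Variables (K B : comNzRingType) (iota : {rmorphism K -> B}) (N : nat).
Implicit Types (v : 'I_N -> B) (p q : {mpoly K[N]}).

(** A variety is handled through its function field: tangent vectors become derivations of this
    field, and a lower bound on a dimension becomes a set of coordinates that are algebraically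
    independent on the variety. The coefficient u3 is carried along because arcs that differ only in
    u3 contain the same scheme of length 3, while their coefficients of t^3, t^4, t^5 differ by
    multiples of d_k x, D d_k x, D^2 d_k x; this is how W enters the space bounded by (i). The
    delicate case is that of D^4 x in W, where D^5 x must be shown to lie in W as well. The
    correction of D uses the b_k because they act on W and yet keep D' u0 = u1 and D'^2 u0 = 2 u2,
    on which the Vandermonde matrix depends: an a_k would change D'^2 u0, and the derivations along
    u3 kill the rows of W. The flow of D' exists only formally, since the rho_k are mere elements of
    the function field; hence the points of X with values in power series over that field, to which
    algebraic relations on X^3 have to be carried. *)

Lemma mpoly_ring_ind (P : {mpoly K[N]} -> Prop) :
    (forall c, P c%:MP) -> (forall i, P 'X_i) ->
    (forall p q, P p -> P q -> P (p + q)) ->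
    (forall p q, P p -> P q -> P (p * q)) -> forall p, P p.
Proof.
move=> PC PX PD PM; elim/mpolyind => [|c m p _ _ Pp]; first by rewrite -mpolyC0.
apply: (PD) Pp; rewrite -mul_mpolyC; apply: (PM) => //.
rewrite mpolyXE_id; elim/big_rec: _ => [|i q _ Pq]; first by rewrite -mpolyC1.
apply: (PM) Pq; elim: (m i) => [|k IHk]; first by rewrite expr0 -mpolyC1.
by rewrite exprS; apply: (PM).
Qed.

Lemma eq_mmap v w p : v =1 w -> mmap iota v p = mmap iota w p.
Proof.
move=> eqvw; apply: eq_bigr => m _; congr (_ * _).
by apply: eq_bigr => i _; rewrite eqvw.
Qed.

Definition derivation (D : B -> B) : Prop :=
  [/\ forall a b, D (a + b) = D a + D b,
      forall a b, D (a * b) = D a * b + a * D b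
    & forall c, D (iota c) = 0].

Section Derivation.
Variables (D : B -> B) (hD : derivation D).

Lemma derD_add a b : D (a + b) = D a + D b. Proof. by case: hD. Qed.
Lemma derD_mul a b : D (a * b) = D a * b + a * D b. Proof. by case: hD. Qed.
Lemma derD_cst c : D (iota c) = 0. Proof. by case: hD. Qed.
Lemma derD_0 : D 0 = 0.
Proof. by rewrite -(rmorph0 iota) derD_cst rmorph0. Qed.
Lemma derD_1 : D 1 = 0. Proof. by rewrite -(rmorph1 iota) derD_cst. Qed.
Lemma derD_opp a : D (- a) = - D a.
Proof. by apply/eqP; rewrite -addr_eq0 -derD_add addNr derD_0. Qed.
Lemma derD_sum I (r : seq I) (P : pred I) F :
  D (\sum_(i <- r | P i) F i) = \sum_(i <- r | P i) D (F i).
Proof. exact: (big_morph D derD_add derD_0). Qed.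
Lemma derD_natr n : D n%:R = 0.
Proof. by rewrite -(rmorph_nat iota) derD_cst. Qed.
Lemma derD_mmap v p :
  D (mmap iota v p) = \sum_i mmap iota v p^`M(i) * D (v i).
Proof.
elim/mpoly_ring_ind: p => [c|i|p q IHp IHq|p q IHp IHq].
- rewrite mmapC derD_cst big1 // => i _.
  by rewrite mderivC mmap0 mul0r.
- have sub0 : (U_(i) - U_(i) = 0 :> 'X_{1..N})%MM.
    by apply/mnmP => j; rewrite mnmBE mnm0E subnn.
  rewrite mmapX mmap1U (bigD1 i) //= mderivX mnm1E eqxx sub0.
  rewrite mpolyX0 scale1r rmorph1 mul1r big1 ?addr0 // => j ne_ji.
  by rewrite mderivX mnm1E eq_sym (negbTE ne_ji) scale0r mmap0 mul0r.
- rewrite mmapD derD_add IHp IHq -big_split /=; apply: eq_bigr => i _.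
  by rewrite mderivD mmapD mulrDl.
- rewrite rmorphM derD_mul IHp IHq mulr_suml mulr_sumr -big_split /=.
  apply: eq_bigr => i _; rewrite mderivM mmapD !rmorphM /=; ring.
Qed.

Lemma derD2_mmap v p : D (D (mmap iota v p)) =
  \sum_i (\sum_j mmap iota v p^`M(i)^`M(j) * D (v j)) * D (v i) +
  \sum_i mmap iota v p^`M(i) * D (D (v i)).
Proof.
rewrite derD_mmap derD_sum -big_split; apply: eq_bigr => i _.
by rewrite derD_mul derD_mmap.
Qed.

End Derivation.
End Evaluation.

Lemma rmorph_mmap_comp (K B C : comNzRingType) (i : {rmorphism K -> B})
    (j : {rmorphism K -> C}) (f : {rmorphism B -> C}) (fij : f \o i =1 j)
    N (v : 'I_N -> B) (w : 'I_N -> C) (fvw : forall k, f (v k) = w k) p :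
  f (mmap i v p) = mmap j w p.
Proof.
elim/mpoly_ring_ind: p => [c|k|p q IHp IHq|p q IHp IHq].
- by rewrite !mmapC; apply: fij.
- by rewrite !mmapX !mmap1U.
- by rewrite !mmapD rmorphD IHp IHq.
- by rewrite !rmorphM /= IHp IHq.
Qed.

Lemma mmap_comp (K B : comNzRingType) (i : {rmorphism K -> B})
    N M (v : 'I_N -> {mpoly K[M]}) (w : 'I_M -> B) p :
  mmap i w (mmap (@mpolyC M K) v p) = mmap i (fun k => mmap i w (v k)) p.
Proof.
by apply: (rmorph_mmap_comp (f := mmap i w)) => // c /=; rewrite mmapC.
Qed.

Lemma fraction_repr (R : idomainType) (e : {fraction R}) :
  exists a b : R, b != 0 /\ e = FracField.tofrac a / FracField.tofrac b.
Proof.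
rewrite -[e]reprK; case: (repr e) => -[a b] /= b0.
exists a, b; split => //.
have tb0 : FracField.tofrac b != 0 by rewrite tofrac_eq0.
apply: (canRL (mulfK tb0)); apply/eqP.
rewrite -[X in X == _]/(FracField.mul _ _) /FracField.tofrac; unlock; rewrite !piE.
rewrite FracField.equivfE /=.
rewrite /FracField.mulf /= !numden_Ratio ?oner_eq0 ?mulf_neq0 ?oner_eq0 //=.
by rewrite !mulr1 mulrC.
Qed.

Section DomainFraction.
Variables (Q : comNzRingType) (domQ : forall x y : Q, x * y = 0 -> x = 0 \/ y = 0).

Let unit : pred Q := fun x => `[< exists y, y * x = 1 >].
Let inv (x : Q) : Q :=
  if pselect (exists y, y * x = 1) is left e then projT1 (cid e) else x.

(** Units and inverses are chosen classically; this makes [Q] an integral domain type, whose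
    fraction field can be formed. *)
Lemma domain_fraction : exists (E : fieldType) (phi : {rmorphism Q -> E}),
  injective phi /\
  forall e, exists a b, b != 0 /\ e = phi a / phi b.
Proof.
have mulV : {in unit, left_inverse 1 inv *%R}.
  move=> x /asboolP ex; rewrite /inv; case: pselect => // e.
  by case: (cid e).
have unitPl x y : y * x = 1 -> unit x by move=> yx; apply/asboolP; exists y.
have inv_out : {in [predC unit], inv =1 id}.
  move=> x /negP nx; rewrite /inv; case: pselect => // e.
  by case: nx; apply/asboolP.
pose Qu : comUnitRingType := HB.pack (Q : Type)
  (GRing.ComNzRing.class Q)
  (GRing.ComNzRing_hasMulInverse.Build Q mulV unitPl inv_out).
have dom (x y : Qu) : x * y = 0 -> (x == 0) || (y == 0).
  by case/(domQ (x := x)) => ->; rewrite eqxx ?orbT.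
pose Qd : idomainType := HB.pack (Qu : Type) (GRing.ComUnitRing.class Qu)
  (GRing.ComUnitRing_isIntegral.Build Qu dom).
pose phi : {rmorphism Qd -> {fraction Qd}} := @FracField.tofrac Qd.
exists {fraction Qd}, (phi : {rmorphism Q -> {fraction Qd}}); split.
  by move=> x y /eqP; rewrite (@tofrac_eq Qd) => /eqP.
exact: fraction_repr.
Qed.
End DomainFraction.

(** The field is the fraction field of the quotient of [A] by the prime ideal [I]. *)
Lemma prime_residue_field (A : comNzRingType) (I : A -> Prop)
    (I1 : ~ I 1) (IB : forall a b, I a -> I b -> I (a - b)) (I0 : I 0)
    (IM : forall a b, I b -> I (a * b))
    (Ip : forall a b, I (a * b) -> I a \/ I b) :
  exists (E : fieldType) (phi : {rmorphism A -> E}),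
    (forall a, phi a = 0 <-> I a) /\
    forall e, exists a b, phi b != 0 /\ e = phi a / phi b.
Proof.
pose J : A -> bool := fun a => `[< I a >].
have Jclosed : idealr_closed J.
  split; first exact/asboolP; first by apply/negP => /asboolP.
  move=> a u v /asboolP Iu /asboolP Iv; apply/asboolP.
  rewrite -[v]opprK; apply: (IB) (IM _ _ Iu) _.
  by rewrite -[- v]add0r; apply: IB.
have Jprime : prime_idealr_closed J.
  by move=> u v /asboolP /Ip [] Iw; apply/orP; [left|right]; apply/asboolP.
pose JP : prime_idealr A := HB.pack J (isIdealr.Build A J Jclosed)
  (isPrimeIdealrClosed.Build A J Jprime).
pose Q : comNzRingType := {ideal_quot JP}.
have domQ (x y : Q) : x * y = 0 -> x = 0 \/ y = 0.
  by move=> /(@Quotient.rquot_IdomainAxiom _ JP) /orP [] /eqP; [left|right].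
have [E [phi [phi_inj phi_frac]]] := domain_fraction domQ.
pose pi : {rmorphism A -> Q} := (\pi_({ideal_quot JP}))%qT.
exists E, (phi \o pi); split=> [a|e].
  rewrite /= -(rmorph0 phi); split=> [/phi_inj|Ia].
    rewrite -(rmorph0 pi) => /eqP; rewrite -Quotient.idealrBE subr0.
    by move/asboolP.
  congr (phi _); apply/eqP; rewrite -(rmorph0 pi) -Quotient.idealrBE subr0.
  exact/asboolP.
have [a [b [b0 ->]]] := phi_frac e.
exists (repr a), (repr b); rewrite /= !reprK.
by rewrite (raddf_eq0 _ phi_inj).
Qed.

Section AffineSets.
Variables (K : fieldType) (N : nat).
Implicit Types (S : ('I_N -> K) -> Prop) (p q : {mpoly K[N]}).

Definition vanish_on S p : Prop := forall v, S v -> p.@[v] = 0.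

(** Irreducibility of the Zariski closure of [S] in affine space. *)
Definition aprime S : Prop :=
  (exists v, S v) /\
  forall p q, vanish_on S (p * q) -> vanish_on S p \/ vanish_on S q.

(** [E] is the function field of the closure of [S], and [xi] is the tuple of its coordinate
    functions. *)
Definition generic_point S (E : fieldType) (iota : {rmorphism K -> E})
    (xi : 'I_N -> E) : Prop :=
  (forall p, mmap iota xi p = 0 <-> vanish_on S p) /\
  forall e, exists a b, mmap iota xi b != 0 /\
                        e = mmap iota xi a / mmap iota xi b.

Lemma exists_generic_point S : aprime S ->
  exists (E : fieldType) (iota : {rmorphism K -> E}) (xi : 'I_N -> E),
    generic_point S iota xi.
Proof.
move=> [[v0 Sv0] Sprime].
have [] := @prime_residue_field _ (vanish_on S).
- by move=> /(_ _ Sv0) /eqP; rewrite meval1 oner_eq0.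
- by move=> a b Ia Ib v Sv; rewrite mevalB Ia // Ib // subr0.
- by move=> v _; rewrite meval0.
- by move=> a b Ib v Sv; rewrite mevalM Ib // mulr0.
- exact: Sprime.
move=> E [phi [phi0 phi_frac]].
pose iota : {rmorphism K -> E} := phi \o (@mpolyC N K).
have phiE p : phi p = mmap iota (fun i => phi 'X_i) p.
  elim/mpoly_ring_ind: p => [c|i|p q IHp IHq|p q IHp IHq].
  - by rewrite mmapC.
  - by rewrite mmapX mmap1U.
  - by rewrite rmorphD mmapD IHp IHq.
  - by rewrite !rmorphM IHp IHq.
exists E, iota, (fun i => phi 'X_i); split=> [p|e]; first by rewrite -phiE.
by have [a [b [b0 eE]]] := phi_frac e; exists a, b; rewrite -!phiE.
Qed.

End AffineSets.

(** * Extension of derivations in characteristic 0 *)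

Section Extension.
Variable E : fieldType.
Hypothesis char0 : forall n, n.+1%:R != 0 :> E.
Implicit Types (S : E -> Prop) (D : E -> E).

(** A derivation defined on the subring [S] only: [D] is a total function whose values outside [S]
    carry no meaning. The domain can thus grow one element at a time inside the fixed field [E]. *)
Definition partial_der S D : Prop :=
  [/\ S 1, (forall a b, S a -> S b -> S (a - b)),
      (forall a b, S a -> S b -> S (a * b)),
      (forall a b, S a -> S b -> D (a + b) = D a + D b)
    & (forall a b, S a -> S b -> D (a * b) = D a * b + a * D b)].

Definition extends S D S' D' : Prop :=
  (forall a, S a -> S' a) /\ (forall a, S a -> D' a = D a).

Definition pOver S (q : {poly E}) := forall i, S q`_i.

Section One.
Variables (S : E -> Prop) (D : E -> E).
Hypothesis SD : partial_der S D.

Let S1 : S 1. Proof. by case: SD. Qed.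
Let SB a b : S a -> S b -> S (a - b). Proof. by case: SD => _ + _ _ _; apply. Qed.
Let SM a b : S a -> S b -> S (a * b). Proof. by case: SD => _ _ + _ _; apply. Qed.
Let S0 : S 0. Proof. by rewrite -(subrr 1); apply: SB. Qed.
Let SN a : S a -> S (- a). Proof. by move=> Sa; rewrite -sub0r; apply: SB. Qed.
Let SA a b : S a -> S b -> S (a + b).
Proof. by move=> Sa Sb; rewrite -[b]opprK; apply: SB => //; apply: SN. Qed.
Let DA a b : S a -> S b -> D (a + b) = D a + D b.
Proof. by case: SD => _ _ _ + _; apply. Qed.
Let DM a b : S a -> S b -> D (a * b) = D a * b + a * D b.
Proof. by case: SD => _ _ _ _; apply. Qed.
Let D0 : D 0 = 0.
Proof. by apply: (addrI (D 0)); rewrite -DA // addr0 addr0. Qed.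
Let D1 : D 1 = 0.
Proof. by apply: (addrI (D 1)); rewrite addr0 -{3}[1]mulr1 DM // mulr1 mul1r. Qed.

Let Ssum I (r : seq I) (P : pred I) F :
  (forall i, P i -> S (F i)) -> S (\sum_(i <- r | P i) F i).
Proof. by move=> SF; elim/big_rec: _ => // i x Pi Sx; apply: SA => //; apply: SF. Qed.
Let Dsum I (r : seq I) (P : pred I) F : (forall i, P i -> S (F i)) ->
  D (\sum_(i <- r | P i) F i) = \sum_(i <- r | P i) D (F i).
Proof.
move=> SF; suff [] : S (\sum_(i <- r | P i) F i) /\
  D (\sum_(i <- r | P i) F i) = \sum_(i <- r | P i) D (F i) by [].
elim/big_rec2: _ => // i x y Pi [Sy <-].
by split; [apply: SA => //; apply: SF | rewrite DA //; apply: SF].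
Qed.
Let Smuln a n : S a -> S (a *+ n).
Proof. by move=> Sa; elim: n => [|n IH]; rewrite ?mulr0n // mulrS; apply: SA. Qed.
Let pD q := map_poly D q.
Let pDE q i : (pD q)`_i = D q`_i. Proof. by rewrite coef_map_id0. Qed.
Let pDA p q : pOver S p -> pOver S q -> pD (p + q) = pD p + pD q.
Proof. by move=> Sp Sq; apply/polyP => i; rewrite coefD !pDE coefD DA. Qed.
Let pSM p q : pOver S p -> pOver S q -> pOver S (p * q).
Proof. by move=> Sp Sq i; rewrite coefM; apply: Ssum => j _; apply: SM. Qed.
Let pSA p q : pOver S p -> pOver S q -> pOver S (p + q).
Proof. by move=> Sp Sq i; rewrite coefD; apply: SA. Qed.
Let pSB p q : pOver S p -> pOver S q -> pOver S (p - q).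
Proof. by move=> Sp Sq i; rewrite coefB; apply: SB. Qed.
Let pDM p q : pOver S p -> pOver S q -> pD (p * q) = pD p * q + p * pD q.
Proof.
move=> Sp Sq; apply/polyP => i; rewrite coefD !pDE !coefM.
rewrite Dsum => [|j _]; last exact: SM.
by rewrite -big_split; apply: eq_bigr => j _ /=; rewrite DM // !pDE.
Qed.
Let pSd p : pOver S p -> pOver S p^`().
Proof. by move=> Sp i; rewrite coef_deriv; apply: Smuln. Qed.
Let pSC a : S a -> pOver S a%:P.
Proof. by move=> Sa i; rewrite coefC; case: ifP. Qed.
Let pSX : pOver S 'X.
Proof. by move=> i; rewrite coefX; case: (i == 1%N). Qed.
Let pDC a : pD a%:P = (D a)%:P.
Proof. by apply/polyP => i; rewrite pDE !coefC; case: ifP. Qed.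
Let pDX : pD 'X = 0.
Proof. by apply/polyP => i; rewrite pDE coefX coef0; case: (i == 1%N). Qed.

(** The only possible value at [q.[e]] of an extension of [D] with value [c] at [e]. *)
Let lift e c q := (pD q).[e] + q^`().[e] * c.

(** The extension to the ring generated by [S] and [e] sends [q.[e]] to [lift e c q]; the hypothesis
    makes this independent of the choice of [q]. *)
Let adjoin_compat e c :
    (forall q, pOver S q -> q.[e] = 0 -> lift e c q = 0) ->
  exists S' D', [/\ partial_der S' D', extends S D S' D', S' e & D' e = c].
Proof.
move=> compat.
pose S' y := exists q, pOver S q /\ y = q.[e].
pose D' y := if pselect (S' y) is left h then lift e c (projT1 (cid h)) else 0.
have liftB p q : pOver S p -> pOver S q -> lift e c (p - q) = lift e c p - lift e c q.
  move=> Sp Sq; have pDB : pD (p - q) = pD p - pD q.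
    apply: (canRL (addrK _)); rewrite -pDA ?subrK //; exact: pSB.
  by rewrite /lift pDB derivB !hornerE; ring.
have D'E q : pOver S q -> D' q.[e] = lift e c q.
  move=> Sq; rewrite /D'; case: pselect => [h|[]]; last by exists q.
  case: (cid h) => q' /= [Sq' qq']; apply/eqP.
  rewrite -subr_eq0 -liftB //; apply/eqP/compat; first exact: pSB.
  by rewrite hornerD hornerN -qq' subrr.
exists S', D'; split.
- split.
  + by exists 1; rewrite hornerE; split => //; rewrite -polyC1; apply: pSC.
  + move=> _ _ [p [Sp ->]] [q [Sq ->]]; exists (p - q).
    by rewrite hornerD hornerN; split => //; apply: pSB.
  + move=> _ _ [p [Sp ->]] [q [Sq ->]]; exists (p * q).
    by rewrite hornerM; split => //; apply: pSM.
  + move=> _ _ [p [Sp ->]] [q [Sq ->]].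
    rewrite -hornerD !D'E ?/lift //; last exact: pSA.
    by rewrite pDA // derivD !hornerD; ring.
  + move=> _ _ [p [Sp ->]] [q [Sq ->]].
    rewrite -hornerM !D'E ?/lift //; last exact: pSM.
    by rewrite pDM // derivM !hornerE; ring.
- split=> a Sa; first by exists a%:P; rewrite hornerC; split => //; apply: pSC.
  have -> : a = a%:P.[e] by rewrite hornerC.
  rewrite D'E /lift; last exact: pSC.
  by rewrite pDC derivC !hornerC mul0r addr0.
- by exists 'X; rewrite hornerX.
- have -> : D' e = D' 'X.[e] by rewrite hornerX.
  by rewrite D'E // /lift pDX derivX hornerC hornerC add0r mul1r.
Qed.

Definition transcendental e := forall q, pOver S q -> q.[e] = 0 -> q = 0.

Lemma adjoin_transcendental e c : transcendental e ->
  exists S' D', [/\ partial_der S' D', extends S D S' D', S' e & D' e = c].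
Proof.
move=> tr; apply: adjoin_compat => q Sq /(tr _ Sq) ->.
have -> : lift e c 0 = (pD 0).[e] + 0 * c by rewrite /lift deriv0 horner0.
by rewrite -polyC0 pDC D0 horner0 mul0r addr0.
Qed.

Lemma minimal_relation e : ~ transcendental e ->
  exists P, [/\ pOver S P, P != 0, P.[e] = 0
    & forall q, pOver S q -> q.[e] = 0 -> (size q < size P)%N -> q = 0].
Proof.
move=> ntr.
have : exists n, `[< exists P, [/\ pOver S P, P != 0, P.[e] = 0 & size P = n] >].
  apply: contrapT => nex; apply: ntr => q Sq q0; apply/eqP/negP => /negP qn0.
  by apply: nex; exists (size q); apply/asboolP; exists q.
move=> ex; case: (ex_minnP ex) => n /asboolP [P [SP P0 Pe sP]] min.
exists P; split => // q Sq qe; rewrite sP ltnNge => /negP nle.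
apply/eqP/negP => /negP qn0; apply: nle; apply: min.
by apply/asboolP; exists q.
Qed.

(** A transcendental [e] may take any value. If [e] is algebraic, the derivative of a relation [P]
    of least degree does not vanish at [e] in characteristic 0, so that differentiating [P.[e] = 0]
    determines the value at [e]. *)
Lemma adjoin e :
  exists S' D', [/\ partial_der S' D', extends S D S' D' & S' e].
Proof.
case: (pselect (transcendental e)) => [tr|].
  by have [S' [D' [? ? ? _]]] := adjoin_transcendental 0 tr; exists S', D'.
move/minimal_relation => [P [SP P0 Pe Pmin]].
have sP : (1 < size P)%N.
  rewrite ltnNge; apply/negP => /size1_polyC PC.
  by move: P0 Pe; rewrite PC hornerC polyC_eq0 => /eqP.
have P'e : P^`().[e] != 0.
  apply/eqP => P'e; have := Pmin _ (pSd SP) P'e.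
  rewrite (leq_ltn_trans (size_poly _ _)) ?prednK ?(ltn_trans _ sP) //.
  move=> /(_ isT) /polyP /(_ (size P).-2); rewrite coef_deriv coef0.
  have -> : (size P).-2.+1 = (size P).-1 by lia.
  rewrite -mulr_natr => /eqP; rewrite mulf_eq0 -/(lead_coef P) lead_coef_eq0.
  rewrite (negbTE P0) /=; case: (size P) sP => [|[|s]] // _.
  by rewrite (negbTE (char0 _)).
have [c Pc] : exists c, lift e c P = 0.
  exists (- (pD P).[e] / P^`().[e]).
  by rewrite /lift mulrCA divff // mulr1 subrr.
suff [S' [D' [? ? ? _]]] : exists S' D',
    [/\ partial_der S' D', extends S D S' D', S' e & D' e = c] by exists S', D'.
(* pseudo-division by P stays over S *)
have pdiv q : pOver S q -> exists l s m, [/\ S l, l != 0, pOver S s, pOver S m &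
    l *: q = s * P + m /\ (size m < size P)%N].
  move: {2}(size q).+1 (ltnSn (size q)) => k.
  elim: k q => // k IH q sq Sq.
  have [small|big] := ltnP (size q) (size P).
    exists 1, 0, q; split => //; first exact: oner_neq0.
      by rewrite -polyC0; apply: pSC.
    by rewrite scale1r mul0r add0r.
  pose a := lead_coef P; pose b := lead_coef q.
  pose d := (size q - size P)%N.
  pose q1 := a *: q - b *: ('X^d * P).
  have Sa : S a by apply: SP. have Sb : S b by apply: Sq.
  have SXd : pOver S 'X^d.
    by move=> i; rewrite coefXn; case: (i == d).
  have SZ x p : S x -> pOver S p -> pOver S (x *: p).
    by move=> Sx Sp i; rewrite coefZ; apply: SM.
  have Sq1 : pOver S q1 by apply: pSB; apply: SZ => //; apply: pSM.
  have sq1 : (size q1 < size q)%N.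
    have q0 : (0 < size q)%N by lia.
    rewrite -(prednK q0) ltnS; apply/leq_sizeP => j lej.
    rewrite coefB !coefZ coefXnM.
    have dj : (j < d)%N = false by rewrite /d; lia.
    rewrite dj; move: lej; rewrite leq_eqVlt => /orP [/eqP <-|ltj].
      have -> : ((size q).-1 - d)%N = (size P).-1 by rewrite /d; lia.
      by rewrite -/(lead_coef q) -/(lead_coef P) /a /b mulrC subrr.
    have lePj : (size P <= j - d)%N by move: ltj big q0; rewrite /d; lia.
    have leqj : (size q <= j)%N by move: ltj q0; lia.
    by rewrite (nth_default 0 leqj) (nth_default 0 lePj) !mulr0 subr0.
  have [|l [s [m [Sl l0 Ss Sm [eqm sm]]]]] := IH q1 _ Sq1; first by lia.
  exists (l * a), (s + (l * b) *: 'X^d), m; split => //; first exact: SM.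
  - by rewrite mulf_neq0 // lead_coef_eq0.
  - by apply: pSA => //; apply: SZ => //; apply: SM.
  - split => //; move: eqm; rewrite /q1 scalerBr !scalerA => /eqP.
    by rewrite subr_eq => /eqP ->; rewrite mulrDl -scalerAl addrAC.
(* By minimality [P] divides a nonzero multiple of each relation [q], and compatibility for [q]
   follows from that for [P]. *)
apply: adjoin_compat => q Sq qe.
have [l [s [m [Sl l0 Ss Sm [eqm sm]]]]] := pdiv q Sq.
have m0 : m = 0.
  apply: Pmin => //; have : (l *: q).[e] = 0 by rewrite hornerZ qe mulr0.
  by rewrite eqm hornerD hornerM Pe mulr0 add0r.
move: eqm; rewrite m0 addr0 -mul_polyC => eqm.
have : lift e c (l%:P * q) = l * lift e c q.
  rewrite /lift pDM ?pDC //; last exact: pSC.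
  by rewrite derivM derivC mul0r add0r !(hornerD, hornerM, hornerC) qe; ring.
rewrite eqm.
have -> : lift e c (s * P) = s.[e] * lift e c P.
  by rewrite /lift pDM // derivM !(hornerD, hornerM, hornerC) Pe; ring.
by rewrite Pc mulr0 => /esym/eqP; rewrite mulf_eq0 (negbTE l0) => /eqP.
Qed.

End One.

Lemma adjoin_seq (s : seq E) S D : partial_der S D ->
  exists S' D', [/\ partial_der S' D', extends S D S' D' &
                    forall e, e \in s -> S' e].
Proof.
elim: s S D => [|e s IH] S D SD; first by exists S, D; split => //; split.
have [S1 [D1 [SD1 [e1 e1'] S1e]]] := adjoin SD e.
have [S2 [D2 [SD2 [e2 e2'] S2s]]] := IH _ _ SD1.
exists S2, D2; split => //.
  by split=> a Sa; [apply/e2/e1 | rewrite e2' ?e1' //; apply: e1].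
by move=> f; rewrite inE => /orP [/eqP ->|/S2s //]; apply: e2.
Qed.

(** The extension is given by the quotient rule; [D'E] shows that its value does not depend on the
    fraction that represents an element. *)
Lemma extend_fractions S D : partial_der S D ->
    (forall e, exists a b, [/\ S a, S b, b != 0 & e = a / b]) ->
  exists D', [/\ forall a b, D' (a + b) = D' a + D' b,
    forall a b, D' (a * b) = D' a * b + a * D' b & forall a, S a -> D' a = D a].
Proof.
case=> S1 SB SM DA DM frac.
have S0 : S 0 by rewrite -(subrr 1); apply: SB.
have SN a : S a -> S (- a) by move=> Sa; rewrite -sub0r; apply: SB.
have SA a b : S a -> S b -> S (a + b).
  by move=> Sa Sb; rewrite -[b]opprK; apply: SB => //; apply: SN.
pose nu e := projT1 (cid (frac e)).
have denP e : exists b, [/\ S (nu e), S b, b != 0 & e = nu e / b].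
  by rewrite /nu; case: (cid (frac e)).
pose de e := projT1 (cid (denP e)).
have P e : [/\ S (nu e), S (de e), de e != 0 & e = nu e / de e].
  by rewrite /de; case: (cid (denP e)).
pose D' e := (D (nu e) * de e - nu e * D (de e)) / de e ^+ 2.
have D'E a b : S a -> S b -> b != 0 -> D' (a / b) = (D a * b - a * D b) / b ^+ 2.
  move=> Sa Sb b0; rewrite /D'; move: (P (a / b)).
  set u := nu _; set w := de _ => -[Su Sw w0 /eqP].
  rewrite eqr_div // => /eqP auw.
  have := DM _ _ Sa Sw; rewrite auw DM // => Dauw.
  apply/eqP; rewrite eqr_div ?expf_neq0 //; apply/eqP.
  have Ea : a = u * b / w by rewrite -auw mulfK.
  have EDa : D a = (D u * b + u * D b - a * D w) / w.
    by apply: (canRL (mulfK w0)); rewrite Dauw addrK.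
  by rewrite EDa Ea; field; rewrite w0.
exists D'; split.
- move=> a b; have [Sna Sda da0 ->] := P a; have [Snb Sdb db0 ->] := P b.
  set na := nu a in Sna *; set ma := de a in Sda da0 *.
  set nb := nu b in Snb *; set mb := de b in Sdb db0 *.
  have -> : na / ma + nb / mb = (na * mb + nb * ma) / (ma * mb).
    by field; rewrite da0 db0.
  rewrite !D'E ?mulf_neq0 //; [|by apply: SA; apply: SM|exact: SM].
  rewrite DA ?DM //; [|exact: SM|exact: SM].
  by field; rewrite da0 db0.
- move=> a b; have [Sna Sda da0 ->] := P a; have [Snb Sdb db0 ->] := P b.
  set na := nu a in Sna *; set ma := de a in Sda da0 *.
  set nb := nu b in Snb *; set mb := de b in Sdb db0 *.
  have -> : na / ma * (nb / mb) = (na * nb) / (ma * mb).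
    by field; rewrite da0 db0.
  rewrite !D'E ?mulf_neq0 //; [|exact: SM|exact: SM].
  rewrite !DM //; by field; rewrite da0 db0.
- move=> a Sa; rewrite -[a in LHS]divr1 D'E ?oner_eq0 //.
  have D1 : D 1 = 0.
    by apply: (addrI (D 1)); rewrite addr0 -{3}[1]mulr1 DM // mulr1 mul1r.
  by rewrite D1 expr1n divr1 mulr1 mulr0 subr0.
Qed.

End Extension.

(** * Algebraic independence and polynomial identities *)

Definition alg_indep (K B : comNzRingType) (iota : {rmorphism K -> B}) m
    (z : 'I_m -> B) : Prop :=
  forall p, mmap iota z p = 0 -> p = 0.

(** Induction on the degree: the partial derivatives of [p] vanish by induction, so that [p] is
    constant in characteristic 0. *)
Lemma mderiv_closed_eq0 (K : numFieldType) m (P : {mpoly K[m]} -> Prop) :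
    (forall p, P p -> forall l, P p^`M(l)) -> (forall c, P c%:MP -> c = 0) ->
  forall p, P p -> p = 0.
Proof.
move=> Pd Pc p0.
suff gen k (p : {mpoly K[m]}) :
    (forall mm : 'X_{1..m}, (k <= mdeg mm)%N -> p@_mm = 0) -> P p -> p = 0.
  by apply: (gen (msize p0)) => mm le; apply/memN_msupp_eq0/msize_mdeg_ge.
elim: k p => [|k IH] p pk Pp; first by apply/mpolyP => mm; rewrite pk ?mcoeff0.
have dp0 l : p^`M(l) = 0.
  apply: IH (Pd _ Pp l) => mm le.
  by rewrite mcoeff_mderiv pk ?mul0rn // mdegD mdeg1 addn1.
have pc mm : mm != 0%MM -> p@_mm = 0.
  rewrite -mdeg_eq0 mdegE sum_nat_eq0 => /forallPn [l]; rewrite implyTb => ml.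
  have := congr1 (mcoeff (mm - U_(l))%MM) (dp0 l).
  rewrite mcoeff_mderiv mcoeff0 submK; last first.
    by apply/mnm_lepP => j; rewrite mnm1E; case: eqP => // <-; rewrite lt0n.
  by move/eqP; rewrite mulrn_eq0 /= => /eqP.
have pE : p = (p@_0)%:MP.
  apply/mpolyP => mm; rewrite mcoeffC.
  by have [->|/pc ->] := eqVneq mm 0%MM; rewrite ?mulr1 ?mulr0.
by move: Pp; rewrite pE => /Pc ->; rewrite mpolyC0.
Qed.

(** Jacobian criterion: differentiating a relation shows that its partial derivatives are relations
    again, so that [mderiv_closed_eq0] applies. With [B] a mere ring, the criterion covers power
    series. *)
Lemma jacobian_alg_indep (K : numFieldType) (B : comNzRingType)
    (iota : {rmorphism K -> B}) m (z : 'I_m -> B) (I : Type) (D : I -> B -> B) :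
    (forall i, derivation iota (D i)) ->
    (forall b : 'I_m -> B, (forall i, \sum_l b l * D i (z l) = 0) ->
       forall l, b l = 0) ->
  alg_indep iota z.
Proof.
move=> derD jac; apply: mderiv_closed_eq0 => [p pz|c]; last first.
  by rewrite mmapC => /eqP; rewrite fmorph_eq0 => /eqP.
apply: jac => i.
by rewrite -(derD_mmap (derD i)) pz (derD_0 (derD i)).
Qed.

Section InfiniteField.
Variable K : numFieldType.

(** Only positive integers are tested, so as to cover identities known on a cone, where the scalar 0
    is excluded. *)
Lemma poly_eq0_natr (q : {poly K}) : (forall n, q.[n.+1%:R] = 0) -> q = 0.
Proof.
move=> q0; apply/eqP/negP => /negP qn0.
have := @max_poly_roots _ q [seq i.+1%:R | i <- iota 0 (size q)] qn0.
rewrite size_map size_iota ltnn => H; suff : false by [].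
apply: H; first by apply/allP => _ /mapP [i _ ->]; apply/rootP/q0.
rewrite map_inj_uniq ?iota_uniq // => i j /eqP.
by rewrite eqr_nat => /eqP [].
Qed.

Lemma deriv_polyC_der : derivation (@polyC K) deriv.
Proof.
by split=> [a b|a b|c]; rewrite ?derivD ?derivM ?derivC.
Qed.

Definition axis_line N (w : 'I_N -> K) l (p : {mpoly K[N]}) : {poly K} :=
  mmap (@polyC K) (fun i => (w i)%:P + (i == l)%:R *: 'X) p.

Lemma horner_axis_line N (w : 'I_N -> K) l p t :
  (axis_line w l p).[t] = p.@[fun i => w i + (i == l)%:R * t].
Proof.
apply: (rmorph_mmap_comp (f := horner_eval t)) => [c|i].
  by rewrite /= /horner_eval hornerC.
by rewrite /= /horner_eval hornerD hornerC hornerZ hornerX.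
Qed.

Lemma deriv_axis_line N (w : 'I_N -> K) l p :
  (axis_line w l p)^`() = axis_line w l p^`M(l).
Proof.
rewrite /axis_line (derD_mmap deriv_polyC_der) (bigD1 l) //=.
rewrite derivD derivC derivZ derivX eqxx scale1r add0r mulr1 big1 ?addr0 //.
move=> i /negbTE ne; rewrite derivD derivC derivZ derivX ne scale0r.
by rewrite addr0 mulr0.
Qed.

Lemma mderiv_axis N (w : 'I_N -> K) l p :
    (forall t, p.@[fun i => w i + (i == l)%:R * t] = 0) -> p^`M(l).@[w] = 0.
Proof.
move=> p0; have q0 : axis_line w l p = 0.
  by apply: poly_eq0_natr => n; rewrite horner_axis_line.
have := congr1 (fun q => q^`().[0]) q0.
rewrite deriv0 horner0 deriv_axis_line horner_axis_line => <-.
by apply: meval_eq => i; rewrite mulr0 addr0.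
Qed.

Lemma mpoly_eq0_eval m (p : {mpoly K[m]}) : (forall w, p.@[w] = 0) -> p = 0.
Proof.
move: p; apply: mderiv_closed_eq0 => [p p0 l w|c].
  exact: mderiv_axis.
by move=> /(_ (fun=> 0)); rewrite mevalC.
Qed.

End InfiniteField.

(** * Derivations of the function field *)

Section GenericDerivations.
Variables (K : numFieldType) (N : nat) (S : ('I_N -> K) -> Prop).
Variables (E : fieldType) (iota : {rmorphism K -> E}) (xi : 'I_N -> E).
Hypothesis gen : generic_point S iota xi.

Let char0 n : n.+1%:R != 0 :> E.
Proof. by rewrite -(rmorph_nat iota) fmorph_eq0 pnatr_eq0. Qed.

(** Adjoining the finitely many coordinates [xi] gives a ring whose fractions fill [E]. *)
Lemma complete_derivation T D : partial_der T D ->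
    (forall c, T (iota c)) -> (forall c, D (iota c) = 0) ->
  exists D', derivation iota D' /\ forall a, T a -> D' a = D a.
Proof.
move=> TD Tc Dc.
have [T' [D1 [TD1 [e1 e1'] xiT]]] := adjoin_seq char0 (codom xi) TD.
have evT p : T' (mmap iota xi p).
  have [T1 TB TM _ _] := TD1.
  have T0 : T' 0 by rewrite -(subrr 1); apply: TB.
  elim/mpoly_ring_ind: p => [c|i|p q IHp IHq|p q IHp IHq].
  - by rewrite mmapC; apply/e1/Tc.
  - by rewrite mmapX mmap1U; apply/xiT/codom_f.
  - rewrite mmapD -[mmap iota xi q]opprK; apply: (TB) => //.
    by rewrite -sub0r; apply: (TB).
  - by rewrite rmorphM; apply: TM.
have frac e : exists a b, [/\ T' a, T' b, b != 0 & e = a / b].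
  have [a [b [b0 ->]]] := gen.2 e.
  by exists (mmap iota xi a), (mmap iota xi b); split.
have [D' [DA DM D'E]] := extend_fractions TD1 frac.
exists D'; split=> [|a Ta]; last by rewrite D'E ?e1' //; apply: e1.
by split=> // c; rewrite D'E ?e1' //; apply/e1.
Qed.

Section Independent.
Variables (m : nat) (z : 'I_m -> E).
Hypothesis z_indep : alg_indep iota z.

Let T y := exists p, y = mmap iota z p.

(** On the ring [T] of polynomials in [z] the derivation is given by the chain rule; independence of
    [z] makes it well defined. *)
Let base (c : 'I_m -> E) : exists D, [/\ partial_der T D,
   (forall j, D (z j) = c j) & (forall k, D (iota k) = 0)].
Proof.
pose d p := \sum_i mmap iota z p^`M(i) * c i.
pose D y := if pselect (T y) is left h then d (projT1 (cid h)) else 0.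
have DE p : D (mmap iota z p) = d p.
  rewrite /D; case: pselect => [h|[]]; last by exists p.
  case: (cid h) => q /= qp; congr d; apply/eqP; rewrite -subr_eq0; apply/eqP.
  by apply: z_indep; rewrite mmapB -qp subrr.
exists D; split.
- split.
  + by exists 1; rewrite rmorph1.
  + by move=> _ _ [p ->] [q ->]; exists (p - q); rewrite mmapB.
  + by move=> _ _ [p ->] [q ->]; exists (p * q); rewrite rmorphM.
  + move=> _ _ [p ->] [q ->]; rewrite -mmapD !DE /d -big_split /=.
    by apply: eq_bigr => i _; rewrite mderivD mmapD mulrDl.
  + move=> _ _ [p ->] [q ->]; rewrite -rmorphM !DE /d mulr_suml mulr_sumr.
    rewrite -big_split /=; apply: eq_bigr => i _.
    by rewrite mderivM mmapD !rmorphM /=; ring.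
- move=> j; have -> : z j = mmap iota z 'X_j by rewrite mmapX mmap1U.
  have sub0 : (U_(j) - U_(j) = 0 :> 'X_{1..m})%MM.
    by apply/mnmP => k; rewrite mnmBE mnm0E subnn.
  rewrite DE /d (bigD1 j) //= mderivX mnm1E eqxx sub0.
  rewrite mpolyX0 scale1r rmorph1 mul1r big1 ?addr0 // => k ne_kj.
  by rewrite mderivX mnm1E eq_sym (negbTE ne_kj) scale0r mmap0 mul0r.
- move=> k; have -> : iota k = mmap iota z k%:MP by rewrite mmapC.
  by rewrite DE /d big1 // => i _; rewrite mderivC mmap0 mul0r.
Qed.

Let Tc c : T (iota c). Proof. by exists c%:MP; rewrite mmapC. Qed.
Let Tz j : T (z j). Proof. by exists 'X_j; rewrite mmapX mmap1U. Qed.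

Lemma exists_derivation (c : 'I_m -> E) :
  exists D, derivation iota D /\ forall j, D (z j) = c j.
Proof.
have [D [TD Dz Dc]] := base c.
have [D' [derD' D'E]] := complete_derivation TD Tc Dc.
by exists D'; split => // j; rewrite D'E.
Qed.

(* The constant coefficient of a minimal relation does not vanish. *)
Lemma algebraic_relation e : e != 0 ->
    (forall D, derivation iota D -> (forall j, D (z j) = 0) -> D e = 0) ->
  exists (d : nat) (a : 'I_d.+1 -> {mpoly K[m]}),
    a ord0 != 0 /\ \sum_i mmap iota z (a i) * e ^+ i = 0.
Proof.
move=> e0 De.
(* Were [e] transcendental over [T], the zero derivation of [T] would extend to one with value 1 at
   [e]. *)
have ntr : ~ transcendental T e.
  have [D [TD Dz Dc]] := base (fun=> 0) => tr.
  have [T1 [D1 [TD1 [e1 e1'] T1e D1e]]] := adjoin_transcendental TD 1 tr.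
  have [||D' [derD' D'E]] := complete_derivation TD1.
  - by move=> c; apply/e1/Tc.
  - by move=> c; rewrite e1' ?Dc.
  have Dz' j : D' (z j) = 0 by rewrite D'E ?e1' //; apply: e1.
  by have := De _ derD' Dz'; rewrite D'E // D1e => /eqP; rewrite oner_eq0.
have [q [Tq q0 qe qmin]] := minimal_relation ntr.
(* Otherwise division by the variable would give a smaller relation, as [e != 0]. *)
have q00 : q`_0 != 0.
  apply/eqP => q00.
  pose q1 := \poly_(i < (size q).-1) q`_i.+1.
  have sq : (0 < size q)%N by rewrite size_poly_gt0.
  have qE : q = q1 * 'X.
    apply/polyP => -[|i]; rewrite coefMX //= coef_poly.
    by case: ltnP => // le; rewrite nth_default // -(prednK sq) ltnS.
  have q10 : q1 = 0.
    apply: qmin.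
    - move=> i; rewrite coef_poly; case: ifP => // _.
      by exists 0; rewrite mmap0.
    - move: qe; rewrite qE hornerM hornerX => /eqP.
      by rewrite mulf_eq0 (negbTE e0) orbF => /eqP.
    - by rewrite (leq_ltn_trans (size_poly _ _)) // prednK.
  by move: q0; rewrite qE q10 mul0r eqxx.
have [a aE] := choice Tq.
exists (size q).-1, (fun i => a (val i)); split.
  by apply: contraNneq q00 => /= a0; rewrite aE a0 mmap0.
rewrite -[RHS]qe horner_coef prednK ?size_poly_gt0 //.
by apply: eq_bigr => i _; rewrite -aE.
Qed.

End Independent.
End GenericDerivations.

(** * Cones and dimension *)

Section Cones.
Variables (K : numFieldType) (r : nat).
Implicit Types (X Y Z : set 'rV[K]_r.+1) (u v : 'rV[K]_r.+1) (f g : {mpoly K[r.+1]}).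

Definition points N (X : set 'rV[K]_N) : ('I_N -> K) -> Prop :=
  fun w => X (\row_i w i).

Lemma meval_row N (w : 'I_N -> K) (p : {mpoly K[N]}) :
  p.@[(\row_i w i) 0] = p.@[w].
Proof. by apply: meval_eq => i; rewrite mxE. Qed.

Lemma vanish_on_points N (X : set 'rV[K]_N) p :
  vanish_on (points X) p <-> vanishing X p.
Proof.
split=> [p0 v Xv|p0 w Xw]; last by rewrite -meval_row; apply: p0.
by apply: p0; rewrite /points (_ : \row_i _ = v) //; apply/rowP => i; rewrite mxE.
Qed.

(** Restriction to the line through the origin and [v]; its coefficients are the values at [v] of
    the homogeneous components. *)
Definition central_line (v : 'rV[K]_r.+1) : {mpoly K[r.+1]} -> {poly K} :=
  mmap (@polyC K) (fun i => v 0 i *: 'X).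

Lemma horner_central_line v f (t : K) : (central_line v f).[t] = f.@[(t *: v) 0].
Proof.
apply: (rmorph_mmap_comp (f := horner_eval t)) => [c|i].
  by rewrite /= /horner_eval hornerC.
by rewrite /= /horner_eval hornerZ hornerX mxE mulrC.
Qed.

Lemma coef_central_line v f d :
  (central_line v f)`_d = (pihomog mdeg d f).@[v 0].
Proof.
elim/mpolyind: f => [|c m p _ _ IHp].
  by rewrite /central_line mmap0 coef0 pihomog0 meval0.
rewrite /central_line mmapD coefD -/(central_line v p) IHp pihomogD mevalD.
congr (_ + _); rewrite mmapZ mmapX linearZ /= mevalZ coefCM; congr (_ * _).
rewrite pihomogX /mmap1.
under eq_bigr do rewrite -mul_polyC exprMn.
rewrite big_split /= prodrXr -mdegE.
under eq_bigr do rewrite -rmorphXn.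
rewrite -rmorph_prod /= coefCM coefXn eq_sym.
case: eqP => _; last by rewrite mulr0 meval0.
by rewrite mulr1 mevalX.
Qed.

Lemma central_line0 v f :
    (forall t : K, t != 0 -> f.@[(t *: v) 0] = 0) -> central_line v f = 0.
Proof.
by move=> f0; apply: poly_eq0_natr => n; rewrite horner_central_line f0 ?pnatr_eq0.
Qed.

Definition cone X : Prop := forall v t, X v -> t != 0 -> X (t *: v).

Lemma dhomog_meval_scale f d v (t : K) : f \is d.-homog for mdeg ->
  f.@[(t *: v) 0] = t ^+ d * f.@[v 0].
Proof.
move=> fd; have lineE : central_line v f = f.@[v 0] *: 'X^d.
  apply/polyP => e; rewrite coef_central_line coefZ coefXn.
  have [->|ne] := eqVneq e d; first by rewrite pihomog_dE // mulr1.
  by rewrite (pihomog_ne0 _ fd) ?meval0 ?mulr0 // eq_sym.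
by rewrite -horner_central_line lineE hornerZ hornerXn mulrC.
Qed.

Lemma pclosed_nz Z v : pclosed Z -> Z v -> v != 0.
Proof. by move=> Zc; rewrite -Zc => -[]. Qed.

Lemma pclosed_cone Z : pclosed Z -> cone Z.
Proof.
move=> Zc v t; rewrite -Zc => -[v0 Zv] t0; split.
  by rewrite scaler_eq0 negb_or t0.
by move=> f d fd f0; rewrite (dhomog_meval_scale _ _ fd) (Zv f d fd f0) mulr0.
Qed.

Lemma pclosed_mem Z v : pclosed Z -> v != 0 ->
  (forall f, vanishing Z f -> f.@[v 0] = 0) -> Z v.
Proof. by move=> Zc v0 Zv; rewrite -Zc; split=> // f d _ f0; apply: Zv. Qed.

(** Euler's relation: [g] vanishes on the line through [p], and the sum is the derivative at 1 of
    its restriction to this line. *)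
Lemma cone_tangent X p g : cone X -> X p -> vanishing X g ->
  \sum_k g^`M(k).@[p 0] * p 0 k = 0.
Proof.
move=> cX Xp gX.
have q0 : central_line p g = 0 by apply: central_line0 => t t0; apply/gX/cX.
have := congr1 (fun q : {poly K} => q^`().[1]) q0; rewrite deriv0 horner0 => e; rewrite -[RHS]e.
rewrite /central_line (derD_mmap (deriv_polyC_der K)).
rewrite horner_sum; apply: eq_bigr => k _.
rewrite hornerM derivZ derivX hornerZ hornerC mulr1; congr (_ * _).
rewrite -[RHS]/((central_line p g^`M(k)).[1]) horner_central_line.
by apply: meval_eq => l; rewrite scale1r.
Qed.

(** On a cone each homogeneous component of [f] vanishes separately. *)
Lemma vanishing_pclosure X f : cone X ->
  vanishing X f -> vanishing (pclosure X) f.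
Proof.
move=> cX fX v [v0 Xv].
rewrite -[v in LHS]scale1r -horner_central_line (_ : central_line v f = 0) ?horner0 //.
apply/polyP => d; rewrite coef_central_line coef0; apply: (Xv _ d (pihomogP _ _ _)).
move=> u Xu; rewrite -coef_central_line (_ : central_line u f = 0) ?coef0 //.
by apply: central_line0 => t t0; apply/fX/cX.
Qed.

(** If [f * g] vanishes on [Z], then on each line of the cone one of the factors vanishes
    identically, since polynomials in one variable form a domain. *)
Lemma pirreducible_aprime Z : pclosed Z -> pirreducible Z -> aprime (points Z).
Proof.
move=> Zc [[v Zv] Zirr]; split.
  exists (v 0); rewrite /points (_ : \row_i _ = v) //.
  by apply/rowP => i; rewrite mxE.
move=> f g /vanish_on_points fg0.
(* The points whose whole line lies in the zero set of [h]: the common zeros of the homogeneous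
   components of [h], hence a closed set. *)
pose V h := [set v : 'rV[K]_r.+1 | v != 0 /\ central_line v h = 0]%classic.
have Vc h : pclosed (V h).
  apply/seteqP; split=> u [u0 hu]; split => //.
    apply/polyP => d; rewrite coef_central_line coef0.
    apply: (hu _ d (pihomogP _ _ _)) => w [_ hw].
    by rewrite -coef_central_line hw coef0.
  by move=> k d _ k0; apply: k0.
have sub : (Z `<=` V f `|` V g)%classic.
  move=> u Zu; have u0 := pclosed_nz Zc Zu.
  have : central_line u (f * g) = 0.
    by apply: central_line0 => t t0; apply/fg0/(pclosed_cone Zc).
  rewrite /central_line rmorphM => /eqP; rewrite mulf_eq0.
  by case/orP => /eqP h0; [left|right].
have VE h : (Z `<=` V h)%classic -> vanish_on (points Z) h.
  move=> ZV; apply/vanish_on_points => u /ZV [_ hu].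
  by rewrite -[u]scale1r -horner_central_line hu horner0.
by case: (Zirr _ _ (Vc f) (Vc g) sub) => /VE; [left|right].
Qed.

(** The projection of [Y] to the coordinates [J] is Zariski dense; lower bounds on dimensions are
    used in this form. *)
Definition free_coords m (Y : set 'rV[K]_r.+1) (J : 'I_m -> 'I_r.+1) : Prop :=
  forall p : {mpoly K[m]}, (forall v, Y v -> p.@[fun i => v 0 (J i)] = 0) -> p = 0.

Definition coord_subst m (J : 'I_m -> 'I_r.+1) (p : {mpoly K[m]}) : {mpoly K[r.+1]} :=
  mmap (@mpolyC _ K) (fun i => 'X_(J i)) p.

Lemma mmap_coord_subst (B : comNzRingType) (i : {rmorphism K -> B}) xi m
    (J : 'I_m -> 'I_r.+1) p :
  mmap i xi (coord_subst J p) = mmap i (fun k => xi (J k)) p.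
Proof. by rewrite mmap_comp; apply: eq_mmap => k; rewrite mmapX mmap1U. Qed.

Lemma free_coords_indep Z (E : fieldType) (iota : {rmorphism K -> E}) xi m
    (J : 'I_m -> 'I_r.+1) : generic_point (points Z) iota xi ->
  free_coords Z J -> alg_indep iota (fun i => xi (J i)).
Proof.
move=> gen fJ p; rewrite -mmap_coord_subst => /gen.1 /vanish_on_points p0.
by apply: fJ => v Zv; rewrite -[LHS]mmap_coord_subst; apply: p0.
Qed.

(** The count [d.+1] is that of the affine cone. Coordinates free on [Z i] stay free on [Z i.+1]. If
    none could be added there, an equation [f] of [Z i] that does not vanish on [Z i.+1] would be
    algebraic over these coordinates, and the nonzero constant coefficient of its relation would
    vanish on [Z i]. *)
Lemma chain_free_coords Y d : has_chain Y d ->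
  exists J : 'I_d.+1 -> 'I_r.+1, free_coords Y J.
Proof.
move=> [Z [Zprop Zinc]].
suff H i : (i <= d)%N -> exists J : 'I_i.+1 -> 'I_r.+1, free_coords (Z i) J.
  have [J fJ] := H d (leqnn d); exists J => p p0; apply: fJ => v Zv.
  by apply: p0; have [_ _] := Zprop d (leqnn d); apply.
elim: i => [|i IH] lid.
  have [Zc [[v Zv] _] _] := Zprop 0%N (leq0n d).
  have /rV0Pn [j vj] := pclosed_nz Zc Zv.
  exists (fun=> j) => p p0.
  apply: mpoly_eq0_eval => w.
  have : mmap (@polyC K) (fun=> v 0 j *: 'X) p = 0.
    apply: poly_eq0_natr => n.
    rewrite -[RHS](p0 _ (pclosed_cone Zc Zv (_ : n.+1%:R != 0))) ?pnatr_eq0 //.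
    apply: (rmorph_mmap_comp (f := horner_eval _)) => [c|k] /=.
      by rewrite /horner_eval hornerC.
    by rewrite /horner_eval hornerZ hornerX mxE mulrC.
  move=> /(congr1 (horner_eval (w ord0 / v 0 j))); rewrite /= /horner_eval horner0.
  move=> <-; apply/esym; apply: (rmorph_mmap_comp (f := horner_eval _)) => [c|k] /=.
    by rewrite /horner_eval hornerC.
  by rewrite /horner_eval hornerZ hornerX (ord1 k) mulrC divfK.
have [J fJ] := IH (ltnW lid).
have [Zc Zirr _] := Zprop i (ltnW lid).
have [Z'c Z'irr _] := Zprop i.+1 lid.
have [ZZ' nZ'Z] := Zinc i lid.
have [E [iota [xi gen]]] := exists_generic_point (pirreducible_aprime Z'c Z'irr).
have fJ' : free_coords (Z i.+1) J by move=> p p0; apply: fJ => v /ZZ'; apply: p0.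
have zind := free_coords_indep gen fJ'.
have [f f0 fn0] : exists2 f, vanishing (Z i) f & ~ vanishing (Z i.+1) f.
  apply: contrapT => nf; apply: nZ'Z => v Z'v.
  apply: (pclosed_mem Zc); first exact: (pclosed_nz Z'c Z'v).
  move=> f f0; apply: contrapT => fv; apply: nf; exists f => // f0'.
  exact/fv/f0'.
have fxi : mmap iota xi f != 0.
  by apply: contra_notN fn0 => /eqP/gen.1/vanish_on_points.
(* Either some derivation kills the coordinates [J] but not the coordinate [j], which can then be
   added, or [f] is algebraic over the coordinates [J]. *)
case: (pselect (exists D j, [/\ derivation iota D,
    forall k, D (xi (J k)) = 0 & D (xi j) != 0])) => [|nD].
  move=> [D [j [derD DJ Dj]]].
  pose J' (k : 'I_i.+2) := if unlift ord_max k is Some k' then J k' else j.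
  exists J'.
  have J'max : J' ord_max = j by rewrite /J' unlift_none.
  have J'lift k : J' (lift ord_max k) = J k by rewrite /J' liftK.
  have [D' D'P] := choice (fun k : 'I_i.+1 =>
    exists_derivation gen zind (fun l => (k == l)%:R)).
  have ind : alg_indep iota (fun k => xi (J' k)).
    pose DD (o : option 'I_i.+1) := if o is Some k then D' k else D.
    apply: (@jacobian_alg_indep _ _ _ _ _ _ DD) => [[k|]|b].
    - exact: (D'P k).1.
    - exact: derD.
    move=> b0; have bmax : b ord_max = 0.
      have := b0 None; rewrite /= (bigD1 ord_max) //= big1 => [|k].
        by rewrite addr0 J'max => /eqP; rewrite mulf_eq0 (negbTE Dj) orbF => /eqP.
      case: (unliftP ord_max k) => [k' ->|->]; last by rewrite eqxx.
      by rewrite J'lift DJ mulr0.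
    move=> k; case: (unliftP ord_max k) => [k' ->|->] //.
    have := b0 (Some k'); rewrite /= (bigD1 (lift ord_max k')) //=.
    rewrite J'lift (D'P k').2 eqxx mulr1 big1 ?addr0 // => l.
    case: (unliftP ord_max l) => [l' ->|->]; last by rewrite bmax mul0r.
    rewrite (inj_eq lift_inj) J'lift (D'P k').2 eq_sym => /negbTE ->.
    by rewrite mulr0.
  move=> p p0; apply: ind; rewrite -mmap_coord_subst; apply/gen.1.
  apply/vanish_on_points => v Zv; rewrite -[RHS](p0 v Zv).
  exact: (mmap_coord_subst idfun).
have Df D : derivation iota D -> (forall k, D (xi (J k)) = 0) ->
    D (mmap iota xi f) = 0.
  move=> derD DJ; rewrite (derD_mmap derD) big1 // => j _.
  suff -> : D (xi j) = 0 by rewrite mulr0.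
  by apply/eqP/negP => /negP Dj; apply: nD; exists D, j.
have [e [a [a0 rel]]] := algebraic_relation gen zind fxi Df.
have : vanishing (Z i.+1) (\sum_k coord_subst J (a k) * f ^+ k).
  apply/vanish_on_points/gen.1; rewrite raddf_sum -[RHS]rel.
  by apply: eq_bigr => k _; rewrite /= (rmorphM (mmap iota xi)) rmorphXn /= mmap_coord_subst.
move=> G0; case/eqP: a0; apply: fJ => v Zv.
have := G0 v (ZZ' v Zv); rewrite raddf_sum (bigD1 ord0) //= big1 ?addr0.
  rewrite expr0 mulr1 => <-; apply/esym.
  exact: (mmap_coord_subst idfun).
move=> k; rewrite -lt0n => k0; rewrite mevalM rmorphXn /= f0 //.
by rewrite expr0n eqn0Ngt k0 mulr0.
Qed.

End Cones.

(** * Power series and arcs on blow-ups *)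

(** A series is the sequence of its coefficients; the ring laws are inherited from polynomials by
    truncation. *)
Definition fps (F : comNzRingType) : Type := nat -> F.

Section PowerSeriesRing.
Variable F : comNzRingType.
Implicit Types f g h : fps F.

HB.instance Definition _ := gen_eqMixin (fps F).
HB.instance Definition _ := gen_choiceMixin (fps F).

Definition fps_add f g : fps F := fun n => f n + g n.
Definition fps_opp f : fps F := fun n => - f n.
Definition fps_const (c : F) : fps F := fun n => if n is 0 then c else 0.
Definition fps_mul f g : fps F := fun n => \sum_(i < n.+1) f i * g (n - i)%N.

Fact fps_addA : associative fps_add.
Proof. by move=> f g h; apply/funext => n; apply: addrA. Qed.
Fact fps_addC : commutative fps_add.
Proof. by move=> f g; apply/funext => n; apply: addrC. Qed.
Fact fps_add0 : left_id (fps_const 0) fps_add.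
Proof. by move=> f; apply/funext => -[|n]; apply: add0r. Qed.
Fact fps_addN : left_inverse (fps_const 0) fps_opp fps_add.
Proof. by move=> f; apply/funext => -[|n]; apply: addNr. Qed.

HB.instance Definition _ :=
  GRing.isZmodule.Build (fps F) fps_addA fps_addC fps_add0 fps_addN.

Let trunc n f : {poly F} := \poly_(i < n.+1) f i.

Let fps_mulE n f g k (p q : {poly F}) : (k <= n)%N ->
    (forall i, (i <= n)%N -> p`_i = f i) -> (forall i, (i <= n)%N -> q`_i = g i) ->
  fps_mul f g k = (p * q)`_k.
Proof.
move=> kn pf qg; rewrite coefM; apply: eq_bigr => i _.
have ik := ltn_ord i.
by rewrite pf ?qg //; lia.
Qed.

Let coef_trunc n f i : (i <= n)%N -> (trunc n f)`_i = f i.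
Proof. by move=> le; rewrite coef_poly ltnS le. Qed.

Fact fps_mulA : associative fps_mul.
Proof.
move=> f g h; apply/funext => n.
rewrite (@fps_mulE n _ _ _ (trunc n f) (trunc n g * trunc n h)) //; first last.
- by move=> i le; rewrite (@fps_mulE n _ _ _ (trunc n g) (trunc n h)) // => j ?;
    apply: coef_trunc.
- by move=> i ?; apply: coef_trunc.
rewrite mulrA (@fps_mulE n _ _ _ (trunc n f * trunc n g) (trunc n h)) //.
- by move=> i le; rewrite (@fps_mulE n _ _ _ (trunc n f) (trunc n g)) // => j ?;
    apply: coef_trunc.
- by move=> i ?; apply: coef_trunc.
Qed.

Fact fps_mulC : commutative fps_mul.
Proof.
move=> f g; apply/funext => n.
rewrite (@fps_mulE n _ _ _ (trunc n f) (trunc n g)) //; try exact: coef_trunc.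
by rewrite mulrC (@fps_mulE n _ _ _ (trunc n g) (trunc n f)) //; exact: coef_trunc.
Qed.

Fact fps_mul1 : left_id (fps_const 1) fps_mul.
Proof.
move=> f; apply/funext => n; rewrite /fps_mul big_ord_recl /= mul1r subn0.
by rewrite big1 ?addr0 // => i _; rewrite mul0r.
Qed.

Fact fps_mulD : left_distributive fps_mul fps_add.
Proof.
move=> f g h; apply/funext => n; rewrite /fps_mul /fps_add -big_split /=.
by apply: eq_bigr => i _; rewrite mulrDl.
Qed.

Fact fps_1neq0 : fps_const 1 != fps_const 0.
Proof. by apply/eqP => /(congr1 (fun f : fps F => f 0%N)) /eqP; rewrite oner_eq0. Qed.

HB.instance Definition _ := GRing.Zmodule_isComNzRing.Build (fps F)
  fps_mulA fps_mulC fps_mul1 fps_mulD fps_1neq0.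

Lemma coef_fpsD f g n : (f + g) n = f n + g n. Proof. by []. Qed.
Lemma coef_fpsN f n : (- f) n = - f n. Proof. by []. Qed.
Lemma coef_fpsB f g n : (f - g) n = f n - g n. Proof. by []. Qed.
Lemma coef_fpsM f g n : (f * g) n = \sum_(i < n.+1) f i * g (n - i)%N.
Proof. by []. Qed.
Lemma coef_fps0 n : (0 : fps F) n = 0. Proof. by case: n. Qed.
Lemma coef_fps_sum I (s : seq I) (P : pred I) (G : I -> fps F) n :
  (\sum_(i <- s | P i) G i) n = \sum_(i <- s | P i) G i n.
Proof.
elim/big_rec2: _ => [|i y1 y2 _ IH]; first exact: coef_fps0.
by rewrite coef_fpsD IH.
Qed.

Fact fps_const_additive : zmod_morphism fps_const.
Proof. by move=> a b; apply/funext => -[|n] //; rewrite coef_fpsB subr0. Qed.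
Fact fps_const_multiplicative : monoid_morphism fps_const.
Proof.
split=> // a b; apply/funext => n; rewrite coef_fpsM big_ord_recl subn0 /=.
by rewrite big1 => [|i _]; rewrite ?mul0r // addr0; case: n => //= n; rewrite mulr0.
Qed.
HB.instance Definition _ :=
  GRing.isZmodMorphism.Build F (fps F) fps_const fps_const_additive.
HB.instance Definition _ :=
  GRing.isMonoidMorphism.Build F (fps F) fps_const fps_const_multiplicative.

Lemma coef_fpsCM c f n : (fps_const c * f) n = c * f n.
Proof.
rewrite coef_fpsM big_ord_recl subn0 /= big1 ?addr0 // => i _.
by rewrite mul0r.
Qed.

Definition fps_ord n f := forall i, (i < n)%N -> f i = 0.

Lemma fps_ordD n f g : fps_ord n f -> fps_ord n g -> fps_ord n (f + g).
Proof. by move=> f0 g0 i lt; rewrite coef_fpsD f0 ?g0 ?addr0. Qed.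

Lemma fps_ordN n f : fps_ord n f -> fps_ord n (- f).
Proof. by move=> f0 i lt; rewrite coef_fpsN f0 ?oppr0. Qed.

Lemma fps_ordM n m f g : fps_ord n f -> fps_ord m g -> fps_ord (n + m) (f * g).
Proof.
move=> f0 g0 i lt; rewrite coef_fpsM big1 // => j _.
have [jn|nj] := ltnP j n; first by rewrite f0 ?mul0r.
by rewrite [g _]g0 ?mulr0 //; have := ltn_ord j; lia.
Qed.

Lemma fps_ordMl n f g : fps_ord n g -> fps_ord n (f * g).
Proof. by move=> gn; rewrite -[n]add0n; apply: fps_ordM. Qed.

Lemma fps_ord_sum n I (s : seq I) (P : pred I) (G : I -> fps F) :
  (forall i, P i -> fps_ord n (G i)) -> fps_ord n (\sum_(i <- s | P i) G i).
Proof. by move=> Gn i lt; rewrite coef_fps_sum big1 // => j Pj; apply: Gn. Qed.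

Lemma fps_ordX n k f : fps_ord n f -> fps_ord (n * k) (f ^+ k).
Proof.
move=> fn; elim: k => [|k IH]; first by rewrite muln0.
by rewrite exprS mulnS; apply: fps_ordM.
Qed.

End PowerSeriesRing.

Section PowerSeriesField.
Variable F : fieldType.
Implicit Types f g h : fps F.

Lemma fps_least_coef f : f != 0 -> exists2 n, f n != 0 & fps_ord n f.
Proof.
move=> f0; have ex : exists n, f n != 0.
  apply: contrapT => nex; case/eqP: f0; apply/funext => n; rewrite coef_fps0.
  by apply/eqP/negP => /negP fn; apply: nex; exists n.
case: (ex_minnP ex) => n fn min; exists n => // i lt.
by apply/eqP/negP => /negP /min; rewrite leqNgt lt.
Qed.

Lemma fps_mul_eq0 f g : f * g = 0 -> f = 0 \/ g = 0.
Proof.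
move=> fg; case: (eqVneq f 0) => [|/fps_least_coef [n fn fmin]]; first by left.
right; apply: contrapT => /eqP /fps_least_coef [m gm gmin].
have := congr1 (fun h : fps F => h (n + m)%N) fg; rewrite coef_fps0 coef_fpsM.
have lt : (n < (n + m).+1)%N by rewrite ltnS leq_addr.
rewrite (bigD1 (Ordinal lt)) //= addKn big1 ?addr0 => [/eqP|i].
  by rewrite mulf_eq0 (negbTE fn) (negbTE gm).
rewrite -val_eqE /= => ne; have [lti|lei] := ltnP i n.
  by rewrite fmin ?mul0r.
by rewrite gmin ?mulr0 //; have := ltn_ord i; lia.
Qed.

(** [f] is a constant times [1 - g] with [g] of positive order; the inverse is the geometric series,
    of which only the powers up to [n] contribute to the coefficient [n]. *)
Lemma fps_inverse f : f 0%N != 0 -> exists h, f * h = 1.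
Proof.
move=> f0; pose c := f 0%N; pose g := 1 - fps_const c^-1 * f.
have g1 : fps_ord 1 g.
  by move=> [|i] // _; rewrite /g coef_fpsB coef_fpsCM mulVf // subrr.
have fE : f = fps_const c * (1 - g).
  by rewrite /g opprB addrC subrK mulrA -rmorphM divff // rmorph1 mul1r.
pose h : fps F := fun n => \sum_(k < n.+1) (g ^+ k) n.
suff gh : (1 - g) * h = 1.
  exists (fps_const c^-1 * h).
  by rewrite fE mulrACA -rmorphM divff // rmorph1 mul1r.
apply/funext => n; pose s := \sum_(k < n.+1) g ^+ k.
have sh i : (i <= n)%N -> s i = h i.
  move=> le; rewrite /s coef_fps_sum /h.
  rewrite -(big_mkord xpredT (fun k => (g ^+ k) i)).
  rewrite (big_cat_nat _ (n := i.+1)) //= big_mkord addrC big_nat big1 ?add0r //.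
  move=> k /andP [ik _]; apply: (fps_ordX (k := k) g1); lia.
have -> : ((1 - g) * h) n = ((1 - g) * s) n.
  by rewrite !coef_fpsM; apply: eq_bigr => i _; rewrite sh // leq_subr.
have -> : (1 - g) * s = 1 - g ^+ n.+1.
  by rewrite -[1 - g ^+ _]opprB subrX1 -mulNr (opprB g 1).
by rewrite coef_fpsB (fps_ordX (k := n.+1) g1) ?subr0 // mul1n.
Qed.

Lemma fps_divide f g : fps_ord 1 f -> f 1%N != 0 -> fps_ord 1 g ->
  exists h, g = f * h.
Proof.
pose X : fps F := fun n => (n == 1%N)%:R.
pose shift (k : fps F) : fps F := fun n => k n.+1.
have shiftE k : fps_ord 1 k -> k = X * shift k.
  move=> k0; apply/funext => -[|n]; rewrite coef_fpsM big_ord_recl /X /= mul0r add0r.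
    by rewrite big_ord0 k0.
  rewrite big_ord_recl /= mul1r big1 ?addr0 ?/shift.
    by rewrite /bump /= subSS subn0.
  by move=> i _; rewrite mul0r.
move=> f1 f1n g1; have [h fh] := fps_inverse (f := shift f) f1n.
exists (h * shift g); rewrite {1}(shiftE g g1) [in RHS](shiftE f f1) -mulrA.
by congr (X * _); rewrite mulrA fh mul1r.
Qed.

End PowerSeriesField.

(** * Taylor expansion along a derivation *)

Section Taylor.
Variables (A : comNzRingType) (F : fieldType) (ev : {rmorphism A -> F}).
Hypothesis char0 : forall n, n.+1%:R != 0 :> F.
Variable d : A -> A.
Hypothesis dD : forall a b, d (a + b) = d a + d b.
Hypothesis dM : forall a b, d (a * b) = d a * b + a * d b.

(** The series exp(t d) a, with coefficients read in [F] through [ev]. *)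
Definition taylor_series (a : A) : fps F := fun n => ev (iter n d a) / n`!%:R.

Lemma fact_neq0 n : n`!%:R != 0 :> F.
Proof. by have := fact_gt0 n; case: (n`!) => // k _; apply: char0. Qed.

Let d0 : d 0 = 0.
Proof. by apply: (addrI (d 0)); rewrite -dD !addr0. Qed.
Let dsum n (G : 'I_n -> A) : d (\sum_i G i) = \sum_i d (G i).
Proof. exact: (big_morph d dD d0). Qed.
Let dnat a n : d (a *+ n) = d a *+ n.
Proof. by elim: n => [|n IH]; rewrite ?mulr0n // !mulrS dD IH. Qed.

Lemma iter_leibniz n a b :
  iter n d (a * b) = \sum_(i < n.+1) (iter i d a * iter (n - i) d b) *+ 'C(n, i).
Proof.
elim: n => [|n IH]; first by rewrite big_ord1 /= mulr1n.
rewrite iterS IH dsum.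
transitivity (\sum_(i < n.+1) ((iter i.+1 d a * iter (n - i) d b) *+ 'C(n, i)) +
  \sum_(i < n.+1) ((iter i d a * iter (n.+1 - i) d b) *+ 'C(n, i))).
  rewrite -big_split; apply: eq_bigr => i _ /=; rewrite dnat dM mulrnDl.
  by rewrite subSn // -ltnS.
rewrite [in RHS]big_ord_recl [X in _ + X = _]big_ord_recl /= ?subn0 ?bin0.
rewrite addrCA; congr (_ + _).
rewrite big_ord_recr [RHS]big_ord_recr /= addrAC; congr (_ + _); last first.
  by rewrite /bump /= !add1n subSS !binn.
rewrite -big_split /=; apply: eq_bigr => i _.
by rewrite /bump /= !add1n subSS binS mulrnDr addrC.
Qed.

(** Multiplicativity is the Leibniz formula. Geometrically this morphism is a formal arc, the
    integral curve of [d] through the point [ev]. *)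
Lemma taylor_rmorphism :
  exists tau : {rmorphism A -> fps F}, forall a, tau a = taylor_series a.
Proof.
have add : zmod_morphism taylor_series.
  move=> a b; apply/funext => n; rewrite coef_fpsB /taylor_series -mulrBl -rmorphB.
  congr (ev _ / _); elim: n => //= n ->.
  have dN x : d (- x) = - d x by apply/eqP; rewrite -addr_eq0 -dD addNr d0.
  by rewrite dD dN.
have d1 : d 1 = 0.
  by apply: (addrI (d 1)); rewrite addr0 -{3}[1]mulr1 dM mulr1 mul1r.
have mul : monoid_morphism taylor_series.
  split.
    apply/funext => -[|n]; rewrite /taylor_series; first by rewrite rmorph1 divr1.
    rewrite (_ : iter n.+1 d 1 = 0) ?rmorph0 ?mul0r //.
    by elim: n => //= n ->; rewrite d0.
  move=> a b; apply/funext => n; rewrite coef_fpsM /taylor_series iter_leibniz.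
  rewrite rmorph_sum mulr_suml; apply: eq_bigr => i _ /=.
  rewrite rmorphMn rmorphM /=.
  have le : (i <= n)%N by rewrite -ltnS.
  rewrite -(bin_fact le) -mulr_natr !natrM.
  have bn0 : 'C(n, i)%:R != 0 :> F.
    by have := bin_gt0 n i; rewrite le; case: 'C(n, i) => // k _; apply: char0.
  by field; rewrite bn0 !fact_neq0.
pose tau : {rmorphism A -> fps F} := HB.pack taylor_series
  (GRing.isZmodMorphism.Build A (fps F) taylor_series add)
  (GRing.isMonoidMorphism.Build A (fps F) taylor_series mul).
by exists tau.
Qed.

End Taylor.

Section PolynomialSeries.
Variable F : fieldType.

Definition poly_fps (q : {poly F}) : fps F := fun n => q`_n.

Fact poly_fps_additive : zmod_morphism poly_fps.
Proof. by move=> p q; apply/funext => n; rewrite /poly_fps coefB. Qed.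
Fact poly_fps_multiplicative : monoid_morphism poly_fps.
Proof.
split; first by apply/funext => -[|n]; rewrite /poly_fps coef1.
by move=> p q; apply/funext => n; rewrite /poly_fps coefM.
Qed.
HB.instance Definition _ :=
  GRing.isZmodMorphism.Build {poly F} (fps F) poly_fps poly_fps_additive.
HB.instance Definition _ :=
  GRing.isMonoidMorphism.Build {poly F} (fps F) poly_fps poly_fps_multiplicative.

Lemma poly_fpsC c : poly_fps c%:P = fps_const c.
Proof. by apply/funext => -[|n]; rewrite /poly_fps coefC. Qed.

Lemma dvdXn_fps_ord n (q : {poly F}) : ('X^n %| q) <-> fps_ord n (poly_fps q).
Proof.
split=> [/dvdpP [u ->] i lt|q0]; first by rewrite /poly_fps coefMXn lt.
rewrite -(poly_take_drop n q) (_ : take_poly n q = 0) ?add0r ?dvdp_mull //.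
apply/polyP => i; rewrite coef_take_poly coef0; case: ltnP => // lt.
exact: q0.
Qed.

Lemma fps_ord_cancel n (f g : fps F) : fps_ord 1 f -> f 1%N != 0 ->
  fps_ord n.+1 (f * g) -> fps_ord n g.
Proof.
move=> f1 fn0 fg i; elim/ltn_ind: i => i IH lt.
have := fg i.+1 lt; rewrite coef_fpsM.
rewrite big_ord_recl f1 // mul0r add0r big_ord_recl /= /bump /= subSS subn0.
rewrite big1 ?addr0 => [/eqP|k _].
  by rewrite mulf_eq0 (negbTE fn0) => /eqP.
by rewrite IH ?mulr0 //; have := ltn_ord k; lia.
Qed.

End PolynomialSeries.

(** * Lifting formal arcs to blow-ups *)

Section BlowupArcs.
Variables (K : numFieldType) (N : nat).
Local Notation ev := (mmap (@fps_const K)).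
Implicit Types (Y : set 'rV[K]_N) (p : 'rV[K]_N) (f g : {mpoly K[N]}).
Implicit Types (delta : 'I_N -> fps K).

(** A morphism from Spec K[[t]] to the closure of [Y]. *)
Definition arc_in Y delta : Prop :=
  forall f, vanishing Y f -> ev delta f = 0.

(** The formula of [blowup_chart], for vectors given as functions. *)
Definition chart_map (B : comNzRingType) (j : 'I_N) (p y : 'I_N -> B) : 'I_N -> B :=
  fun k => p k + y j * (if k == j then 1 else y k).

(* Clearing the denominators of G((x_k - p_k) / (x_j - p_j)). *)
Lemma chart_numerator (j : 'I_N) p (G : {mpoly K[N]}) :
  exists (G' : {mpoly K[N]}) (M : nat),
    forall (B : comNzRingType) (iota : {rmorphism K -> B}) (y : 'I_N -> B),
      mmap iota (chart_map j (fun k => iota (p 0 k)) y) G' = y j ^+ M * mmap iota y G.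
Proof.
elim/mpoly_ring_ind: G => [c|i|a b [a' [m IHa]] [b' [n IHb]]|a b [a' [m IHa]] [b' [n IHb]]].
- by exists c%:MP, 0%N => B iota y; rewrite !mmapC expr0 mul1r.
- exists ('X_i - (p 0 i)%:MP), (i != j) => B iota y.
  rewrite mmapB mmapC !mmapX !mmap1U /chart_map addrC addKr.
  by case: (eqVneq i j) => [->|_]; rewrite ?expr0 ?expr1 ?mul1r ?mulr1.
- exists (('X_j - (p 0 j)%:MP) ^+ n * a' + ('X_j - (p 0 j)%:MP) ^+ m * b'), (m + n)%N.
  move=> B iota y; rewrite mmapD !rmorphM !rmorphXn /= mmapB mmapC mmapX mmap1U.
  rewrite IHa IHb mmapD exprD.
  set c := chart_map _ _ _ j - _; have -> : c = y j.
    by rewrite /c /chart_map eqxx mulr1 addrC addKr.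
  by ring.
- exists (a' * b'), (m + n)%N => B iota y.
  by rewrite !rmorphM /= IHa IHb exprD; ring.
Qed.

Lemma blowup_chartE (j : 'I_N) p (y : 'rV[K]_N) k :
  blowup_chart j p y 0 k = chart_map j (p 0) (y 0) k.
Proof. by rewrite mxE. Qed.

Lemma vanishing_aclosure (S : set 'rV[K]_N) f :
  vanishing (aclosure S) f -> vanishing S f.
Proof. by move=> f0 v Sv; apply: f0 => g; apply. Qed.

(** An equation [f] of the blow-up becomes an equation of [Y] once its denominators are cleared and
    it is multiplied by x_j - p_j. On the arc this says that a power of [delta1 j] times the value
    of [f] is 0, and power series form a domain. *)
Lemma blowup_arc j p Y delta delta1 : arc_in Y delta ->
    (forall k, delta k = chart_map j (fun k => fps_const (p 0 k)) delta1 k) ->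
    delta1 j != 0 ->
  arc_in (blowup j p Y) delta1.
Proof.
move=> Yd dE d1j f /vanishing_aclosure f0.
have [f' [M f'E]] := chart_numerator j p f.
have : vanishing Y (f' * ('X_j - (p 0 j)%:MP)).
  move=> x Yx; rewrite mevalM mevalB mevalC mevalXU.
  have [->|xj] := eqVneq (x 0 j) (p 0 j); first by rewrite subrr mulr0.
  have e0 : x 0 j - p 0 j != 0 by rewrite subr_eq0.
  pose y := \row_k (if k == j then x 0 j - p 0 j else (x 0 k - p 0 k) / (x 0 j - p 0 j)).
  have yE : blowup_chart j p y = x.
    apply/rowP => k; rewrite !mxE eqxx; case: (eqVneq k j) => [->|_].
      by rewrite mulr1 addrC subrK.
    by rewrite mulrCA divff // mulr1 addrC subrK.
  have fy : f.@[y 0] = 0.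
    apply: f0; rewrite /preimage /= yE; split => //= xp.
    by move: xj; rewrite xp eqxx.
  have -> : f'.@[x 0] = y 0 j ^+ M * f.@[y 0].
    rewrite -f'E; apply: meval_eq => k.
    by rewrite -yE blowup_chartE.
  by rewrite fy mulr0 mul0r.
move/Yd; rewrite rmorphM /= mmapB mmapX mmap1U mmapC.
rewrite (eq_mmap _ _ dE) f'E dE {1}/chart_map eqxx mulr1 addrC addKr.
case/fps_mul_eq0 => [|/eqP]; last by rewrite (negbTE d1j).
case/fps_mul_eq0 => [|//]; elim: M {f'E} => [/eqP|M IH].
  by rewrite expr0 oner_eq0.
by rewrite exprS => /fps_mul_eq0 [/eqP|//]; rewrite (negbTE d1j).
Qed.

(** Modulo the ideal of [Y], [f] is a polynomial in the x_i - p_i without terms of degree less than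
    [k], and each x_i - p_i has positive order along the arc. *)
Lemma ord_ge_arc k Y p f delta : ord_ge k Y p f -> arc_in Y delta ->
  (forall i, fps_ord 1 (delta i - fps_const (p 0 i))) -> fps_ord k (ev delta f).
Proof.
move=> [g fg gk] Yd dp.
have -> : ev delta f = ev delta g.
  by apply/eqP; rewrite -subr_eq0 -mmapB Yd.
pose e i := delta i - fps_const (p 0 i).
have -> : ev delta g = ev e (taylor g p).
  rewrite /taylor /comp_mpoly mmap_comp; apply: eq_mmap => i.
  by rewrite tnth_mktuple mmapD mmapX mmap1U mmapC /e subrK.
apply: fps_ord_sum => m _.
have [lt|ge] := ltnP (mdeg m) k.
  by rewrite gk // => i _; rewrite rmorph0 mul0r coef_fps0.
apply: fps_ordMl.
suff H : fps_ord (mdeg m) (mmap1 e m) by move=> i lt; apply: H; lia.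
rewrite mdegE /mmap1; elim/big_rec2: _ => [|i d x _ IH]; first by [].
by rewrite -[X in (X + _)%N]mul1n; apply: fps_ordM => //; apply: fps_ordX; apply: dp.
Qed.

Definition chart_poly j p f : {mpoly K[N]} :=
  mmap (@mpolyC N K) (chart_map j (fun k => (p 0 k)%:MP) (fun k => 'X_k)) f.

Lemma mmap_chart_poly (B : comNzRingType) (iota : {rmorphism K -> B}) y j p f :
  mmap iota y (chart_poly j p f) =
  mmap iota (chart_map j (fun k => iota (p 0 k)) y) f.
Proof.
rewrite mmap_comp; apply: eq_mmap => k; rewrite /chart_map mmapD mmapC rmorphM /=.
by rewrite mmapX mmap1U; case: eqP => _; rewrite ?rmorph1 // mmapX mmap1U.
Qed.

Lemma divisor_transform_arc j p Y f g delta1 : divisor_transform j p Y f g ->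
    arc_in (blowup j p Y) delta1 ->
  ev (chart_map j (fun k => fps_const (p 0 k)) delta1) f =
  delta1 j ^+ 2 * ev delta1 g.
Proof.
move=> fg Yd; rewrite -mmap_chart_poly.
apply/eqP; rewrite -subr_eq0.
have -> : delta1 j ^+ 2 * ev delta1 g = ev delta1 ('X_j ^+ 2 * g).
  by rewrite rmorphM rmorphXn /= mmapX mmap1U.
rewrite -mmapB Yd // => y Yy; rewrite mevalB mevalM rmorphXn /= mevalXU.
rewrite -fg //; apply/eqP; rewrite subr_eq0; apply/eqP.
transitivity (f.@[chart_map j (p 0) (y 0)]); first exact: (mmap_chart_poly idfun).
by apply: meval_eq => k; rewrite blowup_chartE.
Qed.

(** The j-th coordinate of the lift is delta_j - p_j, and the others are the quotients of delta_k -
    p_k by it; dividing by a series of order 1 costs one order of precision. The last clause keeps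
    the velocity along the coordinate [j] nonzero for the next blow-up. *)
Lemma lift_arc e j (gamma gamma1 : 'rV[{poly K}]_N) delta :
    (1 < e)%N -> (forall k, fps_ord e (delta k - poly_fps (gamma 0 k))) ->
    (gamma 0 j)`_1 != 0 -> jet_strict_transform e j gamma gamma1 ->
  exists delta1, [/\
    forall k, delta k =
      chart_map j (fun k => fps_const (jet_point gamma 0 k)) delta1 k,
    forall k, fps_ord e.-1 (delta1 k - poly_fps (gamma1 0 k)),
    fps_ord 1 (delta1 j) & delta1 j 1%N = (gamma 0 j)`_1
      /\ (gamma1 0 j)`_1 = (gamma 0 j)`_1].
Proof.
move=> e1 dg g1 jt.
have e2 : (e.-1.+1 = e)%N by lia.
pose P k := fps_const (jet_point gamma 0 k).
have dP k : fps_ord 1 (delta k - P k).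
  move=> [|//] _; rewrite coef_fpsB /P /= mxE.
  by have := dg k 0%N; rewrite coef_fpsB /poly_fps; apply; lia.
pose h := delta j - P j.
have h1 : h 1%N = (gamma 0 j)`_1.
  rewrite /h coef_fpsB subr0; apply/eqP; rewrite -subr_eq0; apply/eqP.
  exact: dg.
have hn0 : h 1%N != 0 by rewrite h1.
have jt' k : fps_ord e (P k + poly_fps (gamma1 0 j) *
    (if k == j then 1 else poly_fps (gamma1 0 k)) - poly_fps (gamma 0 k)).
  have /dvdXn_fps_ord := jt k; rewrite /blowup_chart !mxE rmorphB rmorphD rmorphM /=.
  by rewrite poly_fpsC /P mxE; case: eqP => _; rewrite ?rmorph1.
have jtd k : fps_ord e (poly_fps (gamma1 0 j) *
    (if k == j then 1 else poly_fps (gamma1 0 k)) - (delta k - P k)).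
  have -> : poly_fps (gamma1 0 j) * (if k == j then 1 else poly_fps (gamma1 0 k)) -
    (delta k - P k) = (P k + poly_fps (gamma1 0 j) *
    (if k == j then 1 else poly_fps (gamma1 0 k)) - poly_fps (gamma 0 k)) -
    (delta k - poly_fps (gamma 0 k)) by ring.
  by apply: fps_ordD => //; apply: fps_ordN.
have [q qE] := choice (fun k => fps_divide (dP j) hn0 (dP k)).
pose delta1 k := if k == j then h else q k.
have d1j : delta1 j = h by rewrite /delta1 eqxx.
have hg : fps_ord e (h - poly_fps (gamma1 0 j)).
  by have := fps_ordN (jtd j); rewrite eqxx mulr1 opprB.
exists delta1; split.
- move=> k; rewrite /chart_map d1j /delta1 -/(P k).
  case: (eqVneq k j) => [->|_]; first by rewrite mulr1 /h addrC subrK.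
  by rewrite /h -qE addrC subrK.
- move=> k; have [->|kj] := eqVneq k j.
    by rewrite d1j => i lt; apply: hg; lia.
  have -> : delta1 k = q k by rewrite /delta1 (negbTE kj).
  apply: (fps_ord_cancel (dP j) hn0); rewrite e2 -/h.
  have -> : h * (q k - poly_fps (gamma1 0 k)) =
    - ((h - poly_fps (gamma1 0 j)) * poly_fps (gamma1 0 k)) -
    (poly_fps (gamma1 0 j) * poly_fps (gamma1 0 k) - (delta k - P k)).
    by rewrite [delta k - _]qE -/h; ring.
  apply: fps_ordD; apply: fps_ordN; first by rewrite mulrC; apply: fps_ordMl.
  by have := jtd k; rewrite (negbTE kj).
- by rewrite d1j; apply: dP.
- rewrite d1j; split => //; rewrite -h1; apply/eqP; rewrite eq_sym -subr_eq0.
  by apply/eqP; apply: hg.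
Qed.

(* Each of the two blow-ups contributes t^2 and the last double point another
   t^2. *)
Lemma singular_along_arc Y (gamma : 'rV[{poly K}]_N) f delta :
    singular_along Y gamma f -> arc_in Y delta ->
    (forall k, fps_ord 3 (delta k - poly_fps (gamma 0 k))) ->
  fps_ord 6 (ev delta f).
Proof.
move=> [j [gamma1 [gamma2 [g1 [g2]]]]] /= [gj [jt1 jt2] _ [fg1 _] [g12 o2]] Yd dg.
have [delta1 [d1E d1g d1j [d1j1 g1j]]] := lift_arc (isT : (1 < 3)%N) dg gj jt1.
have [|delta2 [d2E d2g d2j [d2j1 _]]] := lift_arc (isT : (1 < 2)%N) d1g _ jt2.
  by rewrite g1j.
have nz (h : fps K) : h 1%N != 0 -> h != 0.
  by apply: contraNneq => ->; rewrite coef_fps0.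
have Y1d := blowup_arc Yd d1E (nz _ (_ : delta1 j 1%N != 0)).
rewrite d1j1 in Y1d; have {}Y1d := Y1d gj.
have Y2d := blowup_arc Y1d d2E (nz _ (_ : delta2 j 1%N != 0)).
rewrite d2j1 g1j in Y2d; have {}Y2d := Y2d gj.
rewrite (eq_mmap _ _ d1E) (divisor_transform_arc fg1) //.
rewrite (eq_mmap _ _ d2E) (divisor_transform_arc g12) //.
apply: (@fps_ordM _ 2 4); first exact: (@fps_ordX _ 1 2).
apply: (@fps_ordM _ 2 2); first exact: (@fps_ordX _ 1 2).
apply: (ord_ge_arc o2) => // i [|//] _.
by have := d2g i 0%N isT; rewrite !coef_fpsB /= mxE.
Qed.

End BlowupArcs.

(** * Invariance of the span of the jets *)

Section MatrixDerivation.
Variables (K : comNzRingType) (E : fieldType) (iota : {rmorphism K -> E}).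
Variables (D : E -> E) (hD : derivation iota D).

Lemma map_derD m n (A B : 'M[E]_(m, n)) :
  map_mx D (A + B) = map_mx D A + map_mx D B.
Proof. by apply/matrixP => i j; rewrite !mxE (derD_add hD). Qed.

Lemma map_derM m n p (A : 'M[E]_(m, n)) (B : 'M[E]_(n, p)) :
  map_mx D (A *m B) = map_mx D A *m B + A *m map_mx D B.
Proof.
apply/matrixP => i j; rewrite !mxE (derD_sum hD) -big_split /=.
by apply: eq_bigr => k _; rewrite (derD_mul hD) !mxE.
Qed.

Lemma map_derZ m n c (A : 'M[E]_(m, n)) :
  map_mx D (c *: A) = D c *: A + c *: map_mx D A.
Proof. by apply/matrixP => i j; rewrite !mxE (derD_mul hD). Qed.

Lemma map_derZn m n k (A : 'M[E]_(m, n)) :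
  map_mx D (k%:R *: A) = k%:R *: map_mx D A.
Proof. by rewrite map_derZ (derD_natr hD) scale0r add0r. Qed.

Lemma map_der0 m n : map_mx D (0 : 'M[E]_(m, n)) = 0.
Proof. by apply/matrixP => i j; rewrite !mxE (derD_0 hD). Qed.

Lemma map_derN m n (A : 'M[E]_(m, n)) : map_mx D (- A) = - map_mx D A.
Proof. by apply/matrixP => i j; rewrite !mxE (derD_opp hD). Qed.

Lemma map_der_sub m n q (A : 'M[E]_(n, q)) (t : 'M[E]_(m, q)) :
  (map_mx D A <= A)%MS -> (t <= A)%MS -> (map_mx D t <= A)%MS.
Proof.
move=> sA /submxP [c ->]; rewrite map_derM addmx_sub ?submxMl //.
exact: submx_trans (submxMl _ _) sA.
Qed.

End MatrixDerivation.

Lemma derivation_lincomb (K E : comNzRingType) (iota : {rmorphism K -> E})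
    (D : E -> E) m (b : 'I_m -> E -> E) (c : 'I_m -> E) :
  derivation iota D -> (forall w, derivation iota (b w)) ->
  derivation iota (fun e => D e + \sum_w c w * b w e).
Proof.
move=> hD hb; split=> [x y|x y|k].
- rewrite (derD_add hD) addrACA -big_split /=; congr (_ + _).
  by apply: eq_bigr => w _; rewrite (derD_add (hb w)) mulrDr.
- rewrite (derD_mul hD) mulrDl mulrDr !mulr_sumr mulr_suml addrACA -big_split /=.
  by congr (_ + _); apply: eq_bigr => w _; rewrite (derD_mul (hb w)); ring.
- by rewrite (derD_cst hD) big1 ?addr0 // => w _; rewrite (derD_cst (hb w)) mulr0.
Qed.

(** * Commutation relations on jets and their consequences *)

Section JetAlgebra.
Variables (K : comNzRingType) (E : fieldType) (iota : {rmorphism K -> E}).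
Hypothesis char0 : forall n, n.+1%:R != 0 :> E.
Variables (m q : nat) (D : E -> E) (d a b : 'I_m -> E -> E) (x : 'rV[E]_q).
Hypotheses (hD : derivation iota D) (hd : forall w, derivation iota (d w)).
Hypotheses (ha : forall w, derivation iota (a w)).
Hypotheses (hb : forall w, derivation iota (b w)).
Hypothesis dD : forall w e, d w (D e) = D (d w e).
Hypothesis dd : forall w v e, d w (d v e) = d v (d w e).
Hypothesis aD : forall w e, a w (D e) = D (a w e) + d w e.
Hypothesis bD : forall w e, b w (D e) = D (b w e) + 2%:R * a w e.
Hypothesis ad : forall w v e, a w (d v e) = d v (a w e).
Hypothesis bd : forall w v e, b w (d v e) = d v (b w e).
Hypotheses (ax : forall w i, a w (x 0 i) = 0) (bx : forall w i, b w (x 0 i) = 0).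

(** In what follows Y_j and X_j stand for [jetY j] and [jetX j]. All that is known of [d], [a], [b]
    here is their commutation relations with [D] and with each other, and that [a] and [b] kill
    [x]. *)
Definition jetY j : 'M[E]_(m, q) := \matrix_(k, i) iter j D (d k (x 0 i)).
Definition jetX j : 'rV[E]_q := map_mx (iter j D) x.
Definition jetW := (jetY 0 + jetY 1 + jetY 2)%MS.

(** The second derivatives that appear when a relation between the Y_j is differentiated along [a]
    or [b]. *)
Let H j w : 'M[E]_(m, q) := \matrix_(k, i) iter j D (d w (d k (x 0 i))).

Let D0 : D 0 = 0 := derD_0 hD.

Lemma d_iter w j e : d w (iter j D e) = iter j D (d w e).
Proof. by elim: j => //= j IH; rewrite dD IH. Qed.

(** A change of the coefficient of t in the arc changes a function along it by t times its
    derivative along [d w]; the factor is the quotient of the factorials of [j] and [j.-1] in the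
    Taylor coefficients. *)
Lemma a_iter w j e : a w e = 0 -> a w (iter j D e) = j%:R * iter j.-1 D (d w e).
Proof.
move=> ae; elim: j => [|j IH]; first by rewrite mul0r.
rewrite iterS aD IH d_iter (derD_mul hD) (derD_natr hD) mul0r add0r.
by case: j {IH} => [|j]; rewrite /= ?mul0r ?add0r ?mul1r // -[in RHS]natr1; ring.
Qed.

Lemma b_iter w j e : a w e = 0 -> b w e = 0 ->
  b w (iter j D e) = (j * j.-1)%:R * iter j.-2 D (d w e).
Proof.
move=> ae be; elim: j => [|j IH]; first by rewrite mul0r.
rewrite iterS bD IH (a_iter _ ae) (derD_mul hD) (derD_natr hD) mul0r add0r.
case: j {IH} => [|[|j]]; rewrite /= ?mul0n ?muln0 ?mul0r ?mulr0 ?add0r ?mul1r //.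
by rewrite !natrM -![in RHS]natr1 -![in LHS]natr1; ring.
Qed.

Let ady w k i : a w (d k (x 0 i)) = 0.
Proof. by rewrite ad ax (derD_0 (hd k)). Qed.
Let bdy w k i : b w (d k (x 0 i)) = 0.
Proof. by rewrite bd bx (derD_0 (hd k)). Qed.
Let addy w k l i : a w (d k (d l (x 0 i))) = 0.
Proof. by rewrite ad ady (derD_0 (hd k)). Qed.
Let bddy w k l i : b w (d k (d l (x 0 i))) = 0.
Proof. by rewrite bd bdy (derD_0 (hd k)). Qed.

Let DY j : map_mx D (jetY j) = jetY j.+1.
Proof. by apply/matrixP => k i; rewrite !mxE. Qed.
Let DH j w : map_mx D (H j w) = H j.+1 w.
Proof. by apply/matrixP => k i; rewrite !mxE. Qed.
Let DX j : map_mx D (jetX j) = jetX j.+1.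
Proof. by apply/matrixP => k i; rewrite !mxE. Qed.
Let aY w j : map_mx (a w) (jetY j) = j%:R *: H j.-1 w.
Proof. by apply/matrixP => k i; rewrite !mxE a_iter. Qed.
Let bY w j : map_mx (b w) (jetY j) = (j * j.-1)%:R *: H j.-2 w.
Proof. by apply/matrixP => k i; rewrite !mxE b_iter. Qed.
Let bH0 w l : map_mx (b w) (H 0 l) = 0.
Proof. by apply/matrixP => k i; rewrite !mxE /= bddy. Qed.
Let bH1 w l : map_mx (b w) (H 1 l) = 0.
Proof. by apply/matrixP => k i; rewrite !mxE /= bD bddy addy D0 mulr0 addr0. Qed.
Let aX w j : map_mx (a w) (jetX j) = j%:R *: row w (jetY j.-1).
Proof. by apply/rowP => i; rewrite !mxE a_iter. Qed.
Let bX w j : map_mx (b w) (jetX j) = (j * j.-1)%:R *: row w (jetY j.-2).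
Proof. by apply/rowP => i; rewrite !mxE b_iter. Qed.
(* The symmetric bilinear form with values sum_(k, l) z_k z'_l d_k d_l x,
   differentiated j times. *)
Let Q j (z z' : 'rV[E]_m) : 'rV[E]_q := \sum_w z' 0 w *: (z *m H j w).

Let Q_sym j z z' : Q j z z' = Q j z' z.
Proof.
apply/rowP => i; rewrite /Q !summxE.
under eq_bigr do rewrite !mxE mulr_sumr.
under [RHS]eq_bigr do rewrite !mxE mulr_sumr.
rewrite exchange_big /=; apply: eq_bigr => k _; apply: eq_bigr => w _.
rewrite !mxE dd; ring.
Qed.

Let mulmx_rows p (z : 'rV[E]_m) (A : 'M[E]_(m, p)) :
  \sum_w z 0 w *: row w A = z *m A.
Proof. by rewrite mulmx_sum_row. Qed.

Let Y0W : (jetY 0 <= jetW)%MS.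
Proof. by rewrite /jetW (submx_trans (addsmxSl (jetY 0) (jetY 1))) ?addsmxSl. Qed.
Let Y1W : (jetY 1 <= jetW)%MS.
Proof. by rewrite /jetW (submx_trans (addsmxSr (jetY 0) (jetY 1))) ?addsmxSl. Qed.
Let Y2W : (jetY 2 <= jetW)%MS.
Proof. by rewrite /jetW addsmxSr. Qed.
Let mulW j (c : 'rV[E]_m) : (j <= 2)%N -> (c *m jetY j <= jetW)%MS.
Proof.
move=> le; apply: submx_trans (submxMl _ _) _.
by case: j le => [|[|[|]]].
Qed.
Let subW (u v : 'rV[E]_q) : (u <= jetW)%MS -> (v <= jetW)%MS -> ((u - v)%R <= jetW)%MS.
Proof. by move=> uW vW; rewrite addmx_sub // -scaleN1r scalemx_sub. Qed.
Let rowW j w : (j <= 2)%N -> (row w (jetY j) <= jetW)%MS.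
Proof.
move=> le; apply: submx_trans (row_sub _ _) _.
by case: j le => [|[|[|]]].
Qed.

Let scaleW k (u : 'rV[E]_q) : (k.+1%:R *: u <= jetW)%MS -> (u <= jetW)%MS.
Proof. by move=> ku; rewrite -[u](scalerK (char0 k)) scalemx_sub. Qed.

Lemma sub_jetW (u : 'rV[E]_q) : (u <= jetW)%MS ->
  exists l0 l1 v : 'rV[E]_m, u = l0 *m jetY 0 + l1 *m jetY 1 + v *m jetY 2.
Proof.
move=> /sub_addsmxP [[c v] /= ->].
have /sub_addsmxP [[l0 l1] /= ->] : (c *m (jetY 0 + jetY 1)%MS <= jetY 0 + jetY 1)%MS.
  exact: submxMl.
by exists l0, l1, v.
Qed.

(** With D^4 x = l0 Y_0 + l1 Y_1 + v Y_2, the vector D^5 x is v Y_3 modulo W. Differentiating this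
    expression along [a], [b], [D] and the combination [beta] of the [b] with coefficients [v] gives
    relations modulo W between v Y_3, (beta v) Y_3 and the values of [Q 1] at (v, v) and (beta v,
    v), which suffice to isolate v Y_3. *)
Lemma jetX5_sub : (jetX 4 <= jetW)%MS -> (jetX 5 <= jetW)%MS.
Proof.
move=> /sub_jetW [l0 [l1 [v X4E]]].
suff vY3 : (v *m jetY 3 <= jetW)%MS.
  rewrite -DX X4E !(map_derD hD) !(map_derM hD) !DY.
  by rewrite !addmx_sub // mulW.
pose beta e := \sum_u v 0 u * b u e.
have hbeta : derivation iota beta.
  have /= h0 : derivation iota (fun=> 0 : E).
    by split=> *; rewrite ?mul0r ?mulr0 ?addr0.
  have := derivation_lincomb (fun u => v 0 u) h0 hb.
  by rewrite (_ : (fun e => _) = beta) //; apply/funext => e; rewrite add0r.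
pose v' := map_mx beta v.
have beta_map k p (A : 'M[E]_(k, p)) :
    map_mx beta A = \sum_u v 0 u *: map_mx (b u) A.
  apply/matrixP => i j; rewrite !mxE summxE; apply: eq_bigr => u _.
  by rewrite !mxE.
have contract (z : 'rV[E]_m) (G : 'I_m -> 'rV[E]_q) :
    (forall w, (G w <= jetW)%MS) -> ((\sum_w z 0 w *: G w)%R <= jetW)%MS.
  by move=> GW; apply: summx_sub => w _; apply: scalemx_sub.
(* differentiate X4E along b_w *)
have E2 w : v *m H 0 w = 6%:R *: row w (jetY 2) - 2%:R^-1 *:
   (map_mx (b w) l0 *m jetY 0 + map_mx (b w) l1 *m jetY 1 + map_mx (b w) v *m jetY 2).
  have := congr1 (map_mx (b w)) X4E.
  rewrite bX !(map_derD (hb w)) !(map_derM (hb w)) !bY /= !scale0r !mulmx0 !addr0.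
  rewrite -scalemxAr => bE.
  have -> : 6%:R *: row w (jetY 2) = 2%:R^-1 *: ((4 * 3)%:R *: row w (jetY 2)).
    rewrite scalerA; congr (_ *: _). rewrite (natrM _ 4 3). by field; exact: (char0 1).
  rewrite bE -scalerBr addrA [X in X - _]addrC addrK scalerA mulVf ?scale1r //.
have QvW w : (v *m H 0 w <= jetW)%MS.
  rewrite E2; apply: subW; first by apply: scalemx_sub; apply: rowW.
  by apply: scalemx_sub; rewrite !addmx_sub // mulW.
have Q0v z : (Q 0 v z <= jetW)%MS by apply: contract.
(* differentiate X4E along a_w *)
have E3 w : ((4%:R *: row w (jetY 3) - 2%:R *: (v *m H 1 w) - l1 *m H 0 w)%R <= jetW)%MS.
  have := congr1 (map_mx (a w)) X4E.
  rewrite aX !(map_derD (ha w)) !(map_derM (ha w)) !aY /= scale0r mulmx0 addr0.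
  rewrite scale1r -scalemxAr => ->.
  set A0 := map_mx _ l0 *m _; set A1 := map_mx _ l1 *m _; set A2 := map_mx _ v *m _.
  set B := l1 *m _; set C := 2%:R *: _.
  have -> : A0 + (A1 + B) + (A2 + C) - C - B = A0 + A1 + A2.
    by apply/rowP => i; rewrite !mxE; ring.
  by rewrite !addmx_sub // mulW.
(* differentiate E2 along D *)
have E4 w : ((v *m H 1 w + map_mx D v *m H 0 w - 6%:R *: row w (jetY 3)
    + 2%:R^-1 *: (map_mx (b w) v *m jetY 3))%R <= jetW)%MS.
  have := congr1 (map_mx D) (E2 w).
  rewrite (map_derM hD) DH (map_derD hD) (map_derN hD) (map_derZn hD).
  rewrite map_row DY.
  have D2 : D 2%:R^-1 = 0 :> E.
    apply: (mulfI (char0 1)); rewrite mulr0.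
    have := derD_mul hD 2%:R 2%:R^-1; rewrite divff ?(char0 1) //.
    by rewrite (derD_1 hD) (derD_natr hD) mul0r add0r.
  rewrite (map_derZ hD) D2 scale0r add0r !(map_derD hD) !(map_derM hD) !DY.
  set A0 := map_mx D (map_mx (b w) l0) *m _; set A1 := map_mx D (map_mx (b w) l1) *m _.
  set A2 := map_mx D (map_mx (b w) v) *m _.
  set B0 := map_mx (b w) l0 *m _; set B1 := map_mx (b w) l1 *m _.
  set C := map_mx (b w) v *m _; set G := 6%:R *: _.
  move=> DE; rewrite [v *m H 1 w + _]addrC DE.
  have -> : G - 2%:R^-1 *: (A0 + B0 + (A1 + B1) + (A2 + C)) - G + 2%:R^-1 *: C =
      - (2%:R^-1 *: (A0 + B0 + (A1 + B1) + A2)).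
    by rewrite addrA !scalerDr; apply/rowP => i; rewrite !mxE; ring.
  by rewrite -scaleN1r !scalemx_sub // !addmx_sub // mulW.
have betaY j : map_mx beta (jetY j) = (j * j.-1)%:R *: \sum_u v 0 u *: H j.-2 u.
  rewrite beta_map scaler_sumr; apply: eq_bigr => u _.
  by rewrite bY !scalerA mulrC.
have betaH j w : (j <= 1)%N -> map_mx beta (H j w) = 0.
  case: j => [|[|]] // _; rewrite beta_map big1 // => u _;
  by rewrite ?bH0 ?bH1 scaler0.
have rowH j w : row w (\sum_u v 0 u *: H j u) = v *m H j w.
  apply/rowP => i; rewrite !mxE summxE; apply: eq_bigr => u _.
  by rewrite !mxE dd.
(* [beta] kills Y_0 and Y_1, and the rows of beta Y_2 are the doubles of the v H_0 w, which lie in W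
   by [QvW]. *)
have stableW : (map_mx beta jetW <= jetW)%MS.
  apply/row_subP => i; rewrite -map_row.
  have /sub_jetW [c0 [c1 [c2 ->]]] := row_sub i jetW.
  rewrite !(map_derD hbeta) !(map_derM hbeta) !betaY /= !scale0r !mulmx0 !addr0.
  rewrite !addmx_sub ?mulW // -scalemxAr scalemx_sub //.
  apply: submx_trans (submxMl _ _) _; apply/row_subP => w.
  by rewrite rowH.
have Q0v' z : (Q 0 v' z <= jetW)%MS.
  apply: contract => w; have := map_der_sub hbeta stableW (QvW w).
  by rewrite (map_derM hbeta) betaH // mulmx0 addr0.
(* Apply [beta] to [E3]; 24 is 4 times the factor 3 * 2 of beta Y_3. *)
have E5 w : ((24%:R *: (v *m H 1 w) - 2%:R *: (v' *m H 1 w)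
    - map_mx beta l1 *m H 0 w)%R <= jetW)%MS.
  have := map_der_sub hbeta stableW (E3 w).
  rewrite !(map_derD hbeta) !(map_derN hbeta) !(map_derZn hbeta) map_row betaY.
  rewrite !(map_derM hbeta) !betaH // !mulmx0 !addr0 linearZ /= rowH scalerA.
  by rewrite -natrM.
pose A := v *m jetY 3; pose B := v' *m jetY 3.
have sumE (z : 'rV[E]_m) j : \sum_w z 0 w *: row w (jetY j) = z *m jetY j.
  exact: mulmx_rows.
(* The relations [E4], [E3], [E5] are now contracted with [v], and [E3] also with [v']; the terms in
   [Q 0] disappear into W. *)
have F4 : ((Q 1 v v - 6%:R *: A + 2%:R^-1 *: B)%R <= jetW)%MS.
  have := contract v _ E4.
  under eq_bigr do rewrite !(scalerDr, scalerN) !scalerA ![v 0 _ * _]mulrC -!scalerA.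
  rewrite !big_split /= sumrN -!scaler_sumr sumE -/(Q 1 v v) -/(Q 0 (map_mx D v) v).
  have -> : \sum_w v 0 w *: (map_mx (b w) v *m jetY 3) = B.
    rewrite /B /v' beta_map mulmx_suml; apply: eq_bigr => w _.
    by rewrite scalemxAl.
  move=> F; have := subW F (Q0v (map_mx D v)).
  rewrite Q_sym; congr (is_true (submx _ _)).
  by rewrite /A; apply/rowP => i; rewrite !mxE; ring.
have F3 z : (Q 0 l1 z <= jetW)%MS ->
    ((4%:R *: (z *m jetY 3) - 2%:R *: Q 1 v z)%R <= jetW)%MS.
  move=> l1z; have := contract z _ E3.
  under eq_bigr do rewrite !(scalerDr, scalerN) !scalerA ![z 0 _ * _]mulrC -!scalerA.
  rewrite !big_split /= !sumrN -!scaler_sumr sumE -/(Q 1 v z) -/(Q 0 l1 z) => F.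
  by have := addmx_sub F l1z; rewrite subrK.
have F5 : ((24%:R *: Q 1 v v - 2%:R *: Q 1 v' v)%R <= jetW)%MS.
  have := contract v _ E5.
  under eq_bigr do rewrite !(scalerDr, scalerN) !scalerA ![v 0 _ * _]mulrC -!scalerA.
  rewrite !big_split /= !sumrN -!scaler_sumr -/(Q 1 v v) -/(Q 1 v' v).
  rewrite -/(Q 0 (map_mx beta l1) v) => F.
  have := Q0v (map_mx beta l1); rewrite Q_sym => G.
  by have := addmx_sub F G; rewrite subrK.
have F3v := F3 v; rewrite Q_sym in F3v; have {}F3v := F3v (Q0v l1).
have F3v' := F3 v'; rewrite Q_sym in F3v'; have {}F3v' := F3v' (Q0v' l1).
rewrite -/A in F3v; rewrite -/B [Q 1 v v']Q_sym in F3v'.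
apply: (scaleW (k := 15)); rewrite -/A.
(* The coefficients 8, 16, 1, -1 eliminate [B] and both values of [Q 1]. *)
have -> : 16%:R *: A = 8%:R *: (Q 1 v v - 6%:R *: A + 2%:R^-1 *: B)
   + 16%:R *: (4%:R *: A - 2%:R *: Q 1 v v)
   + (24%:R *: Q 1 v v - 2%:R *: Q 1 v' v)
   - (4%:R *: B - 2%:R *: Q 1 v' v).
  move: (Q 1 v v) (Q 1 v' v) {F4 F3 F5 F3v F3v'} => R1 R2.
  clearbody A B; apply/rowP => i; rewrite !mxE.
  by field; exact: (char0 1).
apply: subW => //; apply: addmx_sub => //.
by apply: addmx_sub; apply: scalemx_sub.
Qed.

(** The only obstruction to stability under [D] is D Y_2 = Y_3. Differentiating the expression of
    D^5 x along [b w] determines the rows of Y_3 modulo T up to a combination of second derivatives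
    H_0, which the [b] can compensate because they send Y_2 to 2 H_0. *)
Lemma jet_stable : (jetX 5 <= jetW + jetX 4)%MS ->
  exists rho : 'I_m -> E,
    let D' := fun e => D e + \sum_w rho w * b w e in
    (map_mx D' (jetW + jetX 4)%MS <= jetW + jetX 4)%MS.
Proof.
set T := (jetW + jetX 4)%MS.
move=> /sub_addsmxP [[c al] /= X5E].
have [l0 [l1 [rho cE]]] := sub_jetW (submxMl c jetW); rewrite cE in X5E.
have WT (u : 'rV[E]_q) : (u <= jetW)%MS -> (u <= T)%MS.
  by move=> uW; apply: submx_trans uW (addsmxSl _ _).
have X4T (e : 'M[E]_1) : (e *m jetX 4 <= T)%MS.
  exact: submx_trans (submxMl _ _) (addsmxSr _ _).
have E1 w : ((20%:R *: row w (jetY 3) - 2%:R *: (rho *m H 0 w))%R <= T)%MS.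
  have := congr1 (map_mx (b w)) X5E.
  rewrite bX !(map_derD (hb w)) !(map_derM (hb w)) !bY bX /= !scale0r !mulmx0 !addr0.
  rewrite -!scalemxAr => ->.
  set A0 := _ *m jetY 0; set A1 := _ *m jetY 1; set A2 := _ *m jetY 2.
  set G := _ *m jetX 4; set B := 2%:R *: _; set C := al *m _.
  have -> : A0 + A1 + (A2 + B) + (G + (4 * 3)%:R *: C) - B =
      A0 + A1 + A2 + (4 * 3)%:R *: C + G.
    by apply/rowP => i; rewrite !mxE; ring.
  rewrite addmx_sub ?X4T // WT // !addmx_sub ?mulW // scalemx_sub //.
  by apply: submx_trans (submxMl _ _) _; apply: rowW.
(* D' Y_2 = Y_3 + 2 sum_u mu_u H_0 u; for this value its row [w] is the vector of [E1] divided by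
   20. *)
pose mu w := - (20%:R^-1 * rho 0 w).
exists mu; pose D' e := D e + \sum_w mu w * b w e; rewrite -/D'.
have hD' : derivation iota D' by apply: derivation_lincomb.
have D'map k p (A : 'M[E]_(k, p)) :
    map_mx D' A = map_mx D A + \sum_u mu u *: map_mx (b u) A.
  apply/matrixP => i j; rewrite !mxE summxE; congr (_ + _).
  by apply: eq_bigr => u _; rewrite !mxE.
have D'Y j : map_mx D' (jetY j) = jetY j.+1
    + (j * j.-1)%:R *: \sum_u mu u *: H j.-2 u.
  rewrite D'map DY scaler_sumr; congr (_ + _); apply: eq_bigr => u _.
  by rewrite bY !scalerA mulrC.
have rowT (u : 'rV[E]_q) : (u <= T)%MS -> (map_mx D' u <= T)%MS.
  move=> /sub_addsmxP [[e f] /= ->].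
  have [c0 [c1 [c2 ->]]] := sub_jetW (submxMl e jetW).
  rewrite !(map_derD hD') !(map_derM hD') !D'Y /= !scale0r !addr0.
  have Y3T : ((c2 *m (jetY 3 + 2%:R *: (\sum_u mu u *: H 0 u)))%R <= T)%MS.
    apply: submx_trans (submxMl _ _) _; apply/row_subP => w.
    have -> : row w (jetY 3 + 2%:R *: (\sum_u mu u *: H 0 u)) =
      20%:R^-1 *: (20%:R *: row w (jetY 3) - 2%:R *: (rho *m H 0 w)).
      rewrite linearD linearZ /= scalerBr scalerA mulVf ?scale1r; last exact: (char0 19).
      congr (_ + _); apply/rowP => i; rewrite !mxE summxE -mulNr !mulr_sumr.
      by apply: eq_bigr => k _; rewrite !mxE dd /mu; ring.
    exact/scalemx_sub/E1.
  have D'X4 : (f *m map_mx D' (jetX 4) <= T)%MS.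
    apply: submx_trans (submxMl _ _) _; rewrite D'map DX X5E.
    rewrite addmx_sub //; first by rewrite addmx_sub ?X4T // WT // !addmx_sub ?mulW.
    by apply: summx_sub => w _; rewrite bX !scalemx_sub // WT // rowW.
  rewrite !addmx_sub ?X4T // WT // ?mulW //.
by apply/row_subP => i; rewrite -map_row; apply/rowT/row_sub.
Qed.

(** If D^4 x lies in W, so does D^5 x by [jetX5_sub]; otherwise D^4 x already fills the only
    dimension allowed beyond W. *)
Theorem jet_span_invariant : (\rank (jetW + jetX 4 + jetX 5)%MS <= (\rank jetW).+1)%N ->
  exists rho : 'I_m -> E,
    let D' := fun e => D e + \sum_w rho w * b w e in
    (map_mx D' (jetW + jetX 4)%MS <= jetW + jetX 4)%MS.
Proof.
move=> rk; apply: jet_stable.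
have [X4W|nX4W] := boolP (jetX 4 <= jetW)%MS.
  exact: submx_trans (jetX5_sub X4W) (addsmxSl _ _).
have lt : (jetW < jetW + jetX 4)%MS.
  by rewrite /ltmx addsmxSl addsmx_sub submx_refl.
have le := ltmxErank (jetW) (jetW + jetX 4)%MS.
have r1 : (\rank jetW < \rank (jetW + jetX 4)%MS)%N by move: lt; rewrite le => /andP [].
have : (jetW + jetX 4 + jetX 5 <= jetW + jetX 4)%MS.
  rewrite -(mxrank_leqif_sup (addsmxSl (jetW + jetX 4)%MS (jetX 5))).
  by rewrite eqn_leq mxrankS ?addsmxSl //= (leq_trans rk).
by rewrite addsmx_sub => /andP [].
Qed.

End JetAlgebra.

(** A family in [S] with independent values and of largest size, which is at most [s]. *)
Lemma finite_spanning_family (F : fieldType) (T : Type) (S : T -> Prop) s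
    (rho : T -> 'rV[F]_s) :
  exists d (y : 'I_d -> T), [/\ forall k, S (y k), row_free (\matrix_k rho (y k))
    & forall w, S w -> (rho w <= \matrix_k rho (y k))%MS].
Proof.
pose indep d := `[< exists y : 'I_d -> T,
  (forall k, S (y k)) /\ row_free (\matrix_k rho (y k)) >].
case: (pselect (exists t, S t)) => [[t0 St0]|nS]; last first.
  pose y0 (k : 'I_0) : T := match notF (ltn_ord k) return T with end.
  exists 0%N, y0; split; [by case| |by move=> w Sw; case: nS; exists w].
  by rewrite /row_free -leqn0 rank_leq_row.
have ex0 : exists d, indep d.
  exists 0%N; apply/asboolP; exists (fun=> t0); split; first by case.
  by rewrite /row_free -leqn0 rank_leq_row.
have bnd d : indep d -> (d <= s)%N.
  by move=> /asboolP [y [_ /eqP <-]]; apply: rank_leq_col.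
case: (ex_maxnP ex0 bnd) => d /asboolP [y [Sy free]] dmax.
exists d, y; split => // w Sw.
set P := \matrix_k rho (y k) in free *.
apply/negP => nP.
suff /dmax : indep d.+1 by rewrite ltnn.
apply/asboolP; exists (fun k : 'I_d.+1 => if unlift ord0 k is Some k' then y k' else w).
split; first by move=> k; case: unliftP.
have -> : \matrix_k rho (if unlift ord0 k is Some k' then y k' else w) =
    col_mx (rho w) P :> 'M_(1 + d, s).
  apply/row_matrixP => k; rewrite rowK.
  case: (split_ordP k) => [k'|k'] ->.
    by rewrite rowKu [k']ord1 (_ : lshift d 0 = ord0) ?unlift_none ?row_id //; apply/val_inj.
  by rewrite rowKd rowK (_ : rshift 1 k' = lift ord0 k') ?liftK //; apply/val_inj.
have w0 : rho w != 0 by apply/eqP => r0; apply: nP; rewrite r0 sub0mx.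
suff rk : \rank (col_mx (rho w) P) = d.+1 by rewrite /row_free rk.
rewrite -addsmxE mxrank_disjoint_sum.
  by rewrite rank_rV w0 (eqP free).
apply/eqP; rewrite -mxrank_eq0 -leqn0 -ltnS.
have rk1 : \rank (rho w) = 1%N by rewrite rank_rV w0.
rewrite -[X in (_ < X)%N]rk1; apply: rank_ltmx.
by rewrite /ltmx capmxSl sub_capmx submx_refl /=; apply/negP.
Qed.

Definition vjoin (B : Type) N1 N2 (v1 : 'I_N1 -> B) (v2 : 'I_N2 -> B) :
    'I_(N1 + N2) -> B :=
  fun i => match split i with inl a => v1 a | inr b => v2 b end.

Lemma vjoinl (B : Type) N1 N2 (v1 : 'I_N1 -> B) (v2 : 'I_N2 -> B) a :
  vjoin v1 v2 (lshift N2 a) = v1 a.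
Proof. by rewrite /vjoin (unsplitK (inl a)). Qed.

Lemma vjoinr (B : Type) N1 N2 (v1 : 'I_N1 -> B) (v2 : 'I_N2 -> B) b :
  vjoin v1 v2 (rshift N1 b) = v2 b.
Proof. by rewrite /vjoin (unsplitK (inr b)). Qed.

Lemma vjoin_eta (B : Type) N1 N2 (v : 'I_(N1 + N2) -> B) :
  vjoin (fun a => v (lshift N2 a)) (fun b => v (rshift N1 b)) =1 v.
Proof. by move=> i; rewrite /vjoin; case: splitP => j ij; congr v; apply/val_inj. Qed.

(** * Products and frames of vector fields *)

Section Products.
Variable K : numFieldType.
Implicit Types N : nat.

Definition prod_set N1 N2 (S1 : ('I_N1 -> K) -> Prop) (S2 : ('I_N2 -> K) -> Prop)
    (v : 'I_(N1 + N2) -> K) : Prop :=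
  S1 (fun a => v (lshift N2 a)) /\ S2 (fun b => v (rshift N1 b)).

(** Monomial by monomial. One splitting serves for all rings of values: the ground field, function
    fields, power series. *)
Lemma separate_variables N1 N2 (F : {mpoly K[N1 + N2]}) :
  exists s (G : 'I_s -> {mpoly K[N1]}) (H : 'I_s -> {mpoly K[N2]}),
  forall (B : comNzRingType) (iota : {rmorphism K -> B}) v1 v2,
    mmap iota (vjoin v1 v2) F = \sum_i mmap iota v1 (G i) * mmap iota v2 (H i).
Proof.
pose ms := msupp F; pose m (i : 'I_(size ms)) := nth 0%MM ms i.
exists (size ms), (fun i => (F@_(m i))%:MP * \prod_a 'X_a ^+ (m i (lshift N2 a))),
  (fun i => \prod_b 'X_b ^+ (m i (rshift N1 b))) => B iota v1 v2.
rewrite {1}/mmap (big_nth 0%MM) big_mkord; apply: eq_bigr => i _.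
rewrite /= (rmorphM (mmap iota v1)) /= mmapC -mulrA; congr (_ * _).
rewrite /mmap1 big_split_ord /=; congr (_ * _); rewrite rmorph_prod /=.
  by apply: eq_bigr => a _; rewrite vjoinl rmorphXn /= mmapX mmap1U.
by apply: eq_bigr => b _; rewrite vjoinr rmorphXn /= mmapX mmap1U.
Qed.

Section TwoFactors.
Variables (N1 N2 : nat) (S1 : ('I_N1 -> K) -> Prop) (S2 : ('I_N2 -> K) -> Prop).

Lemma vanish_on_prod (F : {mpoly K[N1 + N2]}) :
    (forall v1 v2, S1 v1 -> S2 v2 -> F.@[vjoin v1 v2] = 0) ->
  vanish_on (prod_set S1 S2) F.
Proof.
by move=> F0 v [v1 v2]; rewrite -(F0 _ _ v1 v2); apply: meval_eq => i; rewrite vjoin_eta.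
Qed.

Lemma prod_vanish_on (F : {mpoly K[N1 + N2]}) v1 v2 :
  vanish_on (prod_set S1 S2) F -> S1 v1 -> S2 v2 -> F.@[vjoin v1 v2] = 0.
Proof.
move=> F0 Sv1 Sv2; apply: F0; split.
  by rewrite (_ : (fun _ => _) = v1) //; apply/funext => a; rewrite vjoinl.
by rewrite (_ : (fun _ => _) = v2) //; apply/funext => a; rewrite vjoinr.
Qed.

(** If [p] and [q] are each nonzero somewhere on the product, suitable slices of them are nonzero on
    [S2], hence both nonzero at a common [y]; the slices at [y] are then nonzero on [S1], and so is
    their product. *)
Lemma aprime_prod : aprime S1 -> aprime S2 -> aprime (prod_set S1 S2).
Proof.
move=> [[w1 Sw1] pr1] [[w2 Sw2] pr2]; split.
  exists (vjoin w1 w2); split.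
    by rewrite (_ : (fun _ => _) = w1) //; apply/funext => a; rewrite vjoinl.
  by rewrite (_ : (fun _ => _) = w2) //; apply/funext => a; rewrite vjoinr.
move=> p q pq0.
have freeze1 (F : {mpoly K[N1 + N2]}) v1 :
    exists F', forall v2, F.@[vjoin v1 v2] = F'.@[v2].
  have [s [G [H E]]] := separate_variables F.
  exists (\sum_i (G i).@[v1] *: H i) => v2.
  rewrite [LHS](E K idfun) raddf_sum; apply: eq_bigr => i _ /=.
  by rewrite mevalZ.
have freeze2 (F : {mpoly K[N1 + N2]}) v2 :
    exists F', forall v1, F.@[vjoin v1 v2] = F'.@[v1].
  have [s [G [H E]]] := separate_variables F.
  exists (\sum_i (H i).@[v2] *: G i) => v1.
  rewrite [LHS](E K idfun) raddf_sum; apply: eq_bigr => i _ /=.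
  by rewrite mevalZ mulrC.
have ex (F : {mpoly K[N1 + N2]}) : ~ vanish_on (prod_set S1 S2) F ->
    exists v1 v2, [/\ S1 v1, S2 v2 & F.@[vjoin v1 v2] != 0].
  move=> F0; apply: contrapT => nex; apply: F0; apply: vanish_on_prod => v1 v2 Sv1 Sv2.
  by apply/eqP/negP => /negP Fn; apply: nex; exists v1, v2.
apply: contrapT => /not_orP [/ex [a1 [a2 [Sa1 Sa2 pa]]] /ex [b1 [b2 [Sb1 Sb2 qb]]]].
have [p1 p1E] := freeze1 p a1; have [q1 q1E] := freeze1 q b1.
have [y [Sy py qy]] : exists y, [/\ S2 y, p1.@[y] != 0 & q1.@[y] != 0].
  apply: contrapT => nex; have [] := pr2 p1 q1.
  - move=> y Sy; rewrite mevalM; apply/eqP/negP => /negP; rewrite mulf_eq0 negb_or.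
    by case/andP => ? ?; apply: nex; exists y.
  - by move=> /(_ _ Sa2) /eqP; rewrite -p1E (negbTE pa).
  - by move=> /(_ _ Sb2) /eqP; rewrite -q1E (negbTE qb).
have [p2 p2E] := freeze2 p y; have [q2 q2E] := freeze2 q y.
have [] := pr1 p2 q2.
- by move=> x Sx; rewrite mevalM -p2E -q2E -mevalM; apply: prod_vanish_on.
- by move=> /(_ _ Sa1) /eqP; rewrite -p2E p1E (negbTE py).
- by move=> /(_ _ Sb1) /eqP; rewrite -q2E q1E (negbTE qy).
Qed.

(* Points of S1 and S2 with values in a K-algebra B form a B-point of the
   product: the monomials in the second group of variables are, on S2,
   combinations of their values at finitely many points of S2. *)
Lemma prod_vanish_algebra (B : comNzRingType) (iota : {rmorphism K -> B})
    (x1 : 'I_N1 -> B) (x2 : 'I_N2 -> B) :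
    (forall g, vanish_on S1 g -> mmap iota x1 g = 0) ->
    (forall g, vanish_on S2 g -> mmap iota x2 g = 0) ->
  forall F, vanish_on (prod_set S1 S2) F -> mmap iota (vjoin x1 x2) F = 0.
Proof.
move=> Sx1 Sx2 F F0; have [s [G [H E]]] := separate_variables F.
pose rho (y : 'I_N2 -> K) : 'rV[K]_s := \row_i (H i).@[y].
have [d [y [Sy free rhoP]]] := finite_spanning_family S2 rho.
set P := \matrix_k rho (y k) in free rhoP.
have [C PC] := row_freeP free.
pose T i := \sum_k H k * ((C *m P) k i)%:MP - H i.
have T0 i : vanish_on S2 (T i).
  move=> w Sw; have [a aE] := submxP (rhoP w Sw).
  have : rho w *m (C *m P) = rho w by rewrite aE -mulmxA (mulmxA P) PC mul1mx.
  move/rowP/(_ i); rewrite !mxE => e; rewrite mevalB raddf_sum /= -[(H i).@[w]]e.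
  rewrite -sumrB big1 // => k _; by rewrite mevalM mevalC !mxE subrr.
have x2E i : mmap iota x2 (H i) =
    \sum_k mmap iota x2 (H k) * iota ((C *m P) k i).
  have := Sx2 _ (T0 i); rewrite mmapB => /eqP; rewrite subr_eq0 => /eqP <-.
  by rewrite raddf_sum; apply: eq_bigr => k _; rewrite /= (rmorphM (mmap iota x2)) /= mmapC.
have PG l : \sum_i iota (P l i) * mmap iota x1 (G i) = 0.
  transitivity (mmap iota x1 (\sum_i (P l i)%:MP * G i)).
    rewrite raddf_sum; apply: eq_bigr => i _.
    by rewrite /= (rmorphM (mmap iota x1)) /= mmapC.
  apply: Sx1 => w Sw; rewrite -[RHS](prod_vanish_on F0 Sw (Sy l)).
  rewrite [RHS](E K idfun) raddf_sum; apply: eq_bigr => i _ /=.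
  by rewrite mevalM mevalC !mxE mulrC.
rewrite E; under eq_bigr do rewrite x2E mulr_sumr.
rewrite exchange_big /= big1 // => k _.
transitivity (mmap iota x2 (H k) *
    \sum_l iota (C k l) * \sum_i iota (P l i) * mmap iota x1 (G i)).
  rewrite mulr_sumr; under [RHS]eq_bigr do rewrite mulr_sumr mulr_sumr.
  rewrite exchange_big /=; apply: eq_bigr => i _.
  rewrite mxE rmorph_sum mulr_sumr mulr_sumr; apply: eq_bigr => l _.
  by rewrite rmorphM; ring.
by rewrite big1 ?mulr0 // => l _; rewrite PG mulr0.
Qed.

End TwoFactors.

Lemma aprime_full N : aprime (fun _ : 'I_N -> K => True).
Proof.
split; first by exists (fun=> 0).
move=> p q pq; have /eqP : p * q = 0 by apply: mpoly_eq0_eval => w; apply: pq.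
by rewrite mulf_eq0 => /orP [] /eqP ->; [left|right] => w _; rewrite meval0.
Qed.

(* The points of S where f does not vanish, with the inverse of f as an
   additional coordinate. *)
Definition localize N (S : ('I_N -> K) -> Prop) (f : {mpoly K[N]})
    (v : 'I_(N + 1) -> K) : Prop :=
  S (fun a => v (lshift 1 a)) /\
  v (rshift N ord0) * f.@[fun a => v (lshift 1 a)] = 1.

(** Multiplying by a power of [f] removes the additional coordinate and turns an equation of the
    localization into one that can be tested on [S]. *)
Lemma aprime_localize N (S : ('I_N -> K) -> Prop) f :
  aprime S -> ~ vanish_on S f -> aprime (localize S f).
Proof.
move=> [_ pr] fS.
have loc w : S w -> f.@[w] != 0 -> localize S f (vjoin w (fun=> f.@[w]^-1)).
  move=> Sw fw; rewrite /localize vjoinr.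
  have -> : (fun a => vjoin w (fun=> f.@[w]^-1) (lshift 1 a)) = w.
    by apply/funext => a; rewrite vjoinl.
  by rewrite mulVf.
split.
  have [w [Sw fw]] : exists w, S w /\ f.@[w] != 0.
    apply: contrapT => nex; apply: fS => w Sw; apply/eqP/negP => /negP fw.
    by apply: nex; exists w.
  by exists (vjoin w (fun=> f.@[w]^-1)); apply: loc.
have num (p : {mpoly K[N + 1]}) : exists p' M, forall w s, s * f.@[w] = 1 ->
    p'.@[w] = f.@[w] ^+ M * p.@[vjoin w (fun=> s)].
  elim/mpoly_ring_ind: p => [c|i|a b [a' [m IHa]] [b' [n IHb]]|a b [a' [m IHa]] [b' [n IHb]]].
  - by exists c%:MP, 0%N => w s _; rewrite !mevalC mul1r.
  - case: (split_ordP i) => j ->.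
      by exists 'X_j, 0%N => w s _; rewrite !mevalXU vjoinl mul1r.
    by exists 1, 1%N => w s sf; rewrite meval1 mevalXU vjoinr expr1 mulrC sf.
  - exists (f ^+ n * a' + f ^+ m * b'), (m + n)%N => w s sf.
    rewrite mevalD !mevalM (IHa _ _ sf) (IHb _ _ sf) !rmorphXn mevalD exprD /=.
    by ring.
  - exists (a' * b'), (m + n)%N => w s sf.
    by rewrite !mevalM (IHa _ _ sf) (IHb _ _ sf) exprD; ring.
move=> p q pq; have [p' [m p'E]] := num p; have [q' [n q'E]] := num q.
have back g g' M : (forall w s, s * f.@[w] = 1 ->
    g'.@[w] = f.@[w] ^+ M * g.@[vjoin w (fun=> s)]) ->
    vanish_on S g' -> vanish_on (localize S f) g.
  move=> gE g'0 v [Sv vf]; have := gE _ _ vf; rewrite g'0 // => /esym/eqP.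
  rewrite mulf_eq0 expf_eq0 => /orP [/andP [_ /eqP f0]|/eqP g0].
    by move: vf; rewrite f0 mulr0 => /eqP; rewrite eq_sym oner_eq0.
  rewrite -[RHS]g0; apply: meval_eq => i; rewrite -[LHS](vjoin_eta v).
  by rewrite /vjoin; case: split => // b; rewrite [b]ord1.
have : vanish_on S (p' * q' * f).
  move=> w Sw; rewrite !mevalM.
  have [->|fw] := eqVneq f.@[w] 0; first by rewrite mulr0.
  have sf : f.@[w]^-1 * f.@[w] = 1 by rewrite mulVf.
  have pq0 := pq _ (loc w Sw fw); rewrite mevalM in pq0.
  rewrite (p'E _ _ sf) (q'E _ _ sf) mulrACA pq0 mulr0 mul0r //.
case/pr => [/pr []|//]; first by left; apply: (back _ _ _ p'E).
by right; apply: (back _ _ _ q'E).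
Qed.

End Products.

Lemma vspace_matrix (F : fieldType) q (U : {vspace 'rV[F]_q}) :
  exists B : 'M[F]_(\dim U, q), row_free B /\ forall v, (v \in U) = (v <= B)%MS.
Proof.
pose B := \matrix_(i < \dim U) (vbasis U)`_i.
have cB (c : 'rV_(\dim U)) : c *m B = \sum_i c 0 i *: (vbasis U)`_i.
  by rewrite mulmx_sum_row; apply: eq_bigr => i _; rewrite rowK.
exists B; split.
  apply: inj_row_free => c; rewrite cB => c0; apply/rowP => i; rewrite mxE.
  by have /freeP := basis_free (vbasisP U); apply.
move=> v; apply/idP/idP => [/coord_vbasis ->|/submxP [c ->]].
  apply/submxP; exists (\row_i coord (vbasis U) i v); rewrite cB.
  by apply: eq_bigr => i _; rewrite mxE.
rewrite cB memv_suml // => i _; apply: memvZ; apply: vbasis_mem.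
by apply: mem_nth; rewrite size_tuple.
Qed.

Lemma matrix_vspace (F : fieldType) m q (M : 'M[F]_(m, q)) :
  exists U : {vspace 'rV[F]_q}, \dim U = \rank M /\ forall v, (v \in U) = (v <= M)%MS.
Proof.
pose U := (\sum_i <[row i M]>)%VS.
have UE v : (v \in U) = (v <= M)%MS.
  apply/memv_sumP/submxP => [[w wi ->]|[c ->]].
    have /all_sig [c cE] i : {c | w i = c *: row i M}.
      by apply: cid; have /vlineP [c ->] := wi i isT; exists c.
    exists (\row_i c i); rewrite mulmx_sum_row; apply: eq_bigr => i _.
    by rewrite mxE cE.
  exists (fun i => c 0 i *: row i M); last by rewrite mulmx_sum_row.
  by move=> i _; apply: memvZ; apply: memv_line.
exists U; split => //; have [B [/eqP rB BE]] := vspace_matrix U.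
rewrite -rB; apply/eqP; rewrite eqn_leq !mxrankS //.
  by apply/row_subP => i; rewrite -BE UE row_sub.
by apply/row_subP => i; rewrite -UE BE row_sub.
Qed.

(** * Etale coordinates and frames of tangent fields at a smooth point *)

Section Frames.
Variables (K : numFieldType) (r n : nat) (X : set 'rV[K]_r.+1).
Hypotheses (X_closed : pclosed X) (X_irr : pirreducible X) (X_chain : has_chain X n).

(** Tangent vectors to the affine cone over X at a point with values in the algebra [B], such as the
    generic point. *)
Definition tangent_at (B : comNzRingType) (iota : {rmorphism K -> B})
    (xi : 'I_r.+1 -> B) (v : 'rV[B]_r.+1) : Prop :=
  forall g, vanishing X g -> \sum_k mmap iota xi g^`M(k) * v 0 k = 0.

(** On the open set where [f] is invertible, u = x L are etale coordinates of the cone, and the rows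
    of Y / f are the derivations d/du_k. The clauses say that the rows of [Y] are tangent to X, that
    they span all tangent vectors, that they are dual to u up to the factor [f], and that u is
    algebraically independent on X. *)
Definition smooth_frame (f : {mpoly K[r.+1]}) (L : 'M[K]_(r.+1, n.+1))
    (Y : 'M[{mpoly K[r.+1]}]_(n.+1, r.+1)) : Prop :=
  [/\ forall i g, vanishing X g -> vanishing X (\sum_k Y i k * g^`M(k)),
      forall (B : comNzRingType) (iota : {rmorphism K -> B}) xi v,
        tangent_at iota xi v ->
        mmap iota xi f *: v = v *m map_mx iota L *m map_mx (mmap iota xi) Y,
      Y *m map_mx (@mpolyC r.+1 K) L = f%:M
    & forall p : {mpoly K[n.+1]},
        (forall v, X v -> p.@[(v *m L) 0] = 0) -> p = 0].

Lemma derivation_tangent (E : comNzRingType) (iota : {rmorphism K -> E}) xi D :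
    derivation iota D -> (forall g, vanishing X g -> mmap iota xi g = 0) ->
  tangent_at iota xi (\row_k D (xi k)).
Proof.
move=> hD xiX g g0; have := congr1 D (xiX g g0).
rewrite (derD_0 hD) (derD_mmap hD) => e0; rewrite -[RHS]e0.
by apply: eq_bigr => k _; rewrite mxE.
Qed.

(* Gh is an invertible extension of the Jacobian matrix of the equations g_a,
   normalised to be the identity at p; Y is read off its adjugate. *)
Lemma exists_smooth_frame p : smooth_locus n X p ->
  exists f L Y, f.@[p 0] != 0 /\ smooth_frame f L Y.
Proof.
move=> [Xp [U [dimU TU]]].
have tanU v : tangent_at idfun (p 0) v <-> v \in U.
  have [->|v0] := eqVneq v 0.
    by rewrite mem0v; split=> // _ g _; rewrite big1 // => k _; rewrite mxE mulr0.
  have : tangent_space X p v <-> (v != 0 /\ v \in U) by rewrite TU.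
  rewrite /tangent_space /= => TUv; split => h; first by case: TUv.1.
  by case: TUv => _ /(_ (conj v0 h)) [].
have [B [Bfree BU]] := vspace_matrix U; rewrite dimU in B Bfree BU.
have [B' BB'] := row_freeP Bfree.
pose grad (g : {mpoly K[r.+1]}) : 'rV[K]_r.+1 := \row_k g^`M(k).@[p 0].
have [d [g [gX Gfree Gspan]]] := finite_spanning_family (vanishing X) grad.
have [C GC] := row_freeP Gfree.
set G := \matrix_a grad (g a) in Gfree Gspan GC.
pose J := G^T; pose A := C^T.
have AJ : A *m J = 1%:M by rewrite /A /J -trmx_mul GC trmx1.
have tanJ v : tangent_at idfun (p 0) v <-> v *m J = 0.
  split=> [tv|vJ h hX].
    apply/rowP => a; rewrite [RHS]mxE -[RHS](tv (g a) (gX a)) mxE.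
    by apply: eq_bigr => k _; rewrite !mxE mulrC.
  have [c cE] := submxP (Gspan h hX).
  have : v *m (grad h)^T = 0 by rewrite cE trmx_mul mulmxA vJ mul0mx.
  move/rowP/(_ 0); rewrite [RHS]mxE => e0; rewrite -[RHS]e0 [RHS]mxE.
  by apply: eq_bigr => k _; rewrite !mxE mulrC.
have BJ : B *m J = 0.
  apply/row_matrixP => i; rewrite row_mul row0; apply/tanJ/tanU.
  by rewrite BU row_sub.
(* [Q] projects onto the tangent space at [p], the left kernel of [J]; [L] gives the coordinates of
   this projection in the basis [B]. *)
pose Q := 1%:M - J *m A; pose L := Q *m B'.
have QJ : Q *m J = 0 by rewrite mulmxBl mul1mx -mulmxA AJ mulmx1 subrr.
have QE : L *m B = Q.
  have /submxP [D QD] : (Q <= B)%MS.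
    apply/row_subP => i; rewrite -BU; apply/tanU/tanJ.
    by rewrite -row_mul QJ row0.
  by rewrite /L QD -!mulmxA (mulmxA B B') BB' mul1mx.
pose Jp : 'M[{mpoly K[r.+1]}]_(r.+1, d) := \matrix_(k, a) (g a)^`M(k).
pose cst a b (M : 'M[K]_(a, b)) := map_mx (@mpolyC r.+1 K) M.
pose Gh := Jp *m cst _ _ A + cst _ _ Q.
pose f := \det Gh; pose Y := cst _ _ B *m \adj Gh.
have cstE (R : comNzRingType) (iota : {rmorphism K -> R}) xi a b (M : 'M[K]_(a, b)) :
    map_mx (mmap iota xi) (cst a b M) = map_mx iota M.
  by apply/matrixP => i j; rewrite !mxE mmapC.
have Gxi (R : comNzRingType) (iota : {rmorphism K -> R}) xi :
    map_mx (mmap iota xi) Gh =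
    map_mx (mmap iota xi) Jp *m map_mx iota A + map_mx iota Q.
  by rewrite map_mxD map_mxM !cstE.
have GhJ : Gh *m cst _ _ J = Jp.
  rewrite mulmxDl -mulmxA -!map_mxM AJ QJ map_mx1 mulmx1.
  by rewrite map_mx0 addr0.
have YGh : Y *m Gh = f *: cst _ _ B by rewrite -mulmxA mul_adj_mx mul_mx_scalar.
have YJ : Y *m Jp = 0.
  by rewrite -GhJ mulmxA YGh -scalemxAl -map_mxM BJ map_mx0 scaler0.
have YL : Y *m cst _ _ L = f%:M.
  have YQ : Y *m cst _ _ Q = f *: cst _ _ B.
    by rewrite -YGh mulmxDr mulmxA YJ mul0mx add0r.
  by rewrite /cst map_mxM mulmxA YQ -scalemxAl -map_mxM BB' map_mx1 scalemx1.
have f1 : f.@[p 0] = 1.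
  rewrite /f -[LHS](det_map_mx (meval (p 0))).
  rewrite (Gxi K idfun) (_ : map_mx _ Jp = J); last first.
    by apply/matrixP => i j; rewrite !mxE.
  have idE a b (M : 'M[K]_(a, b)) : map_mx idfun M = M by apply/matrixP=> i j; rewrite mxE.
  rewrite !idE.
  by rewrite /Q addrC subrK det1.
have span (R : comNzRingType) (iota : {rmorphism K -> R}) xi v :
    tangent_at iota xi v ->
    mmap iota xi f *: v = v *m map_mx iota L *m map_mx (mmap iota xi) Y.
  move=> tv.
  have vJ : v *m map_mx (mmap iota xi) Jp = 0.
    apply/rowP => a; rewrite [RHS]mxE -[RHS](tv (g a) (gX a)) mxE.
    by apply: eq_bigr => k _; rewrite !mxE mulrC.
  rewrite /Y (map_mxM (mmap iota xi)) mulmxA cstE -[v *m _ *m map_mx iota B]mulmxA -map_mxM QE.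
  have -> : v *m map_mx iota Q = v *m map_mx (mmap iota xi) Gh.
    by rewrite Gxi mulmxDr mulmxA vJ mul0mx add0r.
  by rewrite -mulmxA -map_mxM mul_mx_adj map_scalar_mx mul_mx_scalar.
exists f, L, Y; split; first by rewrite f1 oner_neq0.
have Xprime := pirreducible_aprime X_closed X_irr.
have [E [iota [xi gen]]] := exists_generic_point Xprime.
have [J0 J0free] := chain_free_coords X_chain.
have zind := free_coords_indep gen J0free.
(* Derivations dual to [n.+1] free coordinates yield independent tangent vectors at the generic
   point, where [Y] is therefore an invertible combination of them ([YE]). The tangency of [Y] and
   the independence of x L follow from this. *)
have [D DP] := choice (fun i : 'I_n.+1 =>
  exists_derivation gen zind (fun l => (i == l)%:R)).
pose De : 'M[E]_(n.+1, r.+1) := \matrix_(i, k) D i (xi k).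
have xiX h : vanishing X h -> mmap iota xi h = 0.
  by move=> h0; apply/gen.1/vanish_on_points.
have fxi : mmap iota xi f != 0.
  apply/eqP => /gen.1/vanish_on_points /(_ p Xp) /eqP.
  by rewrite f1 oner_eq0.
have DeE : mmap iota xi f *: De = De *m map_mx iota L *m map_mx (mmap iota xi) Y.
  apply/row_matrixP => i; rewrite !row_mul linearZ /=.
  rewrite (_ : row i De = \row_k D i (xi k)); last by apply/rowP => k; rewrite !mxE.
  exact/span/(derivation_tangent (DP i).1).
pose Sel : 'M[E]_(r.+1, n.+1) := \matrix_(k, i) (k == J0 i)%:R.
have DeSel : De *m Sel = 1%:M.
  apply/matrixP => i l; rewrite !mxE (bigD1 (J0 l)) //= !mxE eqxx mulr1.
  rewrite (DP i).2 big1 ?addr0 // => k /negbTE kJ.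
  by rewrite !mxE kJ mulr0.
pose DL := De *m map_mx iota L.
have DLunit : DL \in unitmx.
  suff : DL *m ((mmap iota xi f)^-1 *: (map_mx (mmap iota xi) Y *m Sel)) = 1%:M.
    by case/mulmx1_unit.
  by rewrite -scalemxAr mulmxA -DeE -scalemxAl DeSel scalerA mulVf ?scale1r.
have YE : map_mx (mmap iota xi) Y = invmx DL *m (mmap iota xi f *: De).
  by rewrite DeE mulmxA mulVmx // mul1mx.
split=> //.
- move=> i h h0; apply/vanish_on_points/gen.1.
  pose gam : 'cV[E]_r.+1 := \col_k mmap iota xi h^`M(k).
  have Dg : De *m gam = 0.
    apply/colP => j; rewrite [RHS]mxE -(derD_0 (DP j).1) -(xiX h h0).
    rewrite (derD_mmap (DP j).1) mxE; apply: eq_bigr => k _.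
    by rewrite !mxE mulrC.
  have : (map_mx (mmap iota xi) Y *m gam) i 0 = 0.
    by rewrite YE -mulmxA -scalemxAl Dg scaler0 mulmx0 mxE.
  rewrite mxE => e0; rewrite -[RHS]e0 raddf_sum; apply: eq_bigr => k _.
  by rewrite !mxE /= (rmorphM (mmap iota xi)).
- move=> q q0; pose ufm k : {mpoly K[r.+1]} := \sum_j (L j k)%:MP * 'X_j.
  have ufmE (R : comNzRingType) (j : {rmorphism K -> R}) x k :
      mmap j x (ufm k) = \sum_l x l * j (L l k).
    rewrite raddf_sum; apply: eq_bigr => l _.
    by rewrite /= (rmorphM (mmap j x)) /= mmapC mmapX mmap1U mulrC.
  apply: (@jacobian_alg_indep _ _ iota _ (fun k => mmap iota xi (ufm k)) _ D).
  + by move=> i; apply: (DP i).1.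
  + move=> b b0; have DLb : DL *m (\col_l b l) = 0.
      apply/colP => i; rewrite [RHS]mxE -[RHS](b0 i) mxE.
      apply: eq_bigr => l _; rewrite ufmE (derD_sum (DP i).1) !mxE mulrC.
      rewrite !mulr_sumr; apply: eq_bigr => k _.
      by rewrite (derD_mul (DP i).1) (derD_cst (DP i).1) mulr0 addr0 !mxE.
    have : \col_l b l = 0 by rewrite -(mulKmx DLunit (\col_l b l)) DLb mulmx0.
    by move=> bc l; have /colP/(_ l) := bc; rewrite !mxE.
  + rewrite -mmap_comp; apply/gen.1/vanish_on_points => v Xv.
    rewrite [LHS]mmap_comp -[RHS](q0 v Xv); apply: eq_mmap => k.
    by rewrite ufmE mxE.
Qed.

End Frames.

(** * Jets of X *)

Section SpecialArcs.
Variables (K : numFieldType) (r n : nat) (X : set 'rV[K]_r.+1).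
Hypothesis X_closed : pclosed X.
Local Notation ev := (mmap (@fps_const K)).

Lemma mderiv_derivation N (k : 'I_N) : derivation (@mpolyC N K) (mderiv k).
Proof. by split=> [p q|p q|c]; rewrite ?mderivD ?mderivM ?mderivC. Qed.

Lemma mderivXU N (k i : 'I_N) : ('X_i : {mpoly K[N]})^`M(k) = (i == k)%:R.
Proof.
rewrite mderivX mnm1E; case: eqP => [->|_]; last by rewrite scale0r.
have -> : (U_(k) - U_(k) = 0 :> 'X_{1..N})%MM.
  by apply/mnmP => j; rewrite mnmBE mnm0E subnn.
by rewrite mpolyX0 scale1r.
Qed.

Lemma tangent_space_scale p (t : K) : t != 0 ->
  (tangent_space X p `<=` tangent_space X (t *: p))%classic.
Proof.
move=> t0 v [v0 tv]; split => // g gX.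
pose gt := mmap (@mpolyC r.+1 K) (fun i => t%:MP * 'X_i) g.
have gtE (x : 'rV[K]_r.+1) : gt.@[x 0] = g.@[(t *: x) 0].
  rewrite [LHS]mmap_comp; apply: eq_mmap => i.
  by rewrite -[LHS]/((t%:MP * 'X_i).@[x 0]) mevalM mevalC mevalXU mxE.
have dE k : gt^`M(k).@[p 0] = t * g^`M(k).@[(t *: p) 0].
  rewrite /gt (derD_mmap (mderiv_derivation k)) (bigD1 k) //= big1 => [|i /negbTE ne].
    rewrite addr0 mderivM mderivC mul0r add0r mderivXU eqxx mulr1 mevalM mevalC mulrC.
    congr (_ * _); rewrite [LHS]mmap_comp; apply: eq_mmap => i.
    by rewrite -[LHS]/((t%:MP * 'X_i).@[p 0]) mevalM mevalC mevalXU mxE.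
  by rewrite mderivM mderivC mul0r add0r mderivXU ne !mulr0.
have gtX : vanishing X gt by move=> x Xx; rewrite gtE; apply/gX/(pclosed_cone X_closed).
apply: (mulfI t0); rewrite mulr0 -[RHS](tv gt gtX) mulr_sumr.
by apply: eq_bigr => k _; rewrite dE mulrA.
Qed.

Lemma smooth_locus_scale p (t : K) : smooth_locus n X p -> t != 0 ->
  smooth_locus n X (t *: p).
Proof.
move=> [Xp Tp] t0; split; first exact: (pclosed_cone X_closed).
rewrite (_ : tangent_space X (t *: p) = tangent_space X p) //.
apply/seteqP; split; last exact: tangent_space_scale.
have := @tangent_space_scale (t *: p) t^-1; rewrite scalerA mulVf // scale1r.
by apply; rewrite invr_eq0.
Qed.

(** [g'] is g(w / w_k) with its denominators cleared; [t] stands for the inverse of w_k in an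
    arbitrary ring. *)
Lemma homogenize_chart (k : 'I_r.+1) (g : {mpoly K[r.+1]}) : exists g' e,
  forall (B : comNzRingType) (iota : {rmorphism K -> B}) (w : 'I_r.+1 -> B) t,
    t * w k = 1 -> mmap iota w g' = w k ^+ e * mmap iota (fun i => t * w i) g.
Proof.
elim/mpoly_ring_ind: g => [c|i|a b [a' [m IHa]] [b' [l IHb]]|a b [a' [m IHa]] [b' [l IHb]]].
- by exists c%:MP, 0%N => B iota w t _; rewrite !mmapC mul1r.
- exists 'X_i, 1%N => B iota w t tw; rewrite !mmapX !mmap1U expr1.
  by rewrite mulrA [w k * t]mulrC tw mul1r.
- exists ('X_k ^+ l * a' + 'X_k ^+ m * b'), (m + l)%N => B iota w t tw.
  rewrite mmapD !(rmorphM (mmap iota w)) !(rmorphXn (mmap iota w)) /= mmapX mmap1U.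
  by rewrite (IHa _ _ _ _ tw) (IHb _ _ _ _ tw) mmapD exprD; ring.
- exists (a' * b'), (m + l)%N => B iota w t tw.
  by rewrite !rmorphM /= (IHa _ _ _ _ tw) (IHb _ _ _ _ tw) exprD; ring.
Qed.

Lemma arc_in_chart k delta h : arc_in X delta -> h * delta k = 1 ->
  arc_in (affine_piece X k) (fun i => h * delta i).
Proof.
move=> Xd hd g g0; have [g' [e g'E]] := homogenize_chart k g.
have g'X : vanishing X (g' * 'X_k).
  move=> x Xx; rewrite mevalM mevalXU.
  have [->|xk] := eqVneq (x 0 k) 0; first by rewrite mulr0.
  have tx : (x 0 k)^-1 * x 0 k = 1 by rewrite mulVf.
  suff -> : g'.@[x 0] = 0 by rewrite mul0r.
  rewrite [LHS](g'E _ _ _ _ tx) -[X in _ * X](_ : g.@[((x 0 k)^-1 *: x) 0] = _).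
    rewrite g0 ?mulr0 //; split; last by rewrite mxE tx.
    by apply: (pclosed_cone X_closed) => //; rewrite invr_eq0.
  by apply: meval_eq => i; rewrite mxE.
have dk0 : delta k != 0.
  by apply/eqP => dk; move/eqP: hd; rewrite dk mulr0 eq_sym oner_eq0.
have := Xd _ g'X; rewrite (rmorphM (ev delta)) /= mmapX mmap1U (g'E _ _ _ _ hd).
case/fps_mul_eq0 => [|/eqP]; last by rewrite (negbTE dk0).
case/fps_mul_eq0 => // /eqP dke; exfalso; move: dke.
elim: e {g'E} => [|e IH]; first by rewrite expr0 oner_eq0.
by rewrite exprS => /eqP/fps_mul_eq0 [/eqP|/eqP //]; rewrite (negbTE dk0).
Qed.

Lemma fps_ord_mmap N e (d1 d2 : 'I_N -> fps K) g :
  (forall i, fps_ord e (d1 i - d2 i)) -> fps_ord e (ev d1 g - ev d2 g).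
Proof.
move=> d12; elim/mpoly_ring_ind: g => [c|i|p q IHp IHq|p q IHp IHq].
- by rewrite !mmapC subrr => i _; rewrite coef_fps0.
- by rewrite !mmapX !mmap1U.
- rewrite !mmapD; move: (ev d1 p) (ev d2 p) (ev d1 q) (ev d2 q) IHp IHq => a b c d ab cd.
  by rewrite opprD addrACA; apply: fps_ordD.
- rewrite !(rmorphM (ev _)) /=.
  move: (ev d1 p) (ev d2 p) (ev d1 q) (ev d2 q) IHp IHq => a b c d ab cd.
  have -> : a * c - b * d = a * (c - d) + d * (a - b) by ring.
  by apply: fps_ordD; apply: fps_ordMl.
Qed.

Lemma ev_linform (h : 'rV[K]_r.+1) (d : 'I_r.+1 -> fps K) :
  ev d (linform h) = \sum_i fps_const (h 0 i) * d i.
Proof.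
rewrite /linform raddf_sum; apply: eq_bigr => i _.
by rewrite /= mmapZ mmapX mmap1U.
Qed.

Lemma meval_linform (h v : 'rV[K]_r.+1) :
  (linform h).@[v 0] = \sum_i h 0 i * v 0 i.
Proof.
rewrite /linform raddf_sum; apply: eq_bigr => i _.
by rewrite /= mevalZ mevalXU.
Qed.

Hypothesis r_ge : (3 * n + 2 <= r)%N.
Hypothesis X_special : forall (k : 'I_r.+1) (gamma : 'rV[{poly K}]_r.+1),
  curvilinear3 (affine_piece X k) gamma -> smooth_locus n X (jet_point gamma) ->
  special_along n X k gamma.

(** A hyperplane singular along the common scheme of length 3 vanishes to order 6 on each arc, hence
    contains its coefficients up to t^5: these lie in the tangent space along the scheme, of
    projective dimension at most 3n+1 and vector dimension at most 3n+2. The last hypothesis says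
    that the arc [delta t0] is immersed in projective space at t = 0. Dividing an arc by its k-th
    coordinate, a unit, brings it into a chart. *)
Lemma special_arcs (T : Type) (delta : T -> 'I_r.+1 -> fps K) (t0 : T) :
    (forall t, arc_in X (delta t)) ->
    (forall t i, fps_ord 3 (delta t i - delta t0 i)) ->
    smooth_locus n X (\row_i delta t0 i 0%N) ->
    (exists i j, delta t0 i 0%N * delta t0 j 1%N != delta t0 j 0%N * delta t0 i 1%N) ->
  exists U : {vspace 'rV[K]_r.+1}, (\dim U <= 3 * n + 2)%N /\
    forall t j, (j < 6)%N -> \row_i delta t i j \in U.
Proof.
move=> Xd d3 sm [i1 [j1 nprop]].
set p := \row_i _ in sm.
have p0 : p != 0 by apply: (pclosed_nz X_closed); case: sm.
have /rV0Pn [k pk] := p0.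
have dk0 t : delta t k 0%N != 0.
  have := d3 t k 0%N isT; rewrite coef_fpsB => /eqP; rewrite subr_eq0 => /eqP ->.
  by move: pk; rewrite mxE.
have /choice [h hE] t : exists h, delta t k * h = 1 by apply: fps_inverse.
pose nd t i := h t * delta t i.
have ndE t i : delta t i = delta t k * nd t i by rewrite /nd mulrA hE mul1r.
have Ynd t : arc_in (affine_piece X k) (nd t).
  by apply: arc_in_chart => //; rewrite mulrC hE.
have nd3 t i : fps_ord 3 (nd t i - nd t0 i).
  have -> : nd t i - nd t0 i = h t * (delta t i - delta t0 i -
      nd t0 i * (delta t k - delta t0 k)).
    have hk : h t * delta t k = 1 by rewrite mulrC hE.
    transitivity (h t * delta t i - (h t * delta t k) * nd t0 i); first by rewrite hk mul1r.
    by rewrite (ndE t0 i); ring.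
  apply: fps_ordMl; apply: fps_ordD; first exact: d3.
  by apply/fps_ordN/fps_ordMl.
pose gamma : 'rV[{poly K}]_r.+1 := \row_i \poly_(l < 3) nd t0 i l.
have gnd t i : fps_ord 3 (nd t i - poly_fps (gamma 0 i)).
  move=> l lt; have := nd3 t i l lt; rewrite !coef_fpsB => /eqP.
  by rewrite subr_eq0 => /eqP ->; rewrite /poly_fps mxE coef_poly lt subrr.
have ptE : jet_point gamma = h t0 0%N *: p.
  apply/rowP => i; rewrite !mxE coef_poly /= /nd.
  by rewrite coef_fpsM big_ord1 subn0.
have h0 : h t0 0%N != 0.
  apply/eqP => h0; have := congr1 (fun g : fps K => g 0%N) (hE t0).
  by rewrite coef_fpsM big_ord1 subn0 h0 mulr0 => /eqP; rewrite eq_sym oner_eq0.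
have curv : curvilinear3 (affine_piece X k) gamma.
  split.
    move=> g g0; apply/dvdXn_fps_ord.
    have -> : poly_fps (mmap (@polyC K) (gamma 0) g) = ev (fun i => poly_fps (gamma 0 i)) g.
      by apply: (rmorph_mmap_comp (f := @poly_fps K)) => // c; rewrite /= poly_fpsC.
    have := fps_ordN (fps_ord_mmap g (gnd t0)).
    by rewrite (Ynd t0 g g0) sub0r opprK.
  apply: contrapT => /forallNP flat.
  have nd1 i : nd t0 i 1%N = 0.
    by have /negP := flat i; rewrite negbK mxE coef_poly /= => /eqP.
  have d1 i : delta t0 i 1%N = delta t0 k 1%N * nd t0 i 0%N.
    rewrite {1}ndE coef_fpsM big_ord_recl big_ord1 /= subn0 nd1 mulr0 add0r.
    by rewrite /bump /= subnn.
  have d0 i : delta t0 i 0%N = delta t0 k 0%N * nd t0 i 0%N.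
    by rewrite {1}ndE coef_fpsM big_ord1 subn0.
  case/negP: nprop; apply/eqP; rewrite (d1 i1) (d1 j1) (d0 i1) (d0 j1); ring.
have smg : smooth_locus n X (jet_point gamma).
  by rewrite ptE; apply: smooth_locus_scale.
have [d [U [dimU TU]] dlt] := X_special curv smg.
exists U; split.
  move: dlt; rewrite ltn_min dimU => /andP [_]; lia.
move=> t j j6; set v := \row_i _.
have [->|v0] := eqVneq v 0; first exact: mem0v.
suff : tangent_along X k gamma v by rewrite TU => -[].
split => // c c0 sing; split => //.
have := singular_along_arc sing (Ynd t) (gnd t); rewrite ev_linform => o6.
have o6' : fps_ord 6 (\sum_i fps_const (c 0 i) * delta t i).
  have -> : \sum_i fps_const (c 0 i) * delta t i =
      delta t k * \sum_i fps_const (c 0 i) * nd t i.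
    rewrite mulr_sumr; apply: eq_bigr => i _.
    by rewrite (ndE t i); ring.
  exact: fps_ordMl.
rewrite meval_linform -[RHS](o6' j j6) coef_fps_sum.
by apply: eq_bigr => i _; rewrite coef_fpsCM mxE.
Qed.

End SpecialArcs.

Lemma commutator_derivation (K B : comNzRingType) (iota : {rmorphism K -> B}) D1 D2 :
  derivation iota D1 -> derivation iota D2 ->
  derivation iota (fun e => D1 (D2 e) - D2 (D1 e)).
Proof.
move=> h1 h2; split=> [x y|x y|c].
- by rewrite !(derD_add h1, derD_add h2); ring.
- by rewrite !(derD_mul h1, derD_mul h2, derD_add h1, derD_add h2); ring.
- by rewrite !(derD_cst h1, derD_cst h2) (derD_0 h1) (derD_0 h2) subrr.
Qed.

Lemma mxsub_rank (F : fieldType) k p q (g : 'I_k -> 'I_p) (h : 'I_k -> 'I_q)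
    (A : 'M[F]_(p, q)) : mxsub g h A \in unitmx -> (k <= \rank A)%N.
Proof.
move=> /mxrank_unit rk; rewrite -[X in (X <= _)%N]rk.
have -> : mxsub g h A = rowsub g 1%:M *m A *m colsub h 1%:M.
  apply/matrixP => i j; rewrite !mxE (bigD1 (h j)) //= !mxE eqxx mulr1.
  rewrite [X in _ + X]big1 ?addr0 => [|l /negbTE ne]; last by rewrite !mxE ne mulr0.
  rewrite (bigD1 (g i)) //= !mxE eqxx mul1r big1 ?addr0 // => l /negbTE ne.
  by rewrite !mxE eq_sym ne mul0r.
exact: leq_trans (mxrankM_maxl _ _) (mxrankM_maxr _ _).
Qed.

(** [h] is a minor of maximal order that does not vanish at the generic point. *)
Lemma generic_rank (K : numFieldType) N (S : ('I_N -> K) -> Prop) (E : fieldType)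
    (iota : {rmorphism K -> E}) xi p q (A : 'M[{mpoly K[N]}]_(p, q)) :
  generic_point S iota xi ->
  exists h, mmap iota xi h != 0 /\ forall P, h.@[P] != 0 ->
    (\rank (map_mx (mmap iota xi) A) <= \rank (map_mx (meval P) A))%N.
Proof.
move=> gen; set AE := map_mx _ A.
pose g := maxrankfun AE; pose B := rowsub g AE.
have Bfull : row_full B^T by rewrite /row_full mxrank_tr; apply: maxrowsub_free.
pose h := fullrankfun Bfull.
have hu : mxsub g h AE \in unitmx.
  rewrite -unitmx_tr; have := fullrowsub_unit Bfull.
  by congr (_ \in unitmx); apply/matrixP => i j; rewrite !mxE.
exists (\det (mxsub g h A)); split.
  rewrite -(det_map_mx (mmap iota xi)) map_mxsub.
  by move: hu; rewrite unitmxE unitfE.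
move=> P dP; apply: (@mxsub_rank _ _ _ _ g h).
by rewrite -map_mxsub unitmxE det_map_mx unitfE.
Qed.

Lemma col_mx5_eqmx (F : fieldType) m1 m2 m3 m4 m5 q (A1 : 'M[F]_(m1, q))
    (A2 : 'M[F]_(m2, q)) (A3 : 'M[F]_(m3, q)) (A4 : 'M[F]_(m4, q)) (A5 : 'M[F]_(m5, q)) :
  (col_mx A1 (col_mx A2 (col_mx A3 (col_mx A4 A5))) :=: A1 + A2 + A3 + A4 + A5)%MS.
Proof.
rewrite -!addsmxA.
do 3!(apply: eqmx_trans (eqmx_sym (addsmxE _ _)) _; apply: adds_eqmx (eqmx_refl _) _).
exact: eqmx_sym (addsmxE _ _).
Qed.

Lemma map_col_mx5 (A B : nzRingType) (phi : A -> B) m1 m2 m3 m4 m5 q (A1 : 'M[A]_(m1, q))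
    (A2 : 'M[A]_(m2, q)) (A3 : 'M[A]_(m3, q)) (A4 : 'M[A]_(m4, q)) (A5 : 'M[A]_(m5, q)) :
  map_mx phi (col_mx A1 (col_mx A2 (col_mx A3 (col_mx A4 A5)))) =
  col_mx (map_mx phi A1) (col_mx (map_mx phi A2) (col_mx (map_mx phi A3)
    (col_mx (map_mx phi A4) (map_mx phi A5)))).
Proof. by rewrite !map_col_mx. Qed.

Lemma col_mx5_sub (F : fieldType) m1 m2 m3 m4 m5 p q (A1 : 'M[F]_(m1, q))
    (A2 : 'M[F]_(m2, q)) (A3 : 'M[F]_(m3, q)) (A4 : 'M[F]_(m4, q)) (A5 : 'M[F]_(m5, q))
    (B : 'M[F]_(p, q)) :
  (A1 <= B)%MS -> (A2 <= B)%MS -> (A3 <= B)%MS -> (A4 <= B)%MS -> (A5 <= B)%MS ->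
  (col_mx A1 (col_mx A2 (col_mx A3 (col_mx A4 A5))) <= B)%MS.
Proof. by move=> *; rewrite !col_mx_sub; apply/and5P. Qed.

(** * The space of jets of order 3 and its function field *)

Section JetField.
Variables (K : numFieldType) (r n : nat) (X : set 'rV[K]_r.+1).
Hypotheses (X_closed : pclosed X) (X_irr : pirreducible X).
Variables (f : {mpoly K[r.+1]}) (L : 'M[K]_(r.+1, n.+1)).
Variables (Y : 'M[{mpoly K[r.+1]}]_(n.+1, r.+1)) (p0 : 'rV[K]_r.+1).
Hypotheses (frame : smooth_frame X f L Y) (Xp0 : X p0) (fp0 : f.@[p0 0] != 0).

Local Notation m := n.+1.
Local Notation M := (m + (m + m))%N.
Local Notation N := ((r.+1 + 1) + M)%N.

(** Coordinates of the space of jets: the point x ([jx]), the inverse of [f] ([js]) and the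
    coefficients u1, u2, u3 ([jc1], [jc2], [jc3]). The coefficient u0 is x L. *)
Definition jx (i : 'I_r.+1) : 'I_N := lshift M (lshift 1 i).
Definition js : 'I_N := lshift M (rshift r.+1 ord0).
Definition jc1 (k : 'I_m) : 'I_N := rshift (r.+1 + 1) (lshift (m + m) k).
Definition jc2 (k : 'I_m) : 'I_N := rshift (r.+1 + 1) (rshift m (lshift m k)).
Definition jc3 (k : 'I_m) : 'I_N := rshift (r.+1 + 1) (rshift m (rshift m k)).

Definition jet_pt (B : Type) (p : 'I_r.+1 -> B) (s : B) (c1 c2 c3 : 'I_m -> B) :
    'I_N -> B := vjoin (vjoin p (fun=> s)) (vjoin c1 (vjoin c2 c3)).

Lemma jet_ptx B (p : 'I_r.+1 -> B) s c1 c2 c3 i : jet_pt p s c1 c2 c3 (jx i) = p i.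
Proof. by rewrite /jet_pt !vjoinl. Qed.
Lemma jet_pts B (p : 'I_r.+1 -> B) s c1 c2 c3 : jet_pt p s c1 c2 c3 js = s.
Proof. by rewrite /jet_pt vjoinl vjoinr. Qed.
Lemma jet_pt1 B (p : 'I_r.+1 -> B) s c1 c2 c3 k : jet_pt p s c1 c2 c3 (jc1 k) = c1 k.
Proof. by rewrite /jet_pt vjoinr vjoinl. Qed.
Lemma jet_pt2 B (p : 'I_r.+1 -> B) s c1 c2 c3 k : jet_pt p s c1 c2 c3 (jc2 k) = c2 k.
Proof. by rewrite /jet_pt !vjoinr vjoinl. Qed.
Lemma jet_pt3 B (p : 'I_r.+1 -> B) s c1 c2 c3 k : jet_pt p s c1 c2 c3 (jc3 k) = c3 k.
Proof. by rewrite /jet_pt !vjoinr. Qed.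

Variant jidx_spec : 'I_N -> Type :=
  | Jx i : jidx_spec (jx i) | Js : jidx_spec js | J1 k : jidx_spec (jc1 k)
  | J2 k : jidx_spec (jc2 k) | J3 k : jidx_spec (jc3 k).

Lemma jidxP i : jidx_spec i.
Proof.
case: (split_ordP i) => j ->; first case: (split_ordP j) => k ->.
- exact: Jx.
- by rewrite [k]ord1; apply: Js.
- case: (split_ordP j) => k ->; first exact: J1.
  by case: (split_ordP k) => l ->; [apply: J2 | apply: J3].
Qed.

Lemma jx_neq i w : (jx i == jc3 w) = false.
Proof. by apply/eqP => /(congr1 val) /=; have := ltn_ord i; lia. Qed.
Lemma js_neq w : (js == jc3 w) = false.
Proof. by apply/eqP => /(congr1 val) /=; lia. Qed.
Lemma jc1_neq k w : (jc1 k == jc3 w) = false.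
Proof. by apply/eqP => /(congr1 val) /=; have := ltn_ord k; lia. Qed.
Lemma jc2_neq k w : (jc2 k == jc3 w) = false.
Proof. by apply/eqP => /(congr1 val) /=; have := ltn_ord k; lia. Qed.
Lemma jc3_eq k w : (jc3 k == jc3 w) = (k == w).
Proof.
apply/eqP/eqP => [/(congr1 val) /= h|-> //].
by apply/val_inj => /=; lia.
Qed.

Definition jet_set : ('I_N -> K) -> Prop :=
  prod_set (localize (points X) f) (fun _ : 'I_M -> K => True).

Lemma jet_setP v : jet_set v <-> X (\row_i v (jx i)) /\ v js * f.@[fun i => v (jx i)] = 1.
Proof. by split=> [[[]]|[]]. Qed.

Lemma jet_set_pt p s c1 c2 c3 : X p -> s * f.@[p 0] = 1 ->
  jet_set (jet_pt (p 0) s c1 c2 c3).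
Proof.
move=> Xp sf; apply/jet_setP; split.
  by rewrite (_ : \row_i _ = p) //; apply/rowP => i; rewrite mxE jet_ptx.
by rewrite jet_pts -[RHS]sf; congr (_ * _); apply: meval_eq => i; rewrite jet_ptx.
Qed.

Lemma f_nvanish : ~ vanish_on (points X) f.
Proof. by move/vanish_on_points => /(_ _ Xp0) /eqP; rewrite (negbTE fp0). Qed.

Lemma jet_set_prime : aprime jet_set.
Proof.
apply: aprime_prod; last exact: aprime_full.
by apply: aprime_localize f_nvanish; apply: pirreducible_aprime.
Qed.

Definition lift (g : {mpoly K[r.+1]}) : {mpoly K[N]} :=
  mmap (@mpolyC N K) (fun i => 'X_(jx i)) g.

Lemma mmap_lift (B : comNzRingType) (j : {rmorphism K -> B}) xi g :
  mmap j xi (lift g) = mmap j (fun i => xi (jx i)) g.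
Proof. by rewrite mmap_comp; apply: eq_mmap => i; rewrite mmapX mmap1U. Qed.

Lemma lift_vanish g : vanishing X g -> vanish_on jet_set (lift g).
Proof.
move=> g0 v /jet_setP [Xv _]; rewrite [LHS]mmap_lift -(g0 _ Xv).
by apply: meval_eq => i; rewrite mxE.
Qed.

Section Generic.
Variables (E : fieldType) (iota : {rmorphism K -> E}) (xi : 'I_N -> E).
Hypothesis gen : generic_point jet_set iota xi.

Local Notation ev := (mmap iota xi).
Local Notation evx := (mmap iota (fun i => xi (jx i))).

Lemma gen_vanishing g : vanishing X g -> evx g = 0.
Proof. by move=> g0; rewrite -mmap_lift; apply/gen.1/lift_vanish. Qed.

Lemma gen_sf : xi js * evx f = 1.
Proof.
have /gen.1 : vanish_on jet_set ('X_js * lift f - 1).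
  move=> v /jet_setP [_ sf]; rewrite mevalB mevalM mevalXU meval1.
  by rewrite [X in _ * X - _]mmap_lift sf subrr.
rewrite mmapB (rmorphM ev) /= mmapX mmap1U mmap_lift rmorph1 => /eqP.
by rewrite subr_eq0 => /eqP.
Qed.

Lemma gen_f_neq0 : evx f != 0.
Proof.
by apply/eqP => f0; have := gen_sf; rewrite f0 mulr0 => /eqP; rewrite eq_sym oner_eq0.
Qed.

Definition genx : 'rV[E]_r.+1 := \row_i xi (jx i).
Definition u0 k := (genx *m map_mx iota L) 0 k.

(** D x is tangent to X, hence is expressed in the frame by the derivatives of u0; [xi js] is the
    inverse of [f]. *)
Lemma gen_der_x D : derivation iota D ->
  map_mx D genx = xi js *: ((\row_k D (u0 k)) *m map_mx evx Y).
Proof.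
move=> hD; have [_ span _ _] := frame.
have tD : tangent_at X iota (fun i => xi (jx i)) (map_mx D genx).
  have -> : map_mx D genx = \row_i D (xi (jx i)) by apply/rowP => i; rewrite !mxE.
  by apply: derivation_tangent => // g; apply: gen_vanishing.
have := span _ _ _ _ tD.
have -> : \row_k D (u0 k) = map_mx D genx *m map_mx iota L.
  apply/rowP => k; rewrite mxE /u0 mxE [RHS]mxE (derD_sum hD); apply: eq_bigr => i _.
  by rewrite (derD_mul hD) !mxE (derD_cst hD) mulr0 addr0.
by move=> <-; rewrite scalerA gen_sf scale1r.
Qed.

Definition ucoord : 'I_(m + M) -> E :=
  vjoin u0 (vjoin (fun k => xi (jc1 k)) (vjoin (fun k => xi (jc2 k)) (fun k => xi (jc3 k)))).

(** D u0 = 0 gives D x = 0 by [gen_der_x], then D (1/f) = 0, and the field is generated by x, 1/f,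
    u1, u2, u3. Identities between derivations can therefore be checked on [ucoord]. *)
Lemma der_eq0 D : derivation iota D -> (forall i, D (ucoord i) = 0) ->
  forall e, D e = 0.
Proof.
move=> hD D0.
have D00 k : D (u0 k) = 0 by have := D0 (lshift M k); rewrite /ucoord vjoinl.
have D1 k : D (xi (jc1 k)) = 0.
  by have := D0 (rshift m (lshift (m + m) k)); rewrite /ucoord vjoinr vjoinl.
have D2 k : D (xi (jc2 k)) = 0.
  by have := D0 (rshift m (rshift m (lshift m k))); rewrite /ucoord !vjoinr vjoinl.
have D3 k : D (xi (jc3 k)) = 0.
  by have := D0 (rshift m (rshift m (rshift m k))); rewrite /ucoord !vjoinr.
have Dx i : D (xi (jx i)) = 0.
  have := gen_der_x hD; rewrite (_ : \row_k _ = 0); last first.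
    by apply/rowP => k; rewrite !mxE.
  by rewrite mul0mx scaler0 => /rowP/(_ i); rewrite !mxE.
have Ds : D (xi js) = 0.
  have := congr1 D gen_sf; rewrite (derD_mul hD) (derD_1 hD) (derD_mmap hD).
  rewrite big1 ?mulr0 ?addr0 => [/eqP|i _]; last by rewrite Dx mulr0.
  by rewrite mulf_eq0 (negbTE gen_f_neq0) orbF => /eqP.
have Dev g : D (ev g) = 0.
  rewrite (derD_mmap hD) big1 // => i _; case: (jidxP i) => *;
  by rewrite ?Dx ?Ds ?D1 ?D2 ?D3 mulr0.
move=> e; have [a [b [b0 eE]]] := gen.2 e.
have eb : e * ev b = ev a by rewrite eE divfK.
have := congr1 D eb; rewrite (derD_mul hD) !Dev mulr0 addr0 => /eqP.
by rewrite mulf_eq0 (negbTE b0) orbF => /eqP.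
Qed.

Lemma der_ext D1 D2 : derivation iota D1 -> derivation iota D2 ->
  (forall i, D1 (ucoord i) = D2 (ucoord i)) -> forall e, D1 e = D2 e.
Proof.
move=> h1 h2 D12 e; apply/eqP; rewrite -subr_eq0; apply/eqP.
have hd : derivation iota (fun e => D1 e - D2 e).
  split=> [x y|x y|c].
  - by rewrite (derD_add h1) (derD_add h2); ring.
  - by rewrite (derD_mul h1) (derD_mul h2); ring.
  - by rewrite (derD_cst h1) (derD_cst h2) subrr.
by apply: (der_eq0 hd) => i; rewrite D12 subrr.
Qed.

Lemma der_commute D1 D2 D3 : derivation iota D1 -> derivation iota D2 ->
  derivation iota D3 ->
  (forall i, D1 (D2 (ucoord i)) = D2 (D1 (ucoord i)) + D3 (ucoord i)) ->
  forall e, D1 (D2 e) = D2 (D1 e) + D3 e.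
Proof.
move=> h1 h2 h3 c e; apply/eqP; rewrite addrC -subr_eq; apply/eqP.
apply: (der_ext (commutator_derivation h1 h2) h3) => i.
by rewrite c [X in X - _]addrC addrK.
Qed.

(** For fixed u1, u2, u3 a relation becomes a polynomial in x L that vanishes on X where [f] does
    not, hence on X by irreducibility; the last clause of the frame makes it 0. *)
Lemma ucoord_indep : alg_indep iota ucoord.
Proof.
move=> p p0'; have [_ _ _ Lfree] := frame.
pose ufm k : {mpoly K[N]} := \sum_j (L j k)%:MP * 'X_(jx j).
have ufmE (B : comNzRingType) (j : {rmorphism K -> B}) x k :
    mmap j x (ufm k) = \sum_l x (jx l) * j (L l k).
  rewrite raddf_sum; apply: eq_bigr => l _.
  by rewrite /= (rmorphM (mmap j x)) /= mmapC mmapX mmap1U mulrC.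
pose W : 'I_(m + M) -> {mpoly K[N]} := vjoin ufm
  (vjoin (fun k => 'X_(jc1 k)) (vjoin (fun k => 'X_(jc2 k)) (fun k => 'X_(jc3 k)))).
have WE i : ev (W i) = ucoord i.
  rewrite /W /ucoord /vjoin; case: split => [k|j].
    by rewrite ufmE /u0 mxE; apply: eq_bigr => l _; rewrite !mxE.
  case: split => [k|j']; first by rewrite mmapX mmap1U.
  by case: split => k; rewrite mmapX mmap1U.
have G0 : vanish_on jet_set (mmap (@mpolyC N K) W p).
  by apply/gen.1; rewrite mmap_comp -[RHS]p0'; apply: eq_mmap.
have pv q (c : 'I_M -> K) : X q -> f.@[q 0] != 0 ->
    p.@[vjoin ((q *m L) 0) c] = 0.
  move=> Xq fq.
  pose c1 k := c (lshift (m + m) k); pose c2 k := c (rshift m (lshift m k)).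
  pose c3 k := c (rshift m (rshift m k)).
  have := G0 _ (jet_set_pt c1 c2 c3 Xq (mulVf fq)).
  rewrite [X in X = _ -> _]mmap_comp => e0; rewrite -[RHS]e0; apply: eq_mmap => i.
  rewrite /W; case: (split_ordP i) => k ->; rewrite ?(vjoinl, vjoinr).
    by rewrite ufmE mxE; apply: eq_bigr => l _; rewrite jet_ptx.
  case: (split_ordP k) => l ->; rewrite ?(vjoinl, vjoinr).
    by rewrite mmapX mmap1U jet_pt1.
  by case: (split_ordP l) => l' ->; rewrite ?(vjoinl, vjoinr) mmapX mmap1U ?jet_pt2 ?jet_pt3.
apply: mpoly_eq0_eval => w.
pose w1 a := w (lshift M a); pose w2 b := w (rshift m b).
have [s [G [H GH]]] := separate_variables p.
pose P := \sum_i (H i).@[w2] *: G i.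
have PE v : P.@[v] = p.@[vjoin v w2].
  rewrite [RHS](GH K idfun) raddf_sum; apply: eq_bigr => i _ /=.
  by rewrite mevalZ mulrC.
have P0 : P = 0.
  apply: Lfree => q Xq.
  pose Pu := mmap (@mpolyC r.+1 K) (fun k => \sum_j (L j k)%:MP * 'X_j) P.
  have PuE (x : 'rV[K]_r.+1) : Pu.@[x 0] = P.@[(x *m L) 0].
    rewrite [LHS]mmap_comp; apply: eq_mmap => k; rewrite raddf_sum mxE.
    by apply: eq_bigr => l _; rewrite -[LHS]/(((L l k)%:MP * 'X_l).@[x 0]) mevalM mevalC mevalXU mulrC.
  have [] := (pirreducible_aprime X_closed X_irr).2 Pu f.
  - apply/vanish_on_points => x Xx; rewrite mevalM PuE PE.
    have [->|fx] := eqVneq f.@[x 0] 0; first by rewrite mulr0.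
    by rewrite pv // mul0r.
  - by move/vanish_on_points => Pu0; rewrite -PuE Pu0.
  - by move/f_nvanish.
rewrite -[RHS](_ : P.@[w1] = 0); last by rewrite P0 meval0.
by rewrite PE; apply: meval_eq => i; rewrite vjoin_eta.
Qed.

(* The derivations of the coordinate field of the space of jets u0 + u1 t +
   u2 t^2 + u3 t^3: d, a, b, e are the partial derivatives along u0, u1, u2,
   u3, and D is the infinitesimal translation of t. *)
Record jet_derivations (D : E -> E) (d a b e : 'I_m -> E -> E) : Prop := JetDerivations {
  jet_D : derivation iota D;
  jet_d : forall w, derivation iota (d w);
  jet_a : forall w, derivation iota (a w);
  jet_b : forall w, derivation iota (b w);
  jet_e : forall w, derivation iota (e w);
  jet_du : forall w, [/\ forall k, d w (u0 k) = (w == k)%:R,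
    forall k, d w (xi (jc1 k)) = 0, forall k, d w (xi (jc2 k)) = 0
    & forall k, d w (xi (jc3 k)) = 0];
  jet_au : forall w, [/\ forall k, a w (u0 k) = 0,
    forall k, a w (xi (jc1 k)) = (w == k)%:R, forall k, a w (xi (jc2 k)) = 0
    & forall k, a w (xi (jc3 k)) = 0];
  jet_bu : forall w, [/\ forall k, b w (u0 k) = 0,
    forall k, b w (xi (jc1 k)) = 0, forall k, b w (xi (jc2 k)) = (w == k)%:R
    & forall k, b w (xi (jc3 k)) = 0];
  jet_eu : forall w, [/\ forall k, e w (u0 k) = 0,
    forall k, e w (xi (jc1 k)) = 0, forall k, e w (xi (jc2 k)) = 0
    & forall k, e w (xi (jc3 k)) = (w == k)%:R];
  jet_Du : [/\ forall k, D (u0 k) = xi (jc1 k),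
    forall k, D (xi (jc1 k)) = 2%:R * xi (jc2 k),
    forall k, D (xi (jc2 k)) = 3%:R * xi (jc3 k)
    & forall k, D (xi (jc3 k)) = 0] }.

Lemma exists_jet_derivations : exists D d a b e, jet_derivations D d a b e.
Proof.
have ex (c0 c1 c2 c3 : 'I_m -> E) : exists D, derivation iota D /\
    [/\ forall k, D (u0 k) = c0 k, forall k, D (xi (jc1 k)) = c1 k,
        forall k, D (xi (jc2 k)) = c2 k & forall k, D (xi (jc3 k)) = c3 k].
  have [D [hD DE]] := exists_derivation gen ucoord_indep
    (vjoin c0 (vjoin c1 (vjoin c2 c3))).
  exists D; split => //; split=> k.
  - by have := DE (lshift M k); rewrite /ucoord !vjoinl.
  - by have := DE (rshift m (lshift (m + m) k)); rewrite /ucoord !vjoinr !vjoinl.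
  - by have := DE (rshift m (rshift m (lshift m k))); rewrite /ucoord !vjoinr !vjoinl.
  - by have := DE (rshift m (rshift m (rshift m k))); rewrite /ucoord !vjoinr.
(* The factors 2 and 3 come from differentiating t^2 and t^3; u3 is constant because jets stop at
   t^3. *)
have [D [hD DE]] := ex (fun k => xi (jc1 k)) (fun k => 2%:R * xi (jc2 k))
  (fun k => 3%:R * xi (jc3 k)) (fun=> 0).
pose z (k : 'I_m) : E := 0; pose o (w k : 'I_m) : E := (w == k)%:R.
have [d dE] := choice (fun w => ex (o w) z z z).
have [a aE] := choice (fun w => ex z (o w) z z).
have [b bE] := choice (fun w => ex z z (o w) z).
have [e eE] := choice (fun w => ex z z z (o w)).
exists D, d, a, b, e; split=> // w.
- exact: (dE w).1.
- exact: (aE w).1.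
- exact: (bE w).1.
- exact: (eE w).1.
- exact: (dE w).2.
- exact: (aE w).2.
- exact: (bE w).2.
- exact: (eE w).2.
Qed.

Section Relations.
Variables (D : E -> E) (d a b e : 'I_m -> E -> E).
Hypothesis J : jet_derivations D d a b e.
Let hD := jet_D J. Let hd := jet_d J. Let ha := jet_a J.
Let hb := jet_b J. Let he := jet_e J.

Lemma ucoord_ind (P : E -> Prop) :
  (forall k, P (u0 k)) -> (forall k, P (xi (jc1 k))) -> (forall k, P (xi (jc2 k))) ->
  (forall k, P (xi (jc3 k))) -> forall i, P (ucoord i).
Proof.
move=> P0 P1 P2 P3 i; rewrite /ucoord /vjoin; case: split => // j.
by case: split => // k; case: split.
Qed.

Let zero_der : derivation iota (fun=> 0).
Proof. by split=> *; rewrite ?mul0r ?mulr0 ?addr0. Qed.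

Let scale_der c D1 : derivation iota D1 -> derivation iota (fun x => c%:R * D1 x).
Proof.
move=> h1; split=> [x y|x y|k].
- by rewrite (derD_add h1) mulrDr.
- by rewrite (derD_mul h1); ring.
- by rewrite (derD_cst h1) mulr0.
Qed.

Let nat0 D1 (h1 : derivation iota D1) (b0 : bool) : D1 b0%:R = 0.
Proof. exact: derD_natr h1 _. Qed.

Let nat0M D1 (h1 : derivation iota D1) c x : D1 (c%:R * x) = c%:R * D1 x.
Proof. by rewrite (derD_mul h1) (derD_natr h1) mul0r add0r. Qed.

Lemma jet_dD w x : d w (D x) = D (d w x).
Proof.
rewrite -[RHS]addr0; apply: (der_commute (hd w) hD zero_der).
have [D0 D1 D2 D3] := jet_Du J; have [d0 d1 d2 d3] := jet_du J w.
apply: (@ucoord_ind (fun z => d w (D z) = D (d w z) + 0)) => k; rewrite ?(D0, D1, D2, D3, d0, d1, d2, d3, nat0M (hd w)) ;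
by rewrite ?(derD_0 hD) ?(derD_0 (hd w)) ?(nat0 hD) ?(d0, d1, d2, d3) ?mulr0 ?addr0.
Qed.

Lemma jet_aD w x : a w (D x) = D (a w x) + d w x.
Proof.
apply: (der_commute (ha w) hD (hd w)).
have [D0 D1 D2 D3] := jet_Du J; have [d0 d1 d2 d3] := jet_du J w.
have [a0 a1 a2 a3] := jet_au J w.
apply: (@ucoord_ind (fun z => a w (D z) = D (a w z) + d w z)) => k; rewrite ?(D0, D1, D2, D3, a0, a1, a2, a3, nat0M (ha w)) ;
by rewrite ?(derD_0 hD) ?(derD_0 (ha w)) ?(nat0 hD) ?(d0, d1, d2, d3, a1, a2, a3) ?mulr0 ?addr0 ?add0r.
Qed.

Lemma jet_bD w x : b w (D x) = D (b w x) + 2%:R * a w x.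
Proof.
apply: (der_commute (hb w) hD (scale_der 2 (ha w))).
have [D0 D1 D2 D3] := jet_Du J; have [b0 b1 b2 b3] := jet_bu J w.
have [a0 a1 a2 a3] := jet_au J w.
apply: (@ucoord_ind (fun z => b w (D z) = D (b w z) + 2%:R * a w z)) => k; rewrite ?(D0, D1, D2, D3, b0, b1, b2, b3, nat0M (hb w)) ;
by rewrite ?(derD_0 hD) ?(derD_0 (hb w)) ?(nat0 hD) ?(a0, a1, a2, a3, b2, b3) ?mulr0 ?addr0 ?add0r.
Qed.

Lemma jet_eD w x : e w (D x) = D (e w x) + 3%:R * b w x.
Proof.
apply: (der_commute (he w) hD (scale_der 3 (hb w))).
have [D0 D1 D2 D3] := jet_Du J; have [b0 b1 b2 b3] := jet_bu J w.
have [e0 e1 e2 e3] := jet_eu J w.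
apply: (@ucoord_ind (fun z => e w (D z) = D (e w z) + 3%:R * b w z)) => k; rewrite ?(D0, D1, D2, D3, e0, e1, e2, e3, nat0M (he w)) ;
by rewrite ?(derD_0 hD) ?(derD_0 (he w)) ?(nat0 hD) ?(b0, b1, b2, b3, e2, e3) ?mulr0 ?addr0 ?add0r.
Qed.

Let partial_commute D1 D2 : derivation iota D1 -> derivation iota D2 ->
  (forall i, D1 (D2 (ucoord i)) = 0) -> (forall i, D2 (D1 (ucoord i)) = 0) ->
  forall x, D1 (D2 x) = D2 (D1 x).
Proof.
move=> h1 h2 e1 e2 x; rewrite -[RHS]addr0.
by apply: (der_commute h1 h2 zero_der) => i; rewrite e1 e2 addr0.
Qed.

Lemma jet_dd w v x : d w (d v x) = d v (d w x).
Proof.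
have [d0 d1 d2 d3] := jet_du J w; have [v0 v1 v2 v3] := jet_du J v.
apply: (partial_commute (hd w) (hd v));
  [apply: (@ucoord_ind (fun z => d w (d v z) = 0)) | apply: (@ucoord_ind (fun z => d v (d w z) = 0))] => k;
by rewrite ?(d0, d1, d2, d3, v0, v1, v2, v3) ?(derD_0 (hd w)) ?(derD_0 (hd v))
  ?(nat0 (hd w)) ?(nat0 (hd v)).
Qed.

Lemma jet_ad w v x : a w (d v x) = d v (a w x).
Proof.
have [d0 d1 d2 d3] := jet_au J w; have [v0 v1 v2 v3] := jet_du J v.
apply: (partial_commute (ha w) (hd v));
  [apply: (@ucoord_ind (fun z => a w (d v z) = 0)) | apply: (@ucoord_ind (fun z => d v (a w z) = 0))] => k;
by rewrite ?(d0, d1, d2, d3, v0, v1, v2, v3) ?(derD_0 (ha w)) ?(derD_0 (hd v))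
  ?(nat0 (ha w)) ?(nat0 (hd v)).
Qed.

Lemma jet_bd w v x : b w (d v x) = d v (b w x).
Proof.
have [d0 d1 d2 d3] := jet_bu J w; have [v0 v1 v2 v3] := jet_du J v.
apply: (partial_commute (hb w) (hd v));
  [apply: (@ucoord_ind (fun z => b w (d v z) = 0)) | apply: (@ucoord_ind (fun z => d v (b w z) = 0))] => k;
by rewrite ?(d0, d1, d2, d3, v0, v1, v2, v3) ?(derD_0 (hb w)) ?(derD_0 (hd v))
  ?(nat0 (hb w)) ?(nat0 (hd v)).
Qed.

Lemma jet_ed w v x : e w (d v x) = d v (e w x).
Proof.
have [d0 d1 d2 d3] := jet_eu J w; have [v0 v1 v2 v3] := jet_du J v.
apply: (partial_commute (he w) (hd v));
  [apply: (@ucoord_ind (fun z => e w (d v z) = 0)) | apply: (@ucoord_ind (fun z => d v (e w z) = 0))] => k;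
by rewrite ?(d0, d1, d2, d3, v0, v1, v2, v3) ?(derD_0 (he w)) ?(derD_0 (hd v))
  ?(nat0 (he w)) ?(nat0 (hd v)).
Qed.

Lemma der_genx0 D1 : derivation iota D1 -> (forall k, D1 (u0 k) = 0) ->
  forall i, D1 (genx 0 i) = 0.
Proof.
move=> h1 D10 i; have := gen_der_x h1; rewrite (_ : \row_k _ = 0); last first.
  by apply/rowP => k; rewrite !mxE.
by rewrite mul0mx scaler0 => /rowP/(_ i); rewrite !mxE.
Qed.

Lemma jet_ax w i : a w (genx 0 i) = 0.
Proof. by apply: (der_genx0 (ha w)); case: (jet_au J w). Qed.
Lemma jet_bx w i : b w (genx 0 i) = 0.
Proof. by apply: (der_genx0 (hb w)); case: (jet_bu J w). Qed.
Lemma jet_ex w i : e w (genx 0 i) = 0.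
Proof. by apply: (der_genx0 (he w)); case: (jet_eu J w). Qed.

Lemma jet_dx w : map_mx (d w) genx = xi js *: row w (map_mx evx Y).
Proof.
rewrite (gen_der_x (hd w)); congr (_ *: _); rewrite rowE; congr (_ *m _).
apply/rowP => k; rewrite !mxE; have [-> _ _ _] := jet_du J w.
by rewrite eqxx /= eq_sym.
Qed.

Lemma e_iter w j x : a w x = 0 -> b w x = 0 -> e w x = 0 ->
  e w (iter j D x) = (j * j.-1 * j.-2)%:R * iter j.-2.-1 D (d w x).
Proof.
move=> ax bx ex; elim: j => [|j IH]; first by rewrite mul0r.
rewrite iterS jet_eD IH (b_iter hD jet_dD jet_aD jet_bD _ ax bx) (nat0M hD).
case: j {IH} => [|[|[|j]]]; rewrite /= ?mul0n ?muln0 ?mul0r ?mulr0 ?add0r ?mul1r //.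
  by rewrite mulrA -natrM.
by rewrite !natrM -![in RHS]natr1 -![in LHS]natr1; ring.
Qed.

Lemma jet_xi_e w i : e w (xi i) = (i == jc3 w)%:R.
Proof.
have [e0 e1 e2 e3] := jet_eu J w.
have es : e w (xi js) = 0.
  have := congr1 (e w) gen_sf; rewrite (derD_mul (he w)) (derD_1 (he w)) (derD_mmap (he w)).
  rewrite big1 ?mulr0 ?addr0 => [/eqP|i' _]; last first.
    by have := jet_ex w i'; rewrite mxE => ->; rewrite mulr0.
  by rewrite mulf_eq0 (negbTE gen_f_neq0) orbF => /eqP.
case: (jidxP i) => [i'||k|k|k].
- by rewrite jx_neq; have := jet_ex w i'; rewrite mxE.
- by rewrite js_neq.
- by rewrite jc1_neq.
- by rewrite jc2_neq.
- by rewrite e3 jc3_eq eq_sym.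
Qed.

Definition ypol w i : {mpoly K[N]} := 'X_js * lift (Y w i).

Lemma ev_ypol w i : ev (ypol w i) = d w (genx 0 i).
Proof.
have /rowP/(_ i) := jet_dx w; rewrite !mxE => ->.
by rewrite (rmorphM ev) /= mmapX mmap1U mmap_lift.
Qed.

(** [D] preserves the coordinate ring of the space of jets, and can thus be evaluated at its points
    over [K]. *)
Lemma exists_vector_field : exists V : 'I_N -> {mpoly K[N]},
  forall i, ev (V i) = D (xi i).
Proof.
have [D0 D1 D2 D3] := jet_Du J.
pose Vx i : {mpoly K[N]} := \sum_k 'X_(jc1 k) * ypol k i.
have VxE i : ev (Vx i) = D (xi (jx i)).
  have /rowP/(_ i) := gen_der_x hD; rewrite !mxE => ->.
  rewrite raddf_sum mulr_sumr; apply: eq_bigr => k _.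
  rewrite /= (rmorphM ev) /= mmapX mmap1U (rmorphM ev) /= mmapX mmap1U mmap_lift !mxE D0.
  by ring.
suff H i : exists v, ev v = D (xi i) by have [V VE] := choice H; exists V.
case: (jidxP i) => [j||k|k|k].
- by exists (Vx j).
(* The derivative of 1/f is minus its square times D f. *)
- exists (- 'X_js ^+ 2 * \sum_i lift f^`M(i) * Vx i).
  have := congr1 D gen_sf; rewrite (derD_mul hD) (derD_1 hD) (derD_mmap hD).
  move=> /(congr1 ( *%R (xi js))); rewrite mulr0 mulrDr mulrCA gen_sf mulr1.
  move=> /eqP; rewrite addr_eq0 => /eqP ->.
  rewrite (rmorphM ev) /= mmapN (rmorphXn ev) /= mmapX mmap1U expr2 mulNr -mulrA.
  congr (- (_ * (_ * _))); rewrite raddf_sum; apply: eq_bigr => l _.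
  by rewrite /= (rmorphM ev) /= VxE mmap_lift.
- exists (2%:R * 'X_(jc2 k)).
  by rewrite D1 (rmorphM ev) /= rmorph_nat mmapX mmap1U.
- exists (3%:R * 'X_(jc3 k)).
  by rewrite D2 (rmorphM ev) /= rmorph_nat mmapX mmap1U.
- by exists 0; rewrite D3 mmap0.
Qed.

Section VectorField.
Variable V : 'I_N -> {mpoly K[N]}.
Hypothesis VE : forall i, ev (V i) = D (xi i).

Definition vfield (g : {mpoly K[N]}) : {mpoly K[N]} := \sum_i g^`M(i) * V i.

Lemma vfield_derivation : derivation (@mpolyC N K) vfield.
Proof.
split=> [p q|p q|c]; rewrite /vfield.
- by rewrite -big_split; apply: eq_bigr => i _; rewrite mderivD mulrDl.
- rewrite mulr_suml mulr_sumr -big_split; apply: eq_bigr => i _ /=.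
  by rewrite mderivM; ring.
- by rewrite big1 // => i _; rewrite mderivC mul0r.
Qed.

Lemma ev_vfield j g : ev (iter j vfield g) = iter j D (ev g).
Proof.
elim: j => //= j IH; rewrite /vfield raddf_sum -IH (derD_mmap hD).
by apply: eq_bigr => i _; rewrite /= (rmorphM ev) /= VE.
Qed.

Definition Xpol j i : {mpoly K[N]} := iter j vfield 'X_(jx i).
Definition Ypol j w i : {mpoly K[N]} := iter j vfield (ypol w i).

Lemma ev_Xpol j i : ev (Xpol j i) = jetX D genx j 0 i.
Proof. by rewrite ev_vfield mmapX mmap1U !mxE. Qed.

Lemma ev_Ypol j w i : ev (Ypol j w i) = jetY D d genx j w i.
Proof. by rewrite ev_vfield ev_ypol !mxE. Qed.

(** The integral curve of the vector field through [P]. It stays in X because all iterates of [D] on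
    an equation of X vanish at the generic point, hence at [P]. *)
Lemma jet_arc P : jet_set P -> exists delta : 'I_r.+1 -> fps K,
  arc_in X delta /\ forall i j, delta i j = (Xpol j i).@[P] / j`!%:R.
Proof.
move=> SP; have hV := vfield_derivation.
have char0 k : k.+1%:R != 0 :> K by rewrite pnatr_eq0.
have [tau tauE] := taylor_rmorphism (meval P) char0 (derD_add hV) (derD_mul hV).
exists (fun i => tau 'X_(jx i)); split; last by move=> i j; rewrite tauE.
move=> g gX; have <- : tau (lift g) = mmap (@fps_const K) (fun i => tau 'X_(jx i)) g.
  apply: rmorph_mmap_comp => // c; rewrite /= tauE; apply/funext => -[|j].
    by rewrite /taylor_series /= mevalC divr1.
  have Z : iter j.+1 vfield c%:MP = 0.
    by elim: j => [|j IH]; [rewrite /= (derD_cst hV) | rewrite iterS IH (derD_0 hV)].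
  by rewrite /taylor_series Z rmorph0 mul0r.
rewrite tauE; apply/funext => j; rewrite /taylor_series coef_fps0.
transitivity ((iter j vfield (lift g)).@[P] / j`!%:R); first by [].
suff -> : (iter j vfield (lift g)).@[P] = 0 by rewrite mul0r.
apply: (gen.1 _).1 SP; rewrite ev_vfield mmap_lift gen_vanishing //.
by elim: j => //= j ->; rewrite (derD_0 hD).
Qed.

(* g is affine along the u3-axis: e_w g = g1 and e_w g1 = 0. *)
Lemma jet_shift w g g1 P : e w (ev g) = ev g1 -> e w (ev g1) = 0 -> jet_set P ->
  g.@[fun i => P i + (i == jc3 w)%:R] = g.@[P] + g1.@[P].
Proof.
move=> eg eg1 SP.
have SPt t : jet_set (fun i => P i + (i == jc3 w)%:R * t).
  have [XP sf] := (jet_setP P).1 SP; apply/jet_setP; split.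
    rewrite (_ : \row_i _ = \row_i P (jx i)) //.
    by apply/rowP => i; rewrite !mxE jx_neq mul0r addr0.
  rewrite js_neq mul0r addr0 -[RHS]sf; congr (_ * _); apply: meval_eq => i.
  by rewrite jx_neq mul0r addr0.
have evd h : ev h^`M(jc3 w) = e w (ev h).
  rewrite (derD_mmap (he w)) (bigD1 (jc3 w)) //= jet_xi_e eqxx mulr1 big1 ?addr0 //.
  by move=> i /negbTE ne; rewrite jet_xi_e ne mulr0.
have d1 t : (g^`M(jc3 w)).@[fun i => P i + (i == jc3 w)%:R * t] =
            g1.@[fun i => P i + (i == jc3 w)%:R * t].
  have h0 : vanish_on jet_set (g^`M(jc3 w) - g1).
    by apply/gen.1; rewrite mmapB evd eg subrr.
  by apply/eqP; rewrite -subr_eq0 -mevalB h0.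
have d2 t : (g1^`M(jc3 w)).@[fun i => P i + (i == jc3 w)%:R * t] = 0.
  have h0 : vanish_on jet_set g1^`M(jc3 w) by apply/gen.1; rewrite evd eg1.
  exact: h0.
have cst (q : {poly K}) : q^`() = 0 -> q = (q.[0])%:P.
  move=> q0; apply/polyP => -[|i]; rewrite coefC /=; first by rewrite horner_coef0.
  have := congr1 (fun s : {poly K} => s`_i) q0; rewrite coef_deriv coef0 => /eqP.
  by rewrite mulrn_eq0 /= => /eqP.
pose q := axis_line P (jc3 w) g; pose q1 := axis_line P (jc3 w) g1.
have q1E : q1 = (q1.[0])%:P.
  apply: cst; apply: poly_eq0_natr => k.
  by rewrite deriv_axis_line horner_axis_line d2.
have q10 : q1.[0] = g1.@[P].
  by rewrite horner_axis_line; apply: meval_eq => i; rewrite mulr0 addr0.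
have dq : q^`() = q1.
  apply/eqP; rewrite -subr_eq0; apply/eqP/poly_eq0_natr => k.
  by rewrite hornerD hornerN deriv_axis_line !horner_axis_line d1 subrr.
have qE : q - q1.[0] *: 'X = ((q - q1.[0] *: 'X).[0])%:P.
  by apply: cst; rewrite derivB dq derivZ derivX q1E alg_polyC !hornerE subrr.
have := congr1 (horner_eval 1) qE; rewrite /= /horner_eval hornerC !hornerD !hornerN !hornerZ !hornerX.
rewrite mulr1 mulr0 subr0 q10 => /eqP; rewrite subr_eq => /eqP.
rewrite !horner_axis_line => qq.
transitivity (g.@[fun i => P i + (i == jc3 w)%:R * 1]).
  by apply: meval_eq => i; rewrite mulr1.
by rewrite qq; congr (_ + _); apply: meval_eq => i; rewrite mulr0 addr0.
Qed.

Lemma frame_smooth p : X p -> f.@[p 0] != 0 -> smooth_locus n X p.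
Proof.
move=> Xp fp; split => //; have [tanY span YL _] := frame.
pose Yp := map_mx (meval (p 0)) Y.
have YpL : Yp *m L = (f.@[p 0])%:M.
  have := congr1 (map_mx (meval (p 0))) YL; rewrite map_mxM map_scalar_mx => <-.
  by congr (_ *m _); apply/matrixP => i j; rewrite !mxE /= mevalC.
have Yrank : \rank Yp = m.
  apply/eqP/row_freeP; exists (f.@[p 0]^-1 *: L).
  by rewrite -scalemxAr YpL scale_scalar_mx mulVf.
have [U [dimU UE]] := matrix_vspace Yp.
exists U; split; first by rewrite dimU Yrank.
apply/seteqP; split=> v [v0 tv]; split => //.
  have tv' : tangent_at X idfun (p 0) v by [].
  have := span _ _ _ _ tv' => vE.
  rewrite UE -[v](scalerK fp) scalemx_sub //.
  have -> : f.@[p 0] *: v = v *m map_mx idfun L *m Yp := vE.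
  exact: submxMl.
move=> g gX; move: tv; rewrite UE => /submxP [c ->].
have row0 i : \sum_k g^`M(k).@[p 0] * Yp i k = 0.
  rewrite -[RHS](tanY i g gX p Xp) raddf_sum; apply: eq_bigr => k _.
  by rewrite !mxE /= mevalM mulrC.
transitivity (\sum_i c 0 i * \sum_k g^`M(k).@[p 0] * Yp i k).
  under [RHS]eq_bigr do rewrite mulr_sumr.
  rewrite exchange_big /=; apply: eq_bigr => k _; rewrite mxE mulr_sumr.
  by apply: eq_bigr => i _; ring.
by rewrite big1 // => i _; rewrite row0 mulr0.
Qed.

Lemma d_u0 w k : \sum_i d w (genx 0 i) * iota (L i k) = (w == k)%:R.
Proof.
have [<- _ _ _] := jet_du J w; rewrite /u0 mxE (derD_sum (hd w)).
apply: eq_bigr => i _.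
by rewrite (derD_mul (hd w)) !mxE (derD_cst (hd w)) mulr0 addr0.
Qed.

(** If x and D x were proportional, differentiating along [a w] would make x and d_w x proportional
    for all w. Contracting with [L] for two distinct indices, available since 0 < n, gives d_0 x =
    0, against d_0 u0_0 = 1. *)
Lemma genx_not_flat : (0 < n)%N ->
  exists i j, genx 0 i * D (genx 0 j) != genx 0 j * D (genx 0 i).
Proof.
move=> n0; apply: contrapT => flat.
have flat' i j : genx 0 i * D (genx 0 j) = genx 0 j * D (genx 0 i).
  by apply/eqP/negP => /negP ne; apply: flat; exists i, j.
have fl w i j : genx 0 i * d w (genx 0 j) = genx 0 j * d w (genx 0 i).
  have := congr1 (a w) (flat' i j).
  by rewrite !(derD_mul (ha w)) !jet_ax !jet_aD !jet_ax (derD_0 hD) !mul0r !add0r.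
have fu w k i : genx 0 i * (w == k)%:R = u0 k * d w (genx 0 i).
  rewrite -d_u0 mulr_sumr /u0 [X in _ = X * _]mxE mulr_suml; apply: eq_bigr => j _.
  by rewrite [map_mx iota L _ _]mxE mulrA fl; ring.
pose k1 : 'I_m := Ordinal (n0 : (1 < n.+1)%N).
have u1 : u0 k1 != 0.
  apply/eqP => u10; have [/(_ k1) du _ _ _] := jet_du J k1.
  by move/eqP: du; rewrite u10 (derD_0 (hd k1)) eqxx eq_sym oner_eq0.
have y0 i : d ord0 (genx 0 i) = 0.
  have /eqP := fu ord0 k1 i; rewrite mulr0 eq_sym mulf_eq0 (negbTE u1) /=.
  by move/eqP.
have /eqP := d_u0 ord0 ord0; rewrite big1 => [|i _]; last by rewrite y0 mul0r.
by rewrite eqxx eq_sym oner_eq0.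
Qed.

Hypothesis r_ge : (3 * n + 2 <= r)%N.
Hypothesis X_special : forall (k : 'I_r.+1) (gamma : 'rV[{poly K}]_r.+1),
  curvilinear3 (affine_piece X k) gamma -> smooth_locus n X (jet_point gamma) ->
  special_along n X k gamma.

Let adx w v i : a w (d v (genx 0 i)) = 0.
Proof. by rewrite jet_ad jet_ax (derD_0 (hd v)). Qed.
Let bdx w v i : b w (d v (genx 0 i)) = 0.
Proof. by rewrite jet_bd jet_bx (derD_0 (hd v)). Qed.
Let edx w v i : e w (d v (genx 0 i)) = 0.
Proof. by rewrite jet_ed jet_ex (derD_0 (hd v)). Qed.

Let shift_P w (P : 'I_N -> K) : 'I_N -> K := fun i => P i + (i == jc3 w)%:R.

Let shift_set w P : jet_set P -> jet_set (shift_P w P).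
Proof.
move=> SP; have [XP sf] := (jet_setP P).1 SP; apply/jet_setP; split.
  rewrite (_ : \row_i _ = \row_i P (jx i)) //.
  by apply/rowP => i; rewrite !mxE /shift_P jx_neq addr0.
rewrite /shift_P js_neq addr0 -[RHS]sf; congr (_ * _); apply: meval_eq => i.
by rewrite jx_neq addr0.
Qed.

(** The derivative of D^j x along u3 is a multiple of D^(j-3) d_w x, whose own derivative along u3
    is 0 as long as j - 3 < 3. *)
Let Xpol_shift j w i P : (j < 6)%N -> jet_set P ->
  (Xpol j i).@[shift_P w P] =
  (Xpol j i).@[P] + (j * j.-1 * j.-2)%:R * (Ypol j.-2.-1 w i).@[P].
Proof.
move=> j6 SP; pose g1 : {mpoly K[N]} := (j * j.-1 * j.-2)%:R * Ypol j.-2.-1 w i.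
rewrite (@jet_shift w (Xpol j i) g1 P) //.
- by rewrite mevalM rmorph_nat.
- rewrite ev_Xpol (rmorphM ev) /= rmorph_nat ev_Ypol.
  rewrite [jetX _ _ _ _ _]mxE [jetY _ _ _ _ _ _]mxE.
  by rewrite e_iter ?jet_ax ?jet_bx ?jet_ex.
- rewrite (rmorphM ev) /= rmorph_nat ev_Ypol (nat0M (he w)) [jetY _ _ _ _ _ _]mxE.
  rewrite e_iter ?adx ?bdx ?edx //.
  have -> : (j.-2.-1 * j.-2.-1.-1 * j.-2.-1.-2)%N = 0%N.
    by case: j j6 {g1} => [|[|[|[|[|[|j]]]]]].
  by rewrite mul0r mulr0.
Qed.

Lemma Xpol0 i : Xpol 0 i = 'X_(jx i). Proof. by []. Qed.

#[local] Opaque Xpol Ypol.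

Definition jet_matrix : 'M[{mpoly K[N]}]_(m + (m + (m + (1 + 1))), r.+1) :=
  col_mx (\matrix_(w, i) Ypol 0 w i) (col_mx (\matrix_(w, i) Ypol 1 w i)
    (col_mx (\matrix_(w, i) Ypol 2 w i)
      (col_mx (\row_i Xpol 4 i) (\row_i Xpol 5 i)))).

Lemma ev_jet_matrix : (map_mx ev jet_matrix :=:
  jetW D d genx + jetX D genx 4 + jetX D genx 5)%MS.
Proof.
have YE j : map_mx ev (\matrix_(w, i) Ypol j w i) = jetY D d genx j.
  by apply/matrixP => w i; rewrite [LHS]mxE [X in ev X]mxE ev_Ypol.
have XE j : map_mx ev (\row_i Xpol j i) = jetX D genx j.
  by apply/rowP => i; rewrite [LHS]mxE [X in ev X]mxE ev_Xpol.
have -> : map_mx ev jet_matrix = col_mx (jetY D d genx 0) (col_mx (jetY D d genx 1)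
    (col_mx (jetY D d genx 2) (col_mx (jetX D genx 4) (jetX D genx 5)))).
  by rewrite -(YE 0%N) -(YE 1%N) -(YE 2%N) -(XE 4%N) -(XE 5%N); apply: map_col_mx5.
exact: col_mx5_eqmx.
Qed.

(** At a point [P] where the rank does not drop, [special_arcs] is applied to the integral curve
    through [P] and to those through [P] with 1 added to one coordinate u3. They agree modulo t^3,
    and the differences of their coefficients of t^3, t^4, t^5 are multiples of the rows of Y_0,
    Y_1, Y_2. *)
Lemma jet_span_rank : (0 < n)%N ->
  (\rank (jetW D d genx + jetX D genx 4 + jetX D genx 5)%MS <= 3 * n + 2)%N.
Proof.
move=> n0; rewrite -ev_jet_matrix.
have [h [h0 hrank]] := generic_rank jet_matrix gen.
have [i1 [j1 ne]] := genx_not_flat n0.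
(* Where [h2] does not vanish, the arc is immersed in projective space. *)
pose h2 := Xpol 0 i1 * Xpol 1 j1 - Xpol 0 j1 * Xpol 1 i1.
have h20 : ev h2 != 0.
  by rewrite mmapB !(rmorphM ev) /= !ev_Xpol !mxE subr_eq0; move: ne; rewrite !mxE.
have [P [SP hP h2P]] : exists P, [/\ jet_set P, h.@[P] != 0 & h2.@[P] != 0].
  apply: contrapT => nex; have /eqP : ev (h * h2) = 0.
    apply/gen.1 => P SP; rewrite mevalM; apply/eqP/negP => /negP.
    by rewrite mulf_eq0 negb_or => /andP [? ?]; apply: nex; exists P.
  by rewrite (rmorphM ev) /= mulf_eq0 (negbTE h0) (negbTE h20).
apply: leq_trans (hrank P hP) _.
pose Q (t : option 'I_m) := if t is Some w then shift_P w P else P.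
have SQ t : jet_set (Q t) by case: t => [w|] //; apply: shift_set.
have [delta dE] := choice (fun t => jet_arc (SQ t)).
have [XP sf] := (jet_setP P).1 SP.
have fP : f.@[(\row_i P (jx i)) 0] != 0.
  apply/eqP => f0; move/eqP: sf; rewrite -meval_row f0 mulr0.
  by rewrite eq_sym oner_eq0.
have ptE : \row_i delta None i 0%N = \row_i P (jx i).
  by apply/rowP => i; rewrite !mxE (dE None).2 divr1 Xpol0 mevalXU.
have [||||U [dimU UE]] := special_arcs X_closed r_ge X_special (delta := delta) (t0 := None).
- by move=> t; have [] := dE t.
- move=> [w|] i j j3; last by rewrite coef_fpsB subrr.
  rewrite coef_fpsB !(dE _).2 /= Xpol_shift //; last by lia.
  have -> : (j * j.-1 * j.-2)%N = 0%N by case: j j3 => [|[|[|j]]].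
  by rewrite mul0r addr0 subrr.
- by rewrite ptE; apply: frame_smooth.
- exists i1, j1; rewrite !(dE None).2 !divr1 -subr_eq0.
  by move: h2P; rewrite /h2 mevalB !mevalM.
have [B [Bfree BE]] := vspace_matrix U.
apply: leq_trans dimU; rewrite -[X in (_ <= X)%N](eqP Bfree); apply: mxrankS.
have XU j : (j < 6)%N -> \row_i (Xpol j i).@[P] \in U.
  move=> j6; have := memvZ j`!%:R (UE None j j6); congr (_ \in U).
  apply/rowP => i; rewrite !mxE (dE None).2 mulrC divfK //.
  by rewrite pnatr_eq0 -lt0n fact_gt0.
have YU j w : (j < 3)%N -> \row_i (Ypol j w i).@[P] \in U.
  move=> j3; have j36 : (3 + j < 6)%N by lia.
  pose c : K := ((3 + j) * (2 + j) * (1 + j))%:R / (3 + j)`!%:R.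
  have c0 : c != 0.
    by rewrite /c mulf_neq0 ?invr_eq0 ?pnatr_eq0 ?muln_eq0 // -lt0n fact_gt0.
  rewrite -(scalerK c0 (\row_i _)); apply: memvZ.
  have := memvB (UE (Some w) (3 + j)%N j36) (UE None (3 + j)%N j36).
  congr (_ \in U); apply/rowP => i; rewrite !mxE !(dE _).2 /= Xpol_shift //.
  by rewrite /c mulrDl [X in X - _]addrC addrK mulrAC.
rewrite /jet_matrix map_col_mx5.
have YB j : (j < 3)%N -> (map_mx (meval P) (\matrix_(w, i) Ypol j w i) <= B)%MS.
  move=> j3; apply/row_subP => w; rewrite -BE (_ : row w _ = \row_i (Ypol j w i).@[P]).
    exact: YU.
  by apply/rowP => i; rewrite !mxE.
have XB j : (j < 6)%N -> (map_mx (meval P) (\row_i Xpol j i) <= B)%MS.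
  move=> j6; rewrite -BE (_ : map_mx _ _ = \row_i (Xpol j i).@[P]); first exact: XU.
  by apply/rowP => i; rewrite !mxE.
by apply: col_mx5_sub; [exact: (YB 0%N)|exact: (YB 1%N)|exact: (YB 2%N)|exact: (XB 4%N)|exact: (XB 5%N)].
Qed.

End VectorField.

End Relations.
End Generic.
End JetField.

(** * Osculating spaces *)

Section MaximalIdealPowers.
Variables (K : fieldType) (N : nat).
Implicit Types g h : {mpoly K[N]}.

(* the k-th power of the ideal generated by the variables *)
Definition mord k h := forall m : 'X_{1..N}, (mdeg m < k)%N -> h@_m = 0.

Lemma mordD k g h : mord k g -> mord k h -> mord k (g + h).
Proof. by move=> g0 h0 m lt; rewrite mcoeffD g0 ?h0 ?addr0. Qed.
Lemma mord_zero k : mord k 0. Proof. by move=> m _; rewrite mcoeff0. Qed.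
Lemma mordM k l g h : mord k g -> mord l h -> mord (k + l) (g * h).
Proof.
move=> g0 h0 m lt; rewrite mcoeffM big1 // => -[m1 m2] /= /eqP mE.
have [lt1|le1] := ltnP (mdeg m1) k; first by rewrite g0 ?mul0r.
by rewrite h0 ?mulr0 //; move: (congr1 mdeg mE); rewrite mdegD; lia.
Qed.

Lemma mordMl k g h : mord k h -> mord k (g * h).
Proof. by move=> hk; rewrite -[k]add0n; apply: mordM. Qed.

Lemma mord_variable i : mord 1 ('X_i).
Proof.
move=> m; rewrite ltnS leqn0 mdeg_eq0 => /eqP ->; rewrite mcoeffX.
by rewrite mnm1_eq0.
Qed.

Lemma mord_factor k h : mord k.+1 h ->
  exists F : 'I_N -> {mpoly K[N]}, (forall i, mord k (F i)) /\ h = \sum_i 'X_i * F i.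
Proof.
move=> hk; pose P h := exists F : 'I_N -> {mpoly K[N]},
  (forall i, mord k (F i)) /\ h = \sum_i 'X_i * F i.
suff : P h by [].
rewrite [h]mpolyE big_seq; elim/big_ind: _ => [||m].
- exists (fun=> 0); split; first by move=> i; apply: mord_zero.
  by rewrite big1 // => i _; rewrite mulr0.
- move=> _ _ [F [Fk ->]] [G [Gk ->]]; exists (fun i => F i + G i); split.
    by move=> i; apply: mordD.
  by rewrite -big_split; apply: eq_bigr => i _; rewrite mulrDr.
- rewrite mcoeff_msupp => hm.
  have km : (k.+1 <= mdeg m)%N by rewrite leqNgt; apply: contraNN hm => /hk ->.
  have [i mi] : exists i, m i != 0%N.
    apply/existsP; rewrite -negb_forall; apply: contraTN km => /forallP m0.
    by rewrite mdegE big1 // => i _; apply/eqP/m0.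
  pose F j : {mpoly K[N]} := if j == i then h@_m *: 'X_[m - U_(i)] else 0.
  exists F; split.
    move=> j; rewrite /F; case: eqP => _; last exact: mord_zero.
    move=> m' lt; rewrite mcoeffZ mcoeffX; case: eqP => [mm|]; last by rewrite mulr0.
    move: lt; rewrite -mm; have : mdeg m = (mdeg (m - U_(i))%MM + 1)%N.
      rewrite -(mdeg1 i) -mdegD submK //.
      by apply/mnm_lepP => j'; rewrite mnm1E; case: eqP => // <-; rewrite lt0n.
    lia.
  rewrite (bigD1 i) //= /F eqxx big1 ?addr0 => [|j /negbTE ->]; last by rewrite mulr0.
  rewrite -scalerAr -mpolyXD addmC submK //.
  by apply/mnm_lepP => j'; rewrite mnm1E; case: eqP => // <-; rewrite lt0n.
Qed.

Lemma mord1_const h : mord 1 (h - (h@_0)%:MP).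
Proof.
move=> m; rewrite ltnS leqn0 mdeg_eq0 => /eqP ->.
by rewrite mcoeffB mcoeffC eqxx mulr1 subrr.
Qed.

Lemma mcoeff0_meval h : h@_0 = h.@[fun=> 0].
Proof.
rewrite [in RHS](mpolyE h) raddf_sum /=.
have [h0|h0] := boolP (0%MM \in msupp h).
  rewrite (bigD1_seq 0%MM) //= mevalZ mpolyX0 meval1 mulr1 big1 ?addr0 // => m m0.
  rewrite mevalZ mevalX; move: m0; rewrite -mdeg_eq0 mdegE sum_nat_eq0.
  move=> /forallPn [j]; rewrite implyTb => mj.
  by rewrite (bigD1 j) //= expr0n (negbTE mj) mul0r mulr0.
rewrite memN_msupp_eq0 // big_seq big1 // => m hm; rewrite mevalZ mevalX.
have : m != 0%MM by apply: contraNneq h0 => <-.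
rewrite -mdeg_eq0 mdegE sum_nat_eq0 => /forallPn [j]; rewrite implyTb => mj.
by rewrite (bigD1 j) //= expr0n (negbTE mj) mul0r mulr0.
Qed.

End MaximalIdealPowers.

Section Osculating.
Variables (K : numFieldType) (r n : nat) (X : set 'rV[K]_r.+1).

Definition jet2 (p a b : 'rV[K]_r.+1) : 'I_r.+1 -> {poly K} :=
  fun k => (p 0 k)%:P + a 0 k *: 'X + b 0 k *: 'X^2.

Section Curve.
Variables (C : set 'rV[K]_r.+1) (i : 'I_r.+1) (p : 'rV[K]_r.+1).
Hypotheses (C_cone : cone C) (Cp : C p) (pi : p 0 i = 1).
Hypothesis C_smooth : has_lin_dim (tangent_space C p) 1.
Let Y := affine_piece C i.

(* The ideal of Y, translated so that p becomes the origin. *)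
Let IY (h : {mpoly K[r.+1]}) := forall y, Y y -> h.@[(y - p) 0] = 0.
Let T (g : {mpoly K[r.+1]}) := taylor g p.

Let TE (B : comNzRingType) (io : {rmorphism K -> B}) v g :
  mmap io v (T g) = mmap io (fun k => v k + io (p 0 k)) g.
Proof.
rewrite /T /taylor /comp_mpoly mmap_comp; apply: eq_mmap => k.
by rewrite tnth_mktuple mmapD mmapX mmap1U mmapC.
Qed.

Let TIY g : vanishing Y g -> IY (T g).
Proof.
move=> gY y Yy; rewrite [LHS]TE -[RHS](gY y Yy); apply: meval_eq => k.
by rewrite /= !mxE subrK.
Qed.

Let back (h : {mpoly K[r.+1]}) : {mpoly K[r.+1]} :=
  mmap (@mpolyC r.+1 K) (fun k => 'X_k - (p 0 k)%:MP) h.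

Let T_back h : T (back h) = h.
Proof.
rewrite /T /taylor /comp_mpoly /back mmap_comp.
transitivity (mmap (@mpolyC r.+1 K) (fun k => 'X_k) h).
  apply: eq_mmap => k; rewrite mmapB mmapX mmap1U mmapC tnth_mktuple.
  by rewrite addrK.
elim/mpoly_ring_ind: h => [c|k|g h IHg IHh|g h IHg IHh].
- by rewrite mmapC.
- by rewrite mmapX mmap1U.
- by rewrite mmapD IHg IHh.
- by rewrite rmorphM /= IHg IHh.
Qed.

Let IY_back h : IY h -> vanishing Y (back h).
Proof.
move=> h0 y Yy; rewrite [LHS]mmap_comp -[RHS](h0 y Yy); apply: eq_mmap => k.
by rewrite -[LHS]/(('X_k - (p 0 k)%:MP).@[y 0]) mevalB mevalXU mevalC !mxE.
Qed.

Let IYD g h : IY g -> IY h -> IY (g + h).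
Proof. by move=> g0 h0 y Yy; rewrite mevalD g0 // h0 // addr0. Qed.
Let IYM g h : IY h -> IY (g * h).
Proof. by move=> h0 y Yy; rewrite mevalM h0 // mulr0. Qed.
Let IY0 : IY 0. Proof. by move=> y _; rewrite meval0. Qed.

(** The ideal I(Y) + m^k of [ord_ge], with [p] moved to the origin. *)
Let J k h := exists2 g, IY g & mord k (h - g).

Let JD k g h : J k g -> J k h -> J k (g + h).
Proof.
move=> [g' ? gk] [h' ? hk]; exists (g' + h'); first exact: IYD.
by rewrite opprD addrACA; apply: mordD.
Qed.
Let JM k g h : J k h -> J k (g * h).
Proof.
move=> [h' ? hk]; exists (g * h'); first exact: IYM.
by rewrite -mulrBr; apply: mordMl.
Qed.
Let JN k h : J k h -> J k (- h).
Proof. by move=> Jh; rewrite -mulN1r; apply: JM. Qed.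
Let JB k g h : J k g -> J k h -> J k (g - h).
Proof. by move=> Jg Jh; apply: JD => //; apply: JN. Qed.
Let J_mord k h : mord k h -> J k h.
Proof. by move=> hk; exists 0 => //; rewrite subr0. Qed.
Let J_IY k h : IY h -> J k h.
Proof. by move=> h0; exists h => //; rewrite subrr; apply: mord_zero. Qed.
Let J_sum k (I : Type) (s : seq I) (P : pred I) F :
  (forall l, P l -> J k (F l)) -> J k (\sum_(l <- s | P l) F l).
Proof.
move=> FJ; elim/big_ind: _ => //; last exact: JD.
exact/J_mord/mord_zero.
Qed.
Let J_mordM k g h : mord 1 g -> J k h -> J k.+1 (g * h).
Proof.
move=> g1 [h' ? hk]; exists (g * h'); first exact: IYM.
rewrite -mulrBr; exact: mordM g1 hk.
Qed.

Let linear_part (h : {mpoly K[r.+1]}) :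
  mord 2 (h - (h@_0)%:MP - \sum_k h@_(U_(k)) *: 'X_k).
Proof.
move=> m lt; rewrite !mcoeffB mcoeffC raddf_sum /=.
move: lt; rewrite ltnS leq_eqVlt => /orP [/mdeg1P [k /eqP ->]|].
  rewrite mnm1_eq0 mulr0 subr0 (bigD1 k) //= mcoeffZ mcoeffX eqxx mulr1.
  rewrite big1 ?addr0 ?subrr // => l /negbTE ne.
  by rewrite mcoeffZ mcoeffX eq_mnm1 ne mulr0.
rewrite ltnS leqn0 mdeg_eq0 => /eqP ->; rewrite eqxx mulr1 subrr sub0r.
rewrite big1 ?oppr0 // => k _.
by rewrite mcoeffZ mcoeffX mnm1_eq0 mulr0.
Qed.

(** The tangent space of the cone at [p] is a vector plane that contains [p], and p_i = 1; its
    vectors with i-th coordinate 0 form the tangent line of the affine piece. *)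
Let tangent_line : exists a : 'rV[K]_r.+1, a != 0 /\
  forall v : 'rV[K]_r.+1, (forall h, IY h -> \sum_k h@_(U_(k)) * v 0 k = 0) ->
    exists c, v = c *: a.
Proof.
have [U [dimU TU]] := C_smooth.
have coefT g k : (T g)@_(U_(k)) = g^`M(k).@[p 0].
  have der : (T g)^`M(k) = T (g^`M(k)).
    rewrite /T /taylor /comp_mpoly.
    have hd : derivation (@mpolyC r.+1 K) (mderiv k).
      by split=> [f h|f h|c]; rewrite ?mderivD ?mderivM ?mderivC.
    have dX (j : 'I_r.+1) : mderiv k (tnth [tuple 'X_k + (p 0 k)%:MP | k < r.+1] j) = (j == k)%:R.
      rewrite tnth_mktuple mderivD mderivC addr0 mderivX mnm1E.
      case: eqP => [->|_]; last by rewrite scale0r.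
      have -> : (U_(k) - U_(k) = 0 :> 'X_{1..r.+1})%MM.
        by apply/mnmP => l; rewrite mnmBE mnm0E subnn.
      by rewrite mpolyX0 scale1r.
    rewrite (derD_mmap hd) (bigD1 k) //= dX eqxx mulr1 big1 ?addr0 // => j /negbTE ne.
    by rewrite dX ne mulr0.
  have := mcoeff_mderiv k (T g) 0%MM; rewrite add0m mnm0E mulr1n => <-.
  rewrite der mcoeff0_meval [LHS]TE; apply: meval_eq => l.
  by rewrite add0r.
have p0 : p != 0 by apply/eqP => p0; move/eqP: pi; rewrite p0 mxE eq_sym oner_eq0.
have pU : p \in U.
  suff : tangent_space C p p by rewrite TU => -[].
  by split=> // g; apply: cone_tangent.
have [B [Bfree BU]] := vspace_matrix U; rewrite dimU in B Bfree BU.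
have [w [w0 [wU wi]]] : exists w : 'rV[K]_r.+1, w != 0 /\ w \in U /\ w 0 i = 0.
  pose w0 k := row k B - row k B 0 i *: p.
  have wU k : w0 k \in U by rewrite memvB ?memvZ // BU row_sub.
  have wi k : w0 k 0 i = 0 by rewrite /w0 !mxE pi mulr1 subrr.
  have [|w00] := eqVneq (w0 0) 0; last by exists (w0 0).
  have [|w01] := eqVneq (w0 1) 0; last by exists (w0 1).
  move=> e1 e0; exfalso.
  have r0 : row 0 B = row 0 B 0 i *: p by apply/eqP; rewrite -subr_eq0; apply/eqP.
  have r1 : row 1 B = row 1 B 0 i *: p by apply/eqP; rewrite -subr_eq0; apply/eqP.
  have : (\rank B <= \rank p)%N.
    apply: mxrankS; apply/row_subP => k.
    have [->|->] : k = 0 \/ k = 1.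
      by case: k => -[|[|//]] lt; [left|right]; apply/val_inj.
    - by rewrite r0 scalemx_sub.
    - by rewrite r1 scalemx_sub.
  by rewrite (eqP Bfree) rank_rV p0.
exists w; split => // v vT.
have vi : v 0 i = 0.
  have := vT ('X_i) _; rewrite (bigD1 i) //= mcoeffX eqxx mul1r big1 ?addr0.
    by apply; move=> y [_ yi]; rewrite mevalXU !mxE yi pi subrr.
  by move=> k /negbTE ne; rewrite mcoeffX eq_mnm1 eq_sym ne mul0r.
have vU : v \in U.
  have [->|v0] := eqVneq v 0; first exact: mem0v.
  suff : tangent_space C p v by rewrite TU => -[].
  split=> // g gC; rewrite -[RHS](vT (T g)).
    by apply: eq_bigr => k _; rewrite coefT.
  by apply: TIY => y [Cy _]; apply: gC.
have pw_free : row_free (col_mx p w).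
  apply: inj_row_free => c; rewrite -[c]hsubmxK mul_row_col => e.
  have c1 : lsubmx c 0 0 = 0.
    move/rowP/(_ i): e; rewrite !mxE !big_ord1 !mxE pi wi mulr1 mulr0 addr0.
    by [].
  have c1' : lsubmx c = 0 by apply/rowP => j; rewrite [j]ord1 c1 mxE.
  move: e; rewrite c1' mul0mx add0r => e.
  have c2 : rsubmx c = 0.
    apply/rowP => j; rewrite [j]ord1 [RHS]mxE; have /rV0Pn [l wl] := w0.
    move/rowP/(_ l)/eqP: e; rewrite !mxE big_ord1 mulf_eq0 (negbTE wl) orbF mxE.
    by move/eqP.
  by rewrite c2 row_mx0.
have Bpw : (B <= col_mx p w)%MS.
  have pwB : (col_mx p w <= B)%MS by rewrite col_mx_sub -!BU pU wU.
  rewrite -(mxrank_leqif_sup pwB) (eqP pw_free) (eqP Bfree) //.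
have := vU; rewrite BU => /submx_trans/(_ Bpw)/submxP [c].
rewrite -[c]hsubmxK mul_row_col => vE; exists (rsubmx c 0 0).
have c1 : lsubmx c 0 0 = 0.
  move/rowP/(_ i): (vE); rewrite vi !mxE !big_ord1 !mxE pi wi mulr1 mulr0 addr0.
  by [].
have c1' : lsubmx c = 0 by apply/rowP => j; rewrite [j]ord1 c1 mxE.
rewrite vE c1' mul0mx add0r; apply/rowP => l.
by rewrite !mxE big_ord1; congr (_ * _); rewrite mxE.
Qed.

(** The linear form [l] is a local parameter: modulo I(Y) + m^3 each coordinate of x - p is a_k l +
    b_k l^2, so that the osculating plane lies in the span of p, a, b. That the jet satisfies the
    equations of Y rests on l^2 not lying in I(Y) + m^3; otherwise p and a alone would span the
    osculating space, which has vector dimension 3. *)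
Lemma curve_jet : has_lin_dim (osculating_space 2 C i p) 2 ->
  exists a b : 'rV[K]_r.+1,
    (forall g, vanishing Y g -> 'X^3 %| mmap (@polyC K) (jet2 p a b) g) /\
    forall v, osculating_space 2 C i p v -> exists l0 l1 l2, v = l0 *: p + l1 *: a + l2 *: b.
Proof.
move=> osc; have [a [a0 aT]] := tangent_line.
have /rV0Pn [j aj] := a0.
pose l : {mpoly K[r.+1]} := (a 0 j)^-1 *: 'X_j.
have l1 : mord 1 l by rewrite /l -mul_mpolyC; apply/mordMl/mord_variable.
pose lin (h : {mpoly K[r.+1]}) : 'rV[K]_r.+1 := \row_k h@_(U_(k)).
have [d [g [gI gfree gspan]]] := finite_spanning_family IY lin.
set G := \matrix_k lin (g k) in gfree gspan.
(* The linear parts of the equations cut out the line of [a]; the linear form considered vanishes on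
   this line, hence is the linear part of an equation. *)
have XJ k : J 2 ('X_k - a 0 k *: l).
  pose lam := lin ('X_k - a 0 k *: l).
  have lama : \sum_k lam 0 k * a 0 k = 0.
    have lamE m : lam 0 m = (k == m)%:R - a 0 k / a 0 j * (j == m)%:R.
      rewrite /lam mxE /l scalerA mcoeffB mcoeffZ !mcoeffX.
      by rewrite !eq_mnm1.
    under eq_bigr do rewrite lamE mulrBl.
    rewrite sumrB (bigD1 k) //= eqxx mul1r big1 ?addr0; last first.
      by move=> m /negbTE ne; rewrite eq_sym ne mul0r.
    rewrite (bigD1 j) //= eqxx mulr1 big1 ?addr0 ?divfK ?subrr // => m /negbTE ne.
    by rewrite [j == m]eq_sym ne mulr0 mul0r.
  have lamG : (lam <= G)%MS.
    rewrite submxE; apply/eqP/rowP => c; rewrite [RHS]mxE mxE.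
    pose v := (col c (cokermx G))^T.
    have [t vE] : exists t, v = t *: a.
      apply: aT => h hI; have := gspan h hI; rewrite submxE => /eqP/rowP/(_ c).
      rewrite [RHS]mxE mxE => e; rewrite -[RHS]e; apply: eq_bigr => k' _.
      by rewrite !mxE.
    transitivity (\sum_k' lam 0 k' * v 0 k').
      by apply: eq_bigr => k' _; rewrite !mxE.
    transitivity (t * \sum_k' lam 0 k' * a 0 k'); last by rewrite lama mulr0.
    by rewrite mulr_sumr vE; apply: eq_bigr => k' _; rewrite [(_ *: a) _ _]mxE mulrCA.
  have [c cE] := submxP lamG.
  exists (\sum_k' (c 0 k')%:MP * g k').
    by apply: (big_ind IY) => // k' _; apply/IYM/gI.
  set h := \sum_k' _.
  have hI : IY h.
    by apply: (big_ind IY) => // k' _; apply/IYM/gI.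
  have Yp : Y p by split.
  have h00 : h@_0 = 0.
    rewrite mcoeff0_meval -[RHS](hI p Yp); apply: meval_eq => m.
    by rewrite subrr mxE.
  have lin_h m : h@_(U_(m)) = lam 0 m.
    rewrite cE mxE /h raddf_sum; apply: eq_bigr => k' _ /=.
    by rewrite mcoeffCM !mxE.
  have := linear_part ('X_k - a 0 k *: l - h).
  rewrite !mcoeffB h00 mcoeffZ (l1 0%MM) ?mdeg0 // (@mord_variable _ _ k 0%MM) ?mdeg0 //.
  rewrite mulr0 !subr0 big1 ?subr0 // => m _.
  by rewrite [(_ - h)@__]mcoeffB lin_h /lam mxE subrr scale0r.
have J1 h : mord 1 h -> exists c, J 2 (h - c *: l).
  move=> /mord_factor [F [_ ->]]; exists (\sum_k (F k)@_0 * a 0 k).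
  rewrite scaler_suml -sumrB; apply: J_sum => k _.
  have -> : 'X_k * F k - ((F k)@_0 * a 0 k) *: l =
      'X_k * (F k - ((F k)@_0)%:MP) + ((F k)@_0)%:MP * ('X_k - a 0 k *: l).
    by rewrite -!mul_mpolyC mpolyCM; ring.
  apply: JD; last exact: JM.
  apply/J_mord/(@mordM _ _ 1 1); [exact: mord_variable | exact: mord1_const].
have J2 h : mord 2 h -> exists c, J 3 (h - c *: l ^+ 2).
  move=> /mord_factor [F [F1 ->]].
  have /choice [c cJ] k := J1 (F k) (F1 k).
  exists (\sum_k c k * a 0 k).
  rewrite scaler_suml -sumrB; apply: J_sum => k _.
  have -> : 'X_k * F k - (c k * a 0 k) *: l ^+ 2 =
      'X_k * (F k - c k *: l) + (c k)%:MP * (l * ('X_k - a 0 k *: l)).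
    by rewrite -!mul_mpolyC mpolyCM; ring.
  apply: JD; first by apply: J_mordM => //; apply: mord_variable.
  exact/JM/J_mordM.
have /choice [b bJ] k : exists c, J 3 ('X_k - a 0 k *: l - c *: l ^+ 2).
  have [g' g'I /J2 [c cJ]] := XJ k; exists c.
  have -> : 'X_k - a 0 k *: l - c *: l ^+ 2 =
    g' + ('X_k - a 0 k *: l - g' - c *: l ^+ 2) by ring.
  by apply: JD => //; apply: J_IY.
pose bv : 'rV[K]_r.+1 := \row_k b k.
pose q h := mmap (@polyC K) (fun k => a 0 k *: 'X + b k *: 'X^2) h.
pose La (u : {poly K}) : {mpoly K[r.+1]} := (map_poly (@mpolyC r.+1 K) u).[l].
have LaE h : La (q h) = mmap (@mpolyC r.+1 K) (fun k => a 0 k *: l + b k *: l ^+ 2) h.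
  apply: (rmorph_mmap_comp (f := horner_eval l \o map_poly (@mpolyC r.+1 K))) => [c|k] /=.
    by rewrite /horner_eval map_polyC hornerC.
  rewrite /horner_eval rmorphD /= !map_polyZ map_polyX map_polyXn.
  by rewrite hornerD !hornerZ hornerX hornerXn !mul_mpolyC.
have La3 u : J 3 (La u - ((u`_0)%:MP + u`_1 *: l + u`_2 *: l ^+ 2)).
  rewrite -{1}(poly_take_drop 3 u) /La rmorphD rmorphM /= map_polyXn hornerD hornerM hornerXn.
  have -> : (map_poly (@mpolyC r.+1 K) (take_poly 3 u)).[l] =
      (u`_0)%:MP + u`_1 *: l + u`_2 *: l ^+ 2.
    rewrite /take_poly poly_def !big_ord_recr big_ord0 /= add0r !rmorphD /= !map_polyZ /=.
    by rewrite !map_polyXn !hornerD !hornerZ !hornerXn !mul_mpolyC expr0 -mul_mpolyC mulr1.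
  rewrite addrAC subrr add0r; apply/J_mord/mordMl.
  by apply: (@mordM _ _ 1 2) => //; apply: (@mordM _ _ 1 1).
have Jq h : J 3 (h - (((q h)`_0)%:MP + (q h)`_1 *: l + (q h)`_2 *: l ^+ 2)).
  set Q := _ + _ *: l ^+ 2; have -> : h - Q = (h - La (q h)) + (La (q h) - Q).
    by rewrite addrA subrK.
  apply: JD; last exact: La3.
  rewrite LaE {Q}; elim/mpoly_ring_ind: h => [c|k|g1 g2 IH1 IH2|g1 g2 IH1 IH2].
  - by rewrite mmapC subrr; apply/J_mord/mord_zero.
  - by rewrite mmapX mmap1U opprD addrA.
  - by rewrite mmapD opprD addrACA; apply: JD.
  - rewrite rmorphM /=; move: (mmap _ _ g1) (mmap _ _ g2) IH1 IH2 => s1 s2 IH1 IH2.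
    have -> : g1 * g2 - s1 * s2 = g1 * (g2 - s2) + s2 * (g1 - s1) by ring.
    by apply: JD; apply: JM.
have osc_lin v c : osculating_space 2 C i p v -> (linform c).@[p 0] = 0 ->
    J 3 (linform c) -> (linform c).@[v 0] = 0.
  move=> [_ vosc] cp [g' g'I ck]; apply: vosc.
  exists (linform c - back g').
    by rewrite opprB addrC subrK; apply: IY_back.
  have -> : taylor (linform c - back g') p = linform c - g'.
    transitivity (T (linform c) - T (back g')); first exact: (raddfB (comp_mpoly _)).
    rewrite T_back; congr (_ - _); rewrite /T /taylor /linform raddf_sum /=.
    under eq_bigr do rewrite comp_mpolyZ comp_mpolyXU -tnth_nth tnth_mktuple scalerDr.
    rewrite big_split /= -[RHS]addr0; congr (_ + _).
    transitivity ((\sum_k c 0 k * p 0 k)%:MP : {mpoly K[r.+1]}).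
      by rewrite raddf_sum; apply: eq_bigr => k _; rewrite /= mpolyCM mul_mpolyC.
    by rewrite -[\sum_k _]meval_linform cp mpolyC0.
  exact: ck.
have lin3 c : J 3 (linform c - ((\sum_k c 0 k * a 0 k) *: l + (\sum_k c 0 k * b k) *: l ^+ 2)).
  rewrite !scaler_suml -big_split -sumrB; apply: J_sum => k _ /=.
  rewrite (_ : _ - _ = (c 0 k)%:MP * ('X_k - a 0 k *: l - b k *: l ^+ 2)); first exact: JM.
  by rewrite -!mul_mpolyC !mpolyCM; ring.
have span3 m (M : 'M[K]_(m, r.+1)) v : osculating_space 2 C i p v ->
    (forall c : 'rV[K]_r.+1, M *m c^T = 0 -> (linform c).@[p 0] = 0 /\ J 3 (linform c)) ->
  (v <= M)%MS.
  move=> vo MJ; rewrite submxE; apply/eqP/rowP => t; rewrite [RHS]mxE mxE.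
  pose c := (col t (cokermx M))^T.
  have [|cp cJ] := MJ c.
    by rewrite trmxK colE mulmxA mulmx_coker mul0mx.
  rewrite -[RHS](osc_lin v c vo cp cJ) meval_linform; apply: eq_bigr => k _.
  by rewrite !mxE mulrC.
exists a, bv.
have [U [dimU oscU]] := osc.
have nJ : ~ J 3 (l ^+ 2).
  move=> Jl; have [B [Bfree BU]] := vspace_matrix U; rewrite dimU in B Bfree BU.
  have : (B <= col_mx p a)%MS.
    apply/row_subP => k; apply: span3.
      rewrite oscU; split; last by rewrite BU row_sub.
      apply/eqP => r0; have := row_free_inj Bfree (_ : delta_mx 0 k *m B = (0 : 'rV_3) *m B).
      rewrite mul0mx -rowE => /(_ r0)/matrixP/(_ 0 k); rewrite !mxE !eqxx => /eqP.
      by rewrite oner_eq0.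
    move=> c; rewrite mul_col_mx => /eqP; rewrite col_mx_eq0 => /andP [/eqP cp /eqP ca].
    have cp0 : (linform c).@[p 0] = 0.
      by rewrite meval_linform; move/rowP/(_ 0): cp; rewrite [RHS]mxE mxE => {2}<-;
        apply: eq_bigr => k' _; rewrite mxE mulrC.
    split => //; have := lin3 c.
    rewrite (_ : \sum_k' c 0 k' * a 0 k' = 0).
      rewrite scale0r add0r => h; rewrite -[linform c](subrK ((\sum_k c 0 k * b k) *: l ^+ 2)).
      by apply: JD => //; rewrite -mul_mpolyC; apply: JM.
    move/rowP/(_ 0): ca; rewrite [RHS]mxE mxE => {2}<-.
    by apply: eq_bigr => k' _; rewrite mxE mulrC.
  move/mxrankS; rewrite (eqP Bfree) => le.
  by have := leq_trans le (rank_leq_row _).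
have ortho (c w : 'rV[K]_r.+1) : w *m c^T = 0 -> \sum_k c 0 k * w 0 k = 0.
  move=> /rowP/(_ 0); rewrite [RHS]mxE mxE => e; rewrite -[RHS]e.
  by apply: eq_bigr => k _; rewrite mxE mulrC.
split=> [f fY|v vo]; last first.
  have : (v <= col_mx p (col_mx a bv))%MS.
    apply: span3 => // c; rewrite !mul_col_mx => /eqP; rewrite !col_mx_eq0.
    move=> /and3P [/eqP cp /eqP ca /eqP cb]; split.
      by rewrite meval_linform ortho.
    have := lin3 c; rewrite ortho // (_ : \sum_k c 0 k * b k = 0).
      by rewrite !scale0r addr0 subr0.
    by rewrite -[RHS](ortho _ _ cb); apply: eq_bigr => k _; rewrite mxE.
  move=> /submxP [c]; rewrite -[c]hsubmxK mul_row_col -[rsubmx c]hsubmxK mul_row_col.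
  move=> ->; exists (lsubmx c 0 0), (lsubmx (rsubmx c) 0 0), (rsubmx (rsubmx c) 0 0).
  have sc (t : 'rV[K]_1) (w : 'rV[K]_r.+1) : t *m w = t 0 0 *: w.
    by rewrite [t]mx11_scalar mul_scalar_mx !mxE eqxx mulr1n.
  by rewrite !sc addrA.
pose Q := mmap (@polyC K) (jet2 p a bv) f.
have QE : q (T f) = Q.
  rewrite /q TE; apply: eq_mmap => k; rewrite /jet2 mxE addrC addrA.
  by [].
have Jlow : J 3 ((Q`_0)%:MP + Q`_1 *: l + Q`_2 *: l ^+ 2).
  have JTg : J 3 (T f) by apply/J_IY/TIY.
  by have := JB JTg (Jq (T f)); rewrite QE opprB addrC subrK.
have Jdiv (c : K) : c != 0 -> J 3 (c *: l ^+ 2) -> False.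
  move=> c0 Jc; apply: nJ; have := JM (c^-1)%:MP Jc.
  by rewrite mul_mpolyC scalerA mulVf // scale1r.
have l3 c e : (3 <= e)%N -> J 3 (c * l ^+ e).
  move=> le; apply/JM/J_mord; rewrite -(subnK le) exprD; apply: mordMl.
  by apply: (@mordM _ _ 1 2) => //; apply: (@mordM _ _ 1 1).
(* Multiplication of [Jlow] by l^2, then by l, then by 1 turns the lowest remaining coefficient into
   that of l^2. *)
have q0 : Q`_0 = 0.
  apply: contrapT => /eqP q0; apply: (Jdiv _ q0).
  have -> : Q`_0 *: l ^+ 2 = l ^+ 2 * ((Q`_0)%:MP + Q`_1 *: l + Q`_2 *: l ^+ 2) -
      ((Q`_1)%:MP * l ^+ 3 + (Q`_2)%:MP * l ^+ 4) by rewrite -!mul_mpolyC; ring.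
  by apply: JB; [apply: JM | apply: JD; apply: l3].
have q1 : Q`_1 = 0.
  apply: contrapT => /eqP q1; apply: (Jdiv _ q1).
  have -> : Q`_1 *: l ^+ 2 = l * ((Q`_0)%:MP + Q`_1 *: l + Q`_2 *: l ^+ 2) -
      (Q`_2)%:MP * l ^+ 3 by rewrite q0 mpolyC0 -!mul_mpolyC; ring.
  by apply: JB; [apply: JM | apply: l3].
have q2 : Q`_2 = 0.
  apply: contrapT => /eqP q2; apply: (Jdiv _ q2).
  by move: Jlow; rewrite q0 q1 mpolyC0 scale0r !add0r.
by apply/dvdXn_fps_ord => -[|[|[|//]]].
Qed.

End Curve.

Lemma osculating_jet v : osculating_union 2 n X v ->
  exists (p a b : 'rV[K]_r.+1) (l0 l1 l2 : K), [/\ smooth_locus n X p,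
    forall g, vanishing X g -> 'X^3 %| mmap (@polyC K) (jet2 p a b) g &
    v = l0 *: p + l1 *: a + l2 *: b].
Proof.
move=> [C [i [p [[[Z [W [Zc Wc CE]]] _ _ Csm] CX [Cp pi] osc vo]]]].
have C_cone : cone C.
  rewrite CE => u t [Zu Wu] t0; split; first exact: (pclosed_cone Zc).
  move=> Wt; apply: Wu; rewrite -[u]scale1r -(mulVf t0) -scalerA.
  by apply: (pclosed_cone Wc) => //; rewrite invr_eq0.
have [_ Tp] := Csm p Cp.
have [a [b [dvd span]]] := curve_jet C_cone Cp pi Tp osc.
have [l0 [l1 [l2 vE]]] := span v vo.
exists p, a, b, l0, l1, l2; split=> //; first exact: CX.
by move=> g gX; apply: dvd => y [Cy _]; apply: gX; case: (CX y Cy).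
Qed.

End Osculating.

(** * Second-order arcs and tangent fields *)

Section SecondOrder.
Variables (K : numFieldType) (r n : nat) (X : set 'rV[K]_r.+1).
Implicit Types (p a h v : 'rV[K]_r.+1) (g : {mpoly K[r.+1]}).

(* The curve p + a t + h t^2 / 2 is contained in X modulo t^3. *)
Definition second_order p a h : Prop :=
  [/\ X p, tangent_at X idfun (p 0) a & forall g, vanishing X g ->
    \sum_i (\sum_j g^`M(i)^`M(j).@[p 0] * a 0 j) * a 0 i +
    \sum_i g^`M(i).@[p 0] * h 0 i = 0].

Lemma tangent_lincomb p a h c : tangent_at X idfun (p 0) a ->
  tangent_at X idfun (p 0) h -> tangent_at X idfun (p 0) (c *: a + h).
Proof.
move=> ta th g gX; pose d k := mmap idfun (p 0) g^`M(k).
transitivity (c * (\sum_k d k * a 0 k) + \sum_k d k * h 0 k).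
  by rewrite mulr_sumr -big_split; apply: eq_bigr => k _; rewrite /= !mxE; ring.
by rewrite [X in c * X](ta g gX) [X in _ + X](th g gX) mulr0 addr0.
Qed.

Lemma tangent_at0 p : tangent_at X idfun (p 0) 0.
Proof. by move=> g _; rewrite big1 // => k _; rewrite mxE mulr0. Qed.

(** The substitution of c t for t, followed by the addition of a tangent vector to the acceleration,
    which the condition allows. *)
Lemma second_order_scale p a h c v : second_order p a h ->
  tangent_at X idfun (p 0) v -> second_order p (c *: a) (c ^+ 2 *: h + v).
Proof.
move=> [Xp ta ah] tv; split=> // [|g gX].
  by rewrite -[_ *: a]addr0; apply: tangent_lincomb => //; apply: tangent_at0.
pose d k := g^`M(k).@[p 0]; pose d2 i k := g^`M(i)^`M(k).@[p 0].
transitivity (c ^+ 2 * (\sum_i (\sum_j d2 i j * a 0 j) * a 0 i + \sum_i d i * h 0 i) +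
  \sum_k d k * v 0 k).
  rewrite mulrDr -addrA !mulr_sumr; congr (_ + _).
    apply: eq_bigr => i _; rewrite !mulr_suml mulr_sumr; apply: eq_bigr => j _.
    by rewrite !mxE /d2; ring.
  by rewrite -big_split; apply: eq_bigr => k _; rewrite /= !mxE /d; ring.
by rewrite [X in c ^+ 2 * X](ah g gX) [X in _ + X](tv g gX) mulr0 addr0.
Qed.

Lemma second_order_unique p a h h' : second_order p a h -> second_order p a h' ->
  tangent_at X idfun (p 0) (h - h').
Proof.
move=> [_ _ ah] [_ _ ah'] g gX.
have := ah g gX; rewrite -[X in _ = X](ah' g gX) => /addrI /eqP; rewrite -subr_eq0 => /eqP e.
by rewrite -[RHS]e -sumrB; apply: eq_bigr => k _; rewrite !mxE mulrBr.
Qed.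

Lemma jet2_second_order p a b : X p ->
  (forall g, vanishing X g -> ('X^3 %| mmap (@polyC K) (jet2 p a b) g)%R) ->
  second_order p a (2%:R *: b).
Proof.
move=> Xp dvd; pose q g := mmap (@polyC K) (jet2 p a b) g.
have phi0 k : (jet2 p a b k).[0] = p 0 k.
  by rewrite /jet2 !hornerD hornerC !hornerZ hornerX hornerXn expr2 !mulr0 !addr0.
have q0 g : (q g).[0] = g.@[p 0].
  apply: (rmorph_mmap_comp (f := horner_eval 0)) => [c|k] /=.
    by rewrite /horner_eval hornerC.
  exact: phi0.
have phi1 k : (jet2 p a b k)^`() = (a 0 k)%:P + (2%:R * b 0 k) *: 'X.
  rewrite /jet2 !derivD derivC add0r !derivZ derivX derivXn -mul_polyC mulr1; congr (_ + _).
  by rewrite -!mul_polyC polyCM -[in LHS]mulr_natl polyC_natr; ring.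
have phi2 k : (jet2 p a b k)^`()^`() = (2%:R * b 0 k)%:P.
  by rewrite phi1 derivD derivC add0r derivZ derivX alg_polyC.
have low g i : vanishing X g -> (i < 3)%N -> (q g)`_i = 0.
  by move=> /dvd /dvdpP [u e] i3; rewrite /q e coefMXn i3.
split=> // g gX.
  have e := low g 1%N gX isT.
  have : (q g)^`().[0] = 0 by rewrite horner_coef0 coef_deriv e mul0rn.
  rewrite /q (derD_mmap (deriv_polyC_der K)) horner_sum => e'; rewrite -[RHS]e'.
  by apply: eq_bigr => k _; rewrite hornerM phi1 !hornerE ?mulr0 ?addr0 q0.
have : (q g)^`()^`().[0] = 0.
  by rewrite horner_coef0 !coef_deriv low // !mul0rn.
rewrite /q (derD2_mmap (deriv_polyC_der K)) hornerD !horner_sum => e'; rewrite -[RHS]e'.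
congr (_ + _); apply: eq_bigr => i _; last first.
  by rewrite hornerM phi2 hornerC q0 !mxE.
rewrite hornerM horner_sum phi1 !hornerE ?mulr0 ?addr0; congr (_ * _).
by apply: eq_bigr => j _; rewrite hornerM phi1 !hornerE ?mulr0 ?addr0 q0.
Qed.

Definition field_der (A : 'I_r.+1 -> {mpoly K[r.+1]}) g := \sum_k A k * g^`M(k).

Lemma field_derivation A : derivation (@mpolyC r.+1 K) (field_der A).
Proof.
split=> [p q|p q|c]; rewrite /field_der.
- by rewrite -big_split; apply: eq_bigr => i _; rewrite mderivD mulrDr.
- rewrite mulr_suml mulr_sumr -big_split; apply: eq_bigr => i _ /=.
  by rewrite mderivM; ring.
- by rewrite big1 // => i _; rewrite mderivC mulr0.
Qed.

Definition tangent_field A := forall g, vanishing X g -> vanishing X (field_der A g).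

(** Applying [A] twice to an equation of X gives the second-order condition for the integral curves
    of [A], of acceleration A(A); the tangent field [B] may be added to this. *)
Lemma field_second_order A B q : tangent_field A -> tangent_field B -> X q ->
  second_order q (\row_k (A k).@[q 0]) (\row_k (field_der A (A k) + B k).@[q 0]).
Proof.
move=> tA tB Xq.
have fX C k : field_der C 'X_k = C k.
  rewrite /field_der (bigD1 k) //= mderivXU eqxx mulr1 big1 ?addr0 // => l /negbTE ne.
  by rewrite mderivXU eq_sym ne mulr0.
have gE g : mmap (@mpolyC r.+1 K) (fun k => 'X_k) g = g.
  elim/mpoly_ring_ind: g => [c|k|g h IHg IHh|g h IHg IHh].
  - by rewrite mmapC.
  - by rewrite mmapX mmap1U.
  - by rewrite mmapD IHg IHh.
  - by rewrite rmorphM /= IHg IHh.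
split=> // g gX.
  rewrite -[RHS](tA g gX q Xq) /field_der raddf_sum; apply: eq_bigr => k _ /=.
  by rewrite mxE mevalM mulrC.
pose d k := g^`M(k).@[q 0]; pose d2 i k := g^`M(i)^`M(k).@[q 0].
have e1 : \sum_i (\sum_j d2 i j * (A j).@[q 0]) * (A i).@[q 0] +
    \sum_i d i * (field_der A (A i)).@[q 0] = 0.
  rewrite -[RHS](tA _ (tA g gX) q Xq) -{1}[g]gE (derD2_mmap (field_derivation A)) mevalD.
  rewrite !raddf_sum /=; congr (_ + _); apply: eq_bigr => i _; rewrite ?gE !fX mevalM //.
  rewrite raddf_sum; congr (_ * _); apply: eq_bigr => j _.
  by rewrite /= gE fX mevalM.
have e2 : \sum_k d k * (B k).@[q 0] = 0.
  rewrite -[RHS](tB g gX q Xq) /field_der raddf_sum; apply: eq_bigr => k _.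
  by rewrite /= mevalM mulrC.
have := congr2 +%R e1 e2; rewrite addr0 -addrA => e; rewrite -[RHS]e; congr (_ + _).
  by apply: eq_bigr => i _; rewrite mxE; congr (_ * _); apply: eq_bigr => j _; rewrite mxE.
by rewrite -big_split; apply: eq_bigr => i _; rewrite mxE mevalD mulrDr.
Qed.

Hypotheses (X_closed : pclosed X) (X_irr : pirreducible X) (X_chain : has_chain X n).

Lemma exists_tangent_field p v : smooth_locus n X p -> tangent_at X idfun (p 0) v ->
  exists A, tangent_field A /\ \row_k (A k).@[p 0] = v.
Proof.
move=> sm tv; have [f [L [Y [fp [tanY span _ _]]]]] := exists_smooth_frame X_closed X_irr X_chain sm.
pose c := (f.@[p 0])^-1 *: (v *m L).
exists (fun k => \sum_j (c 0 j)%:MP * Y j k); split.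
  move=> g gX q Xq; rewrite /field_der.
  have -> : \sum_k (\sum_j (c 0 j)%:MP * Y j k) * g^`M(k) =
      \sum_j (c 0 j)%:MP * \sum_k Y j k * g^`M(k).
    under eq_bigr do rewrite mulr_suml.
    rewrite exchange_big; apply: eq_bigr => j _; rewrite mulr_sumr.
    by apply: eq_bigr => k _; rewrite mulrA.
  by rewrite raddf_sum big1 // => j _; rewrite /= mevalM (tanY j g gX q Xq) mulr0.
have := span _ _ _ _ tv => /(congr1 ( *:%R f.@[p 0]^-1)).
rewrite -[X in _ *: (X *: v)]/(f.@[p 0]) scalerK // => ->.
rewrite scalemxAl; apply/rowP => k; rewrite !mxE raddf_sum; apply: eq_bigr => j _.
rewrite /= mevalM mevalC !mxE; congr (_ * _ * _).
by apply: eq_bigr => i _; rewrite mxE.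
Qed.

End SecondOrder.

(** * The rank of W and the dimension of Osc_2(X) *)

Section OscRank.
Variables (K : numFieldType) (r n : nat) (X : set 'rV[K]_r.+1).
Hypotheses (X_closed : pclosed X) (X_irr : pirreducible X) (X_chain : has_chain X n).
Hypothesis sqrt_exists : forall x : K, exists y, y ^+ 2 = x.
Variables (f : {mpoly K[r.+1]}) (L : 'M[K]_(r.+1, n.+1)).
Variables (Y : 'M[{mpoly K[r.+1]}]_(n.+1, r.+1)) (p0 : 'rV[K]_r.+1).
Hypotheses (frame : smooth_frame X f L Y) (Xp0 : X p0) (fp0 : f.@[p0 0] != 0).
Local Notation m := n.+1.
Local Notation N := ((r.+1 + 1) + (m + (m + m)))%N.
Variables (E : fieldType) (iota : {rmorphism K -> E}) (xi : 'I_N -> E).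
Hypothesis gen : generic_point (jet_set X f) iota xi.
Variables (D : E -> E) (d a b e : 'I_m -> E -> E).
Hypothesis J : jet_derivations L iota xi D d a b e.
Local Notation ev := (mmap iota xi).
Local Notation x := (genx xi).

Lemma tangent_frame_eq0 (q v : 'rV[K]_r.+1) : f.@[q 0] != 0 -> tangent_at X idfun (q 0) v ->
  v *m L = 0 -> v = 0.
Proof.
move=> fq tv vL; have [_ span _ _] := frame.
have := span _ _ _ _ tv; have -> : map_mx idfun L = L by apply/matrixP => i j; rewrite mxE.
by rewrite vL mul0mx => /eqP; rewrite scaler_eq0 => /orP [|/eqP //]; move/negP: fq.
Qed.

Lemma second_order_ext (q a1 a2 h1 h2 : 'rV[K]_r.+1) : f.@[q 0] != 0 ->
    second_order X q a1 h1 -> second_order X q a2 h2 ->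
  a1 *m L = a2 *m L -> h1 *m L = h2 *m L -> a1 = a2 /\ h1 = h2.
Proof.
move=> fq so1 so2 aL hL.
have aE : a1 = a2.
  apply/eqP; rewrite -subr_eq0; apply/eqP/(tangent_frame_eq0 fq).
    case: so1 so2 => [_ t1 _] [_ t2 _].
    by rewrite addrC -scaleN1r; apply: tangent_lincomb.
  by rewrite mulmxBl aL subrr.
split=> //; rewrite aE in so1.
apply/eqP; rewrite -subr_eq0; apply/eqP/(tangent_frame_eq0 fq).
  exact: second_order_unique so1 so2.
by rewrite mulmxBl hL subrr.
Qed.

Section Field.
Variable V : 'I_N -> {mpoly K[N]}.
Hypothesis VE : forall i, ev (V i) = D (xi i).

Lemma jet_second_order P : jet_set X f P ->
  second_order X (\row_i P (jx n i)) (\row_i (Xpol V 1 i).@[P]) (\row_i (Xpol V 2 i).@[P]).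
Proof.
move=> SP; have [XP _] := (jet_setP X f P).1 SP.
have hV := vfield_derivation V.
have vgX j g : vanishing X g -> (iter j (vfield V) (lift n g)).@[P] = 0.
  move=> gX; apply: (gen.1 _).1 SP; rewrite (ev_vfield J VE) mmap_lift.
  rewrite (gen_vanishing gen) //; elim: j => //= j ->.
  exact: derD_0 (jet_D J).
have lE g : (mmap (@mpolyC N K) (fun i => 'X_(jx n i)) g).@[P] = g.@[(\row_i P (jx n i)) 0].
  rewrite [LHS]mmap_comp; apply: eq_mmap => i.
  by rewrite -[LHS]/('X_(jx n i)).@[P] mevalXU mxE.
split=> // g gX.
  rewrite -[RHS](vgX 1%N g gX) /= /lift (derD_mmap hV) raddf_sum.
  by apply: eq_bigr => i _; rewrite /= mevalM lE mxE.
rewrite -[RHS](vgX 2%N g gX) /= /lift (derD2_mmap hV) mevalD !raddf_sum.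
congr (_ + _); apply: eq_bigr => i _; rewrite /= mevalM ?lE [X in _ * X]mxE //.
congr (_ * _); rewrite [RHS]raddf_sum; apply: eq_bigr => j _.
by rewrite /= mevalM lE mxE.
Qed.

Lemma Xpol_linear P : jet_set X f P ->
  (\row_i (Xpol V 1 i).@[P]) *m L = (\row_k P (jc1 r k)) /\
  (\row_i (Xpol V 2 i).@[P]) *m L = 2%:R *: (\row_k P (jc2 r k)).
Proof.
move=> SP; have [D0 D1 _ _] := jet_Du J; have hD := jet_D J.
have DL j k : iter j D (u0 L iota xi k) = \sum_i iter j D (xi (jx n i)) * iota (L i k).
  elim: j => [|j IH]; first by rewrite /u0 mxE; apply: eq_bigr => i _; rewrite !mxE.
  rewrite iterS IH (derD_sum hD); apply: eq_bigr => i _.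
  by rewrite (derD_mul hD) (derD_cst hD) mulr0 addr0.
have main j k (g : {mpoly K[N]}) : iter j D (u0 L iota xi k) = ev g ->
    \sum_i (Xpol V j i).@[P] * L i k = g.@[P].
  move=> e0; have : vanish_on (jet_set X f) (\sum_i Xpol V j i * (L i k)%:MP - g).
    apply/gen.1; rewrite mmapB -e0 DL raddf_sum; apply/eqP; rewrite subr_eq0.
    apply/eqP; apply: eq_bigr => i _.
    by rewrite /= (rmorphM ev) /= (ev_Xpol J VE) mmapC !mxE.
  move=> /(_ P SP); rewrite mevalB raddf_sum => /eqP; rewrite subr_eq0 => /eqP <-.
  by apply: eq_bigr => i _; rewrite /= mevalM mevalC.
split; apply/rowP => k; rewrite !mxE.
  rewrite -(mevalXU P) -(main 1%N k) /= ?D0 ?mmapX ?mmap1U //.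
  by apply: eq_bigr => i _; rewrite mxE.
transitivity ((2%:R * 'X_(jc2 r k) : {mpoly K[N]}).@[P]).
  rewrite -(main 2%N k) /=.
    by apply: eq_bigr => i _; rewrite mxE.
  by rewrite D0 D1 (rmorphM ev) /= rmorph_nat mmapX mmap1U.
by rewrite mevalM rmorph_nat mevalXU.
Qed.

(** [v] is the acceleration of a second-order arc of X at [p], but [f] may vanish at [p]. The arc is
    therefore spread out by tangent fields [A] and [B]: at each q with f(q) != 0 the acceleration
    H(q) is the value of D^2 x at some jet, so that [R] vanishes at H(q), and by irreducibility this
    extends to [p]. *)
Lemma osc_relation (R : {mpoly K[r.+1]}) (v : 'rV[K]_r.+1) :
  mmap iota (fun i => jetX D x 2 0 i) R = 0 -> osculating_union 2 n X v -> R.@[v 0] = 0.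
Proof.
move=> R0 /osculating_jet [p [a1 [b1 [l0 [l1 [l2 [sm dvd vE]]]]]]].
have [Xp _] := sm.
have so1 := jet2_second_order Xp dvd.
(* Replacing t by c t multiplies the acceleration 2 b by c^2, and 2 c^2 = l2; the terms in [p] and
   [a1] are tangent vectors. *)
have [c cE] := sqrt_exists (l2 / 2%:R).
have [_ ta _] := so1.
have tp : tangent_at X idfun (p 0) p.
  by move=> g gX; apply: cone_tangent Xp gX; apply: pclosed_cone.
have tw : tangent_at X idfun (p 0) (l1 *: a1 + (l0 *: p + 0)).
  by apply: tangent_lincomb => //; apply: tangent_lincomb => //; apply: tangent_at0.
have so2 := second_order_scale c so1 tw.
have hv : c ^+ 2 *: (2%:R *: b1) + (l1 *: a1 + (l0 *: p + 0)) = v.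
  rewrite cE scalerA divfK ?pnatr_eq0 // vE addr0 addrC [l1 *: _ + _]addrC.
  by [].
rewrite hv in so2; have [_ tca _] := so2.
have [A [tA Ap]] := exists_tangent_field X_closed X_irr X_chain sm tca.
have tf0 : tangent_field X (fun=> 0).
  by move=> g gX; rewrite /field_der big1 => [q _|k _]; rewrite ?meval0 ?mul0r.
have so3 := field_second_order tA tf0 Xp.
rewrite Ap in so3; have tB := second_order_unique so2 so3.
have [B [tfB Bp]] := exists_tangent_field X_closed X_irr X_chain sm tB.
pose H k := field_der A (A k) + B k.
have Hp : \row_k (H k).@[p 0] = v.
  apply/rowP => k; move/rowP/(_ k): Bp; rewrite !mxE /H !mevalD meval0 addr0 => ->.
  by rewrite addrCA subrr addr0.
pose RH := mmap (@mpolyC r.+1 K) H R.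
have RHE q : RH.@[q 0] = R.@[(\row_k (H k).@[q 0]) 0].
  by rewrite [LHS]mmap_comp; apply: eq_mmap => k; rewrite mxE.
rewrite -Hp -RHE; move: p Xp {sm so1 dvd ta tp tw so2 hv tca Ap so3 tB Bp Hp vE}.
suff : vanish_on (points X) RH by move/vanish_on_points.
have [] := (pirreducible_aprime X_closed X_irr).2 RH f => //; last first.
  by move/(f_nvanish Xp0 fp0).
apply/vanish_on_points => q Xq; rewrite mevalM.
have [->|fq] := eqVneq f.@[q 0] 0; first by rewrite mulr0.
pose Aq := \row_k (A k).@[q 0]; pose Hq := \row_k (H k).@[q 0].
pose P := jet_pt (q 0) (f.@[q 0])^-1 ((Aq *m L) 0) ((2%:R^-1 *: (Hq *m L)) 0) (fun=> 0).
have SP : jet_set X f P by apply: jet_set_pt => //; rewrite mulVf.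
have so := jet_second_order SP.
have qE : \row_i P (jx n i) = q by apply/rowP => i; rewrite mxE /P jet_ptx.
rewrite qE in so; have [P1 P2] := Xpol_linear SP.
have [] := second_order_ext fq so (field_second_order tA tfB Xq).
- by rewrite P1; apply/rowP => k; rewrite mxE /P jet_pt1.
- rewrite P2 -/Hq; apply/rowP => k; rewrite mxE [X in _ * X]mxE /P jet_pt2 mxE mulrA divff ?mul1r //.
  by rewrite pnatr_eq0.
move=> _ P2E; rewrite RHE -P2E.
have := (gen.1 (mmap (@mpolyC N K) (fun i => Xpol V 2 i) R)).1.
rewrite mmap_comp => vanR.
rewrite (_ : R.@[_] = (mmap (@mpolyC N K) (fun i => Xpol V 2 i) R).@[P]).
  rewrite vanR ?mul0r // -[RHS]R0; apply: eq_mmap => i.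
  by rewrite (ev_Xpol J VE).
by rewrite [RHS]mmap_comp; apply: eq_mmap => i; rewrite mxE.
Qed.

End Field.

(** [D1] is a combination of the [d], [a], [b], [e], which send D^2 x to the rows of Y_2, 2 Y_1, 2
    Y_0 and to 0. *)
Lemma der_jetX2 D1 : derivation iota D1 ->
  (map_mx D1 (jetX D x 2) <= jetW D d x)%MS.
Proof.
move=> h1; have [hD hd ha hb he] := And5 (jet_D J) (jet_d J) (jet_a J) (jet_b J) (jet_e J).
pose c0 k := D1 (u0 L iota xi k); pose c1 k := D1 (xi (jc1 r k)).
pose c2 k := D1 (xi (jc2 r k)); pose c3 k := D1 (xi (jc3 r k)).
have zero_der : derivation iota (fun=> 0 : E).
  by split=> *; rewrite ?mul0r ?mulr0 ?addr0.
have h2 := derivation_lincomb c3 (derivation_lincomb c2 (derivation_lincomb c1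
  (derivation_lincomb c0 zero_der hd) ha) hb) he.
have sum1 (c F : 'I_m -> E) k : (forall w, F w = (w == k)%:R) -> \sum_w c w * F w = c k.
  move=> F1; rewrite (bigD1 k) //= F1 eqxx mulr1 big1 ?addr0 // => w /negbTE ne.
  by rewrite F1 ne mulr0.
have sum0 (c F : 'I_m -> E) : (forall w, F w = 0) -> \sum_w c w * F w = 0.
  by move=> F0; rewrite big1 // => w _; rewrite F0 mulr0.
have D1E := der_ext frame gen h1 h2.
have {}D1E z : D1 z = 0 + \sum_w c0 w * d w z + \sum_w c1 w * a w z +
    \sum_w c2 w * b w z + \sum_w c3 w * e w z.
  apply: D1E; apply: (@ucoord_ind _ _ _ L E iota xi (fun z => D1 z = 0 + \sum_w c0 w * d w z +
    \sum_w c1 w * a w z + \sum_w c2 w * b w z + \sum_w c3 w * e w z)) => k; symmetry.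
  - rewrite (sum1 c0 (d^~ _) k) ?(sum0 c1 (a^~ _)) ?(sum0 c2 (b^~ _)) ?(sum0 c3 (e^~ _))
      ?add0r ?addr0 // => w; [by case: (jet_eu J w)|by case: (jet_bu J w)|
      by case: (jet_au J w)|by case: (jet_du J w)].
  - rewrite (sum0 c0 (d^~ _)) ?(sum1 c1 (a^~ _) k) ?(sum0 c2 (b^~ _)) ?(sum0 c3 (e^~ _))
      ?add0r ?addr0 // => w; [by case: (jet_eu J w)|by case: (jet_bu J w)|
      by case: (jet_au J w)|by case: (jet_du J w)].
  - rewrite (sum0 c0 (d^~ _)) ?(sum0 c1 (a^~ _)) ?(sum1 c2 (b^~ _) k) ?(sum0 c3 (e^~ _))
      ?add0r ?addr0 // => w; [by case: (jet_eu J w)|by case: (jet_bu J w)|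
      by case: (jet_au J w)|by case: (jet_du J w)].
  - rewrite (sum0 c0 (d^~ _)) ?(sum0 c1 (a^~ _)) ?(sum0 c2 (b^~ _)) ?(sum1 c3 (e^~ _) k)
      ?add0r ?addr0 // => w; [by case: (jet_eu J w)|by case: (jet_bu J w)|
      by case: (jet_au J w)|by case: (jet_du J w)].
have xE : map_mx D1 (jetX D x 2) = (\row_k c0 k) *m jetY D d x 2 +
    (2%:R *: \row_k c1 k) *m jetY D d x 1 + (2%:R *: \row_k c2 k) *m jetY D d x 0.
  apply/rowP => i; rewrite [LHS]mxE [jetX _ _ _ _ _]mxE D1E add0r.
  rewrite [X in _ + X](sum0 c3 (e^~ _)) => [|w]; last first.
    rewrite (e_iter frame gen J 2 (jet_ax frame gen J w i) (jet_bx frame gen J w i)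
      (jet_ex frame gen J w i)).
    by rewrite mul0r.
  rewrite addr0 [RHS]mxE [X in _ = X + _]mxE; congr (_ + _ + _); rewrite [RHS]mxE;
    apply: eq_bigr => w _.
  - by rewrite (d_iter (jet_dD frame gen J)) !mxE.
  - rewrite (a_iter hD (jet_dD frame gen J) (jet_aD frame gen J)) ?(jet_ax frame gen J) //.
    by rewrite !mxE; ring.
  - rewrite (b_iter hD (jet_dD frame gen J) (jet_aD frame gen J) (jet_bD frame gen J)).
    + by rewrite !mxE /=; ring.
    + exact: (jet_ax frame gen J w i).
    + exact: (jet_bx frame gen J w i).
rewrite xE /jetW; apply: addmx_sub; [apply: addmx_sub|].
- exact: submx_trans (submxMl _ _) (addsmxSr _ _).
- exact: submx_trans (submxMl _ _) (submx_trans (addsmxSr _ _) (addsmxSl _ _)).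
- exact: submx_trans (submxMl _ _) (submx_trans (addsmxSl _ _) (addsmxSl _ _)).
Qed.

(** By [osc_relation] the coordinates [I] of D^2 x are algebraically independent. The derivations
    dual to them send D^2 x to independent vectors, all in W. *)
Lemma osculating_rank k (I : 'I_k -> 'I_r.+1) :
  free_coords (osculating_union 2 n X) I -> (k <= \rank (jetW D d x))%N.
Proof.
move=> Ifree; have [V VE] := exists_vector_field frame gen J.
pose z i := jetX D x 2 0 (I i).
have zind : alg_indep iota z.
  move=> p p0'; apply: Ifree => v vO.
  rewrite -[LHS](mmap_coord_subst idfun (v 0)).
  by apply: (osc_relation VE _ vO); rewrite mmap_coord_subst.
have [dl dlE] := choice (fun j : 'I_k => exists_derivation gen zind (fun i => (j == i)%:R)).
pose M := \matrix_j map_mx (dl j) (jetX D x 2).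
have MI : mxsub id I M = 1%:M.
  apply/matrixP => j i; rewrite [RHS]mxE [LHS]mxE [M _ _]mxE [LHS]mxE.
  exact: (dlE j).2.
apply: leq_trans (_ : (k <= \rank M)%N) _.
  by apply: (@mxsub_rank _ _ _ _ id I); rewrite MI unitmx1.
apply: mxrankS; apply/row_subP => j; rewrite rowK.
by apply: der_jetX2; case: (dlE j).
Qed.

End OscRank.

(** * Secant varieties *)

(* A kernel vector of minimal support with an entry 1 is constant: its
   derivative is a kernel vector of smaller support. *)
Lemma stable_kernel (K : comNzRingType) (E : fieldType) (iota : {rmorphism K -> E})
    (D : E -> E) (q s : nat) (A : 'M[E]_(q, s)) :
    derivation iota D -> (map_mx D A <= A)%MS -> (\rank A < s)%N ->
  exists H : 'cV[E]_s, [/\ H != 0, A *m H = 0 & map_mx D H = 0].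
Proof.
move=> hD sA rA; pose supp (H : 'cV[E]_s) := #|[set j | H j 0 != 0]|.
pose P k := `[< exists H : 'cV[E]_s, [/\ H != 0, A *m H = 0 & supp H = k] >].
have exP : exists k, P k.
  have /rowV0Pn [h hk h0] : kermx A^T != 0.
    by rewrite -mxrank_eq0 mxrank_ker mxrank_tr -lt0n subn_gt0.
  exists (supp h^T); apply/asboolP; exists h^T; split=> //.
    by rewrite trmx_eq0.
  by apply: (can_inj (@trmxK _ _ _)); rewrite trmx_mul trmxK trmx0; apply/sub_kermxP.
case: (ex_minnP exP) => k /asboolP [H [H0 AH Hk]] kmin.
have /matrix0Pn [j [z Hj]] := H0; rewrite [z]ord1 in Hj.
pose G := (H j 0)^-1 *: H.
have AG : A *m G = 0 by rewrite -scalemxAr AH scaler0.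
have Gj : G j 0 = 1 by rewrite mxE mulVf.
exists G; split=> //.
  by apply/eqP => G0; move: Gj; rewrite G0 mxE => /eqP; rewrite eq_sym oner_eq0.
have ADG : A *m map_mx D G = 0.
  have := congr1 (map_mx D) AG; rewrite (map_derM hD) (map_der0 hD).
  by have /submxP [C ->] := sA; rewrite -mulmxA AG mulmx0 add0r.
apply/eqP/negP => /negP DG0.
have : (k <= supp (map_mx D G))%N by apply: kmin; apply/asboolP; exists (map_mx D G).
rewrite -Hk leqNgt => /negP; apply; apply/proper_card/properP; split.
  apply/fintype.subsetP => l; rewrite !inE; apply: contraNneq => Hl.
  by rewrite !mxE Hl mulr0 (derD_0 hD).
by exists j; rewrite !inE // mxE Gj (derD_1 hD) eqxx.
Qed.

Section DenseProducts.
Variable K : numFieldType.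

Definition dense N (S : ('I_N -> K) -> Prop) : Prop := forall p, vanish_on S p -> p = 0.

Lemma dense_prod N1 N2 (S1 : ('I_N1 -> K) -> Prop) (S2 : ('I_N2 -> K) -> Prop) :
  dense S1 -> dense S2 -> dense (prod_set S1 S2).
Proof.
move=> d1 d2 p p0; apply: mpoly_eq0_eval => w.
have [s [G [H GH]]] := separate_variables p.
pose P v2 := \sum_i (H i).@[v2] *: G i; pose Q v1 := \sum_i (G i).@[v1] *: H i.
have PE v1 v2 : (P v2).@[v1] = p.@[vjoin v1 v2].
  rewrite [RHS](GH K idfun) raddf_sum; apply: eq_bigr => i _ /=.
  by rewrite mevalZ mulrC.
have QE v1 v2 : (Q v1).@[v2] = p.@[vjoin v1 v2].
  by rewrite [RHS](GH K idfun) raddf_sum; apply: eq_bigr => i _ /=; rewrite mevalZ.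
have P0 v2 : S2 v2 -> P v2 = 0.
  by move=> S2v; apply: d1 => v1 S1v; rewrite PE (prod_vanish_on p0).
have Q0 v1 : Q v1 = 0.
  by apply: d2 => v2 S2v; rewrite QE -PE P0 ?meval0.
by rewrite -(meval_eq _ (vjoin_eta w)) -QE Q0 meval0.
Qed.

End DenseProducts.

Section SeriesDerivation.
Variables (K : comNzRingType) (E : fieldType) (iota : {rmorphism K -> E}).

Definition fps_map (D : E -> E) (f : fps E) : fps E := fun n => D (f n).

Lemma fps_map_derivation D : derivation iota D ->
  derivation (@fps_const E \o iota) (fps_map D).
Proof.
move=> hD; split=> [f g|f g|c]; apply/funext => n.
- exact: derD_add hD _ _.
- rewrite coef_fpsD /fps_map !coef_fpsM (derD_sum hD) -big_split.
  by apply: eq_bigr => i _; rewrite /= (derD_mul hD).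
- rewrite coef_fps0 /fps_map; case: n => [|n]; first exact: derD_cst hD c.
  exact: derD_0 hD.
Qed.

Definition fps_monomial k (c : E) : fps E := fun n => if n == k then c else 0.

Lemma coef_fps_monomialM k c f n :
  (fps_monomial k c * f) n = if (k <= n)%N then c * f (n - k)%N else 0.
Proof.
rewrite coef_fpsM; case: leqP => [le|lt].
  rewrite (bigD1 (Ordinal (le : (k < n.+1)%N))) //= /fps_monomial eqxx big1 ?addr0 //.
  by move=> i; rewrite -val_eqE /= => /negbTE ->; rewrite mul0r.
rewrite big1 // => i _; rewrite /fps_monomial; case: eqP => [ik|]; last by rewrite mul0r.
by have := ltn_ord i; rewrite ik; lia.
Qed.

End SeriesDerivation.

(** * Independence of three points of a formal curve *)

Section TaylorTriple.
Variables (K : numFieldType) (E : fieldType) (iota : {rmorphism K -> E}) (m : nat).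
Variables (D : E -> E) (u : 'I_m -> E) (del : 'I_3 -> 'I_m -> E -> E).
Hypothesis hdel : forall k w, derivation iota (del k w).
Hypothesis del_u : forall (k : 'I_3) w l j, (l < 3)%N ->
  del k w (iter l D (u j)) = l`!%:R * (k == l :> nat)%:R * (w == j)%:R.
Variable tau : nat -> E -> fps E.
Hypothesis tauE : forall c e n, tau c e n = c%:R ^+ n * iter n D e / n`!%:R.

Let z : 'I_(m + (m + m)) -> fps E :=
  vjoin (fun j => tau 0 (u j)) (vjoin (fun j => tau 1 (u j)) (fun j => tau 2 (u j))).

Let nat_neq0 n : (0 < n)%N -> n%:R != 0 :> E.
Proof. by move=> n0; rewrite -(rmorph_nat iota) fmorph_eq0 pnatr_eq0 -lt0n. Qed.

Let del_tau k w c j :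
  fps_ord 3 (fps_map (del k w) (tau c (u j)) - fps_monomial k (c%:R ^+ k * (w == j)%:R)).
Proof.
move=> l l3; rewrite coef_fpsB /fps_map tauE.
have -> : c%:R ^+ l * iter l D (u j) / l`!%:R = iota (c%:R ^+ l / l`!%:R) * iter l D (u j).
  by rewrite rmorphM fmorphV rmorphXn !rmorph_nat mulrAC.
rewrite (derD_mul (hdel k w)) (derD_cst (hdel k w)) mul0r add0r del_u //.
rewrite /fps_monomial eq_sym; case: eqP => [<-|_]; last by rewrite !(mulr0, mul0r) subrr.
rewrite rmorphM fmorphV rmorphXn !rmorph_nat mulr1 mulrA divfK ?subrr //.
by rewrite nat_neq0 // fact_gt0.
Qed.

(** In the Jacobian criterion, the derivative of u(c t) along [del k] is (c t)^k modulo t^3. If the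
    coefficients of a linear dependence have order N, the relation for [k], divided by t^k, reads
    sum_c c^k b_c = 0 modulo t^(N+1); the Vandermonde matrix of 0, 1, 2 raises the order to N+1. *)
Lemma taylor_triple_indep : alg_indep (@fps_const E \o iota) z.
Proof.
apply: (@jacobian_alg_indep K (fps E) _ _ _ ('I_3 * 'I_m)%type
  (fun kw => fps_map (del kw.1 kw.2))) => [kw|b b0]; first exact: fps_map_derivation.
pose b_ c w := b (match c with 0%N => lshift _ w | 1%N => rshift m (lshift m w)
                  | _ => rshift m (rshift m w) end).
have rel k w : \sum_j b_ 0%N j * fps_map (del k w) (tau 0 (u j)) +
    (\sum_j b_ 1%N j * fps_map (del k w) (tau 1 (u j)) +
     \sum_j b_ 2%N j * fps_map (del k w) (tau 2 (u j))) = 0.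
  rewrite -[RHS](b0 (k, w)) !big_split_ord /=.
  congr (_ + (_ + _)); apply: eq_bigr => j _; by rewrite /z ?(vjoinr, vjoinl).
suff bN N c w : fps_ord N (b_ c w).
  move=> l; apply/funext => i; rewrite coef_fps0.
  case: (split_ordP l) => j ->; first exact: (bN i.+1 0%N j).
  by case: (split_ordP j) => j' ->; [apply: (bN i.+1 1%N j') | apply: (bN i.+1 2%N j')].
elim: N c w => // N IH c w.
have approx k v c' : fps_ord (N + 3)
    (\sum_j b_ c' j * fps_map (del k v) (tau c' (u j)) - fps_monomial k (c'%:R ^+ k) * b_ c' v).
  have -> : fps_monomial k (c'%:R ^+ k) * b_ c' v =
      \sum_j b_ c' j * fps_monomial k (c'%:R ^+ k * (v == j)%:R).
    rewrite (bigD1 v) //= eqxx mulr1 mulrC big1 ?addr0 // => j ne.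
    rewrite eq_sym (negbTE ne) mulr0; apply/funext => i; rewrite mulrC coef_fps_monomialM.
    by rewrite mul0r if_same coef_fps0.
  rewrite -sumrB; apply: fps_ord_sum => j _; rewrite -mulrBr.
  by apply: fps_ordM (IH c' j) (del_tau k v c' j).
(* [approx] is exact up to t^(N+3), and division by t^k with k <= 2 leaves precision N+1; for k = 0
   the convention 0^0 = 1 is the intended one. *)
have s k : (k < 3)%N -> fps_ord N.+1 (fps_const (0 ^+ k) * b_ 0%N w +
    (b_ 1%N w + fps_const (2%:R ^+ k) * b_ 2%N w)).
  move=> k3 i iN; pose k' : 'I_3 := Ordinal k3.
  have := fps_ordD (approx k' w 0%N) (fps_ordD (approx k' w 1%N) (approx k' w 2%N)).
  move: (rel k' w); set S0 := \sum_j _; set S1 := \sum_j _; set S2 := \sum_j _ => S0E.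
  have -> : S0 - fps_monomial k' (0%:R ^+ k') * b_ 0%N w + (S1 - fps_monomial k' (1%:R ^+ k') * b_ 1%N w +
    (S2 - fps_monomial k' (2%:R ^+ k') * b_ 2%N w)) =
    - (fps_monomial k' (0%:R ^+ k') * b_ 0%N w + (fps_monomial k' (1%:R ^+ k') * b_ 1%N w +
      fps_monomial k' (2%:R ^+ k') * b_ 2%N w)).
    rewrite -[RHS]add0r -S0E; ring.
  have lt : (i + k < N + 3)%N by lia.
  move=> /(_ _ lt); rewrite coef_fpsN !coef_fpsD !coef_fps_monomialM /= leq_addl addnK.
  by rewrite !coef_fpsCM expr1n mul1r => /eqP; rewrite oppr_eq0 => /eqP.
have b2 : fps_ord N.+1 (b_ 2%N w).
  move=> i iN; have := fps_ordD (s 2%N isT) (fps_ordN (s 1%N isT)) iN.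
  rewrite coef_fpsD coef_fpsN !coef_fpsD !coef_fpsCM expr0n expr1 /= !mul0r !add0r => e.
  apply: (mulfI (nat_neq0 (isT : (0 < 2)%N))); rewrite mulr0 -[RHS]e; ring.
have b1 : fps_ord N.+1 (b_ 1%N w).
  move=> i iN; have := s 1%N isT i iN.
  by rewrite !coef_fpsD !coef_fpsCM b2 // expr1 mul0r mulr0 add0r addr0.
have b0' : fps_ord N.+1 (b_ 0%N w).
  move=> i iN; have := s 0%N isT i iN.
  by rewrite !coef_fpsD !coef_fpsCM b2 // b1 // expr0 mul1r mulr0 !addr0.
by case: c => [|[|c]].
Qed.

End TaylorTriple.

Section Projections.
Variables (K : numFieldType) (N1 N2 : nat).
Variables (S1 : ('I_N1 -> K) -> Prop) (S2 : ('I_N2 -> K) -> Prop).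
Variables (B : comNzRingType) (iota : {rmorphism K -> B}) (xi : 'I_(N1 + N2) -> B).
Hypothesis gen : forall g, mmap iota xi g = 0 <-> vanish_on (prod_set S1 S2) g.

Lemma generic_projl : (exists v, S2 v) ->
  forall g, mmap iota (fun i => xi (lshift N2 i)) g = 0 <-> vanish_on S1 g.
Proof.
move=> [v2 S2v] g; pose G := mmap (@mpolyC (N1 + N2) K) (fun i => 'X_(lshift N2 i)) g.
have GE (C : comNzRingType) (j : {rmorphism K -> C}) y :
    mmap j y G = mmap j (fun i => y (lshift N2 i)) g.
  by rewrite mmap_comp; apply: eq_mmap => i; rewrite mmapX mmap1U.
rewrite -GE; split=> [/gen G0 v Sv|g0].
  rewrite -[RHS](prod_vanish_on G0 Sv S2v) [RHS]GE.
  by apply: eq_mmap => i; rewrite vjoinl.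
by apply/gen => v [Sv _]; rewrite [LHS]GE; apply: g0.
Qed.

Lemma generic_projr : (exists v, S1 v) ->
  forall g, mmap iota (fun i => xi (rshift N1 i)) g = 0 <-> vanish_on S2 g.
Proof.
move=> [v1 S1v] g; pose G := mmap (@mpolyC (N1 + N2) K) (fun i => 'X_(rshift N1 i)) g.
have GE (C : comNzRingType) (j : {rmorphism K -> C}) y :
    mmap j y G = mmap j (fun i => y (rshift N1 i)) g.
  by rewrite mmap_comp; apply: eq_mmap => i; rewrite mmapX mmap1U.
rewrite -GE; split=> [/gen G0 v Sv|g0].
  rewrite -[RHS](prod_vanish_on G0 S1v Sv) [RHS]GE.
  by apply: eq_mmap => i; rewrite vjoinr.
by apply/gen => v [_ Sv]; rewrite [LHS]GE; apply: g0.
Qed.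

End Projections.

(** * Terracini's lemma and the relation on X^3 *)

Section Secant.
Variables (K : numFieldType) (r n : nat) (X : set 'rV[K]_r.+1).
Hypotheses (X_closed : pclosed X) (X_irr : pirreducible X).
Variables (f : {mpoly K[r.+1]}) (L : 'M[K]_(r.+1, n.+1)).
Variables (Y : 'M[{mpoly K[r.+1]}]_(n.+1, r.+1)) (p0 : 'rV[K]_r.+1).
Hypotheses (frame : smooth_frame X f L Y) (Xp0 : X p0) (fp0 : f.@[p0 0] != 0).
Local Notation m := n.+1.
Local Notation R := r.+1.
Variable J : 'I_(m + (m + m)) -> 'I_R.
Hypothesis J_free : free_coords (secant_union 2 X) J.

Definition frame_coord (B : comNzRingType) (iota : {rmorphism K -> B}) (q : 'I_R -> B) (k : 'I_m) : B :=
  \sum_i q i * iota (L i k).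

Lemma frame_der (E : fieldType) (iota : {rmorphism K -> E}) q D : derivation iota D ->
    (forall g, mmap iota q g = 0 <-> vanish_on (points X) g) ->
  \row_i D (q i) = (mmap iota q f)^-1 *: ((\row_k D (frame_coord iota q k)) *m map_mx (mmap iota q) Y).
Proof.
move=> hD genq; have [_ span _ _] := frame.
have qX g : vanishing X g -> mmap iota q g = 0 by move=> gX; apply/genq/vanish_on_points.
have := span _ _ _ _ (derivation_tangent hD qX).
have -> : (\row_i D (q i)) *m map_mx iota L = \row_k D (frame_coord iota q k).
  apply/rowP => k; rewrite !mxE (derD_sum hD); apply: eq_bigr => i _.
  by rewrite !mxE (derD_mul hD) (derD_cst hD) mulr0 addr0.
move=> <-; rewrite scalerK //; apply/eqP => /genq.
by move/(f_nvanish Xp0 fp0).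
Qed.

(** Frames of the tangent spaces at three points, restricted to the columns [J], of which there are
    3(n+1), so that the matrix is square. *)
Definition sec_matrix (B : comNzRingType) (iota : {rmorphism K -> B}) (q0 q1 q2 : 'I_R -> B) :
    'M[B]_(m + (m + m)) :=
  let A q := \matrix_(w, j) mmap iota q (Y w (J j)) in
  col_mx (A q0) (col_mx (A q1) (A q2)).

Local Notation N3 := (R + (R + R))%N.

Definition sec_poly : {mpoly K[N3]} := \det (sec_matrix (@mpolyC N3 K)
  (fun i => 'X_(lshift (R + R) i)) (fun i => 'X_(rshift R (lshift R i)))
  (fun i => 'X_(rshift R (rshift R i)))).

Lemma mmap_sec_poly (B : comNzRingType) (iota : {rmorphism K -> B}) q0 q1 q2 :
  mmap iota (vjoin q0 (vjoin q1 q2)) sec_poly = \det (sec_matrix iota q0 q1 q2).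
Proof.
rewrite -det_map_mx /sec_matrix !map_col_mx.
by congr (\det (col_mx _ (col_mx _ _))); apply/matrixP => w j; rewrite !mxE /= mmap_comp;
  apply: eq_mmap => i; rewrite mmapX mmap1U ?(vjoinr, vjoinl).
Qed.

Definition X3 : ('I_N3 -> K) -> Prop := prod_set (points X) (prod_set (points X) (points X)).

Lemma X3_vjoin x y w : X x -> X y -> X w -> X3 (vjoin (x 0) (vjoin (y 0) (w 0))).
Proof.
have pX v : X v -> points X (v 0).
  by move=> Xv; rewrite /points (_ : \row_i _ = v) //; apply/rowP => i; rewrite mxE.
move=> /pX Xx /pX Xy /pX Xw; split; last split.
- by rewrite (_ : (fun _ => _) = x 0) //; apply/funext => a; rewrite vjoinl.
- by rewrite (_ : (fun _ => _) = y 0) //; apply/funext => a; rewrite vjoinr vjoinl.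
- by rewrite (_ : (fun _ => _) = w 0) //; apply/funext => a; rewrite !vjoinr.
Qed.

(** As X is a cone, a combination of three of its points with nonzero coefficients c_i is a sum of
    three points of X. Vanishing coefficients are avoided by taking c_i + s: the value of [p] is
    polynomial in s and vanishes for all but finitely many s, hence for s = 0. *)
Lemma secant_sum_free (p : {mpoly K[m + (m + m)]}) :
  (forall x y w, X x -> X y -> X w -> p.@[fun j => x 0 (J j) + (y 0 (J j) + w 0 (J j))] = 0) ->
  p = 0.
Proof.
move=> p_0; apply: J_free => v [_ [P [PX _ /submxP [c ->]]]].
pose Q := mmap (@polyC K) (fun j => \sum_i ((c 0 i)%:P + 'X) * (P i (J j))%:P) p.
have QE s : Q.[s] = p.@[fun j => \sum_i (c 0 i + s) * P i (J j)].
  apply: (rmorph_mmap_comp (f := horner_eval s)) => [k|j] /=.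
    by rewrite /horner_eval hornerC.
  rewrite /horner_eval horner_sum; apply: eq_bigr => i _.
  by rewrite hornerM hornerD !hornerC hornerX.
pose Pi : {poly K} := \prod_i ((c 0 i)%:P + 'X).
have Pi0 : Pi != 0.
  apply/prodf_neq0 => i _; apply/eqP => /(congr1 (fun q : {poly K} => q`_1)).
  by rewrite coefD coefC coefX coef0 add0r => /eqP; rewrite oner_eq0.
have : Q * Pi = 0.
  apply: poly_eq0_natr => k; rewrite hornerM QE horner_prod; set s := _%:R.
  have [->|] := eqVneq (\prod_i ((c 0 i)%:P + 'X).[s]) 0; first by rewrite mulr0.
  move=> /prodf_neq0 ne; apply/eqP; rewrite mulf_eq0; apply/orP; left; apply/eqP.
  have XP i : X ((c 0 i + s) *: row i P).
    apply: pclosed_cone => //; have := ne i isT.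
    by rewrite hornerD hornerC hornerX.
  rewrite -[RHS](p_0 _ _ _ (XP 0) (XP 1) (XP 2%:R)); apply: meval_eq => j.
  rewrite !big_ord_recl big_ord0 addr0 !mxE.
  by congr (_ + (_ + _)); congr ((c _ _ + _) * P _ _); apply/val_inj.
move=> /eqP; rewrite mulf_eq0 (negbTE Pi0) orbF => /eqP Q0.
have := QE 0; rewrite Q0 horner0 => e; rewrite [RHS]e; apply: meval_eq => j.
by rewrite mxE; apply: eq_bigr => i _; rewrite addr0.
Qed.

Lemma points_ex : exists v, points X v.
Proof. by exists (p0 0); rewrite /points (_ : \row_i _ = p0) //; apply/rowP => i; rewrite mxE. Qed.

Definition coord_triple (B : comNzRingType) (iota : {rmorphism K -> B}) (q0 q1 q2 : 'I_R -> B) :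
    'I_(m + (m + m)) -> B :=
  vjoin (frame_coord iota q0) (vjoin (frame_coord iota q1) (frame_coord iota q2)).

Definition coord_poly : 'I_(m + (m + m)) -> {mpoly K[N3]} := coord_triple (@mpolyC N3 K)
  (fun i => 'X_(lshift (R + R) i)) (fun i => 'X_(rshift R (lshift R i)))
  (fun i => 'X_(rshift R (rshift R i))).

Lemma mmap_coord_poly (B : comNzRingType) (iota : {rmorphism K -> B}) q0 q1 q2 p :
  mmap iota (vjoin q0 (vjoin q1 q2)) (mmap (@mpolyC N3 K) coord_poly p) =
  mmap iota (coord_triple iota q0 q1 q2) p.
Proof.
have fcE (v : 'I_R -> 'I_N3) k : mmap iota (vjoin q0 (vjoin q1 q2))
    (frame_coord (@mpolyC N3 K) (fun i => 'X_(v i)) k) =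
    frame_coord iota (fun i => vjoin q0 (vjoin q1 q2) (v i)) k.
  rewrite /frame_coord raddf_sum; apply: eq_bigr => i _.
  by rewrite /= (rmorphM (mmap _ _)) /= mmapC mmapX mmap1U.
rewrite mmap_comp; apply: eq_mmap => k; rewrite /coord_poly /coord_triple.
case: (split_ordP k) => l ->; rewrite ?(vjoinl, vjoinr) ?fcE.
  by apply: eq_bigr => i _; rewrite ?(vjoinl, vjoinr).
by case: (split_ordP l) => l' ->; rewrite ?(vjoinl, vjoinr) ?fcE;
  apply: eq_bigr => i _; rewrite ?(vjoinl, vjoinr).
Qed.

Section GenericTriple.
Variables (E : fieldType) (iota : {rmorphism K -> E}) (xi : 'I_N3 -> E).
Hypothesis gen : generic_point X3 iota xi.
Let q0 i := xi (lshift (R + R) i).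
Let q1 i := xi (rshift R (lshift R i)).
Let q2 i := xi (rshift R (rshift R i)).

Let XX_ex : exists v, prod_set (points X) (points X) v.
Proof. exact: (aprime_prod (pirreducible_aprime X_closed X_irr) (pirreducible_aprime X_closed X_irr)).1. Qed.

Let gen0 g : mmap iota q0 g = 0 <-> vanish_on (points X) g.
Proof. exact: generic_projl gen.1 XX_ex g. Qed.
Let gen1 g : mmap iota q1 g = 0 <-> vanish_on (points X) g.
Proof. exact: generic_projl (generic_projr gen.1 points_ex) points_ex g. Qed.
Let gen2 g : mmap iota q2 g = 0 <-> vanish_on (points X) g.
Proof. exact: generic_projr (generic_projr gen.1 points_ex) points_ex g. Qed.

Let xiE : vjoin q0 (vjoin q1 q2) =1 xi.
Proof.
move=> i; case: (split_ordP i) => j ->; rewrite ?(vjoinl, vjoinr) //.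
by case: (split_ordP j) => l ->; rewrite ?(vjoinl, vjoinr).
Qed.

(** Terracini's lemma: the derivations dual to the independent coordinates [J] of q0 + q1 + q2,
    expressed in the frames at the three points, form a left inverse of [sec_matrix]. *)
Lemma sec_det_neq0 : \det (sec_matrix iota q0 q1 q2) != 0.
Proof.
pose z j := q0 (J j) + (q1 (J j) + q2 (J j)).
have zind : alg_indep iota z.
  move=> p pz; apply: secant_sum_free => x y w Xx Xy Xw.
  pose G := mmap (@mpolyC N3 K) (fun j => 'X_(lshift (R + R) (J j)) +
    ('X_(rshift R (lshift R (J j))) + 'X_(rshift R (rshift R (J j))))) p.
  have GE (C : comNzRingType) (j : {rmorphism K -> C}) (a b c : 'I_R -> C) :
      mmap j (vjoin a (vjoin b c)) G = mmap j (fun i => a (J i) + (b (J i) + c (J i))) p.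
    rewrite mmap_comp; apply: eq_mmap => i; rewrite !mmapD !mmapX !mmap1U.
    by rewrite ?(vjoinr, vjoinl).
  have /gen.1 G0 : mmap iota xi G = 0 by rewrite -(eq_mmap _ _ xiE) GE.
  by rewrite -[RHS](G0 _ (X3_vjoin Xx Xy Xw)) [RHS]GE.
have [dl dlE] := choice (fun j => exists_derivation gen zind (fun i => (j == i)%:R)).
pose C q := \matrix_j ((mmap iota q f)^-1 *: (\row_k dl j (frame_coord iota q k))).
have CE q : (forall g, mmap iota q g = 0 <-> vanish_on (points X) g) ->
    \matrix_(j, i) dl j (q (J i)) = C q *m \matrix_(w, i) mmap iota q (Y w (J i)).
  move=> genq; apply/matrixP => j i; have /rowP/(_ (J i)) := frame_der (dlE j).1 genq.
  rewrite scalemxAl !mxE => ->; apply: eq_bigr => w _.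
  by rewrite /C !mxE.
have CI : row_mx (C q0) (row_mx (C q1) (C q2)) *m sec_matrix iota q0 q1 q2 = 1%:M.
  rewrite /sec_matrix !mul_row_col -!CE //; apply/matrixP => j i; rewrite !mxE.
  have [hdl dlz] := dlE j; rewrite -dlz /z !(derD_add hdl); ring.
by apply: contra_eqN (congr1 determinant CI) => /eqP d0; rewrite det_mulmx d0 mulr0 det1 eq_sym oner_eq0.
Qed.

Lemma frame_coord_indep : alg_indep iota (coord_triple iota q0 q1 q2).
Proof.
pose S (c : 'I_m -> K) := exists2 v, X v & c = frame_coord idfun (v 0).
have Sd : dense S.
  have [_ _ _ Lfree] := frame; move=> p pS; apply: Lfree => v Xv.
  rewrite -[RHS](pS _ (ex_intro2 _ _ v Xv erefl)); apply: meval_eq => k.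
  by rewrite mxE.
move=> p; rewrite -mmap_coord_poly (eq_mmap _ _ xiE) => /gen.1 pz.
apply: (dense_prod Sd (dense_prod Sd Sd)) => v [[x Xx xE] [[y Xy yE] [w Xw wE]]].
rewrite -[RHS](pz _ (X3_vjoin Xx Xy Xw)) [RHS]mmap_coord_poly; apply: eq_mmap => k.
rewrite /coord_triple -xE -yE -wE; case: (split_ordP k) => l ->; rewrite ?(vjoinl, vjoinr) //.
by case: (split_ordP l) => l' ->; rewrite ?(vjoinl, vjoinr).
Qed.

Lemma frame_coord_der_eq0 D : derivation iota D ->
  (forall k, D (coord_triple iota q0 q1 q2 k) = 0) -> forall i, D (xi i) = 0.
Proof.
move=> hD D0.
have q_eq0 q : (forall g, mmap iota q g = 0 <-> vanish_on (points X) g) ->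
    (forall k, D (frame_coord iota q k) = 0) -> forall i, D (q i) = 0.
  move=> genq Dq i; have := frame_der hD genq.
  have -> : \row_k D (frame_coord iota q k) = 0 by apply/rowP => k; rewrite !mxE.
  by rewrite mul0mx scaler0 => /rowP/(_ i); rewrite !mxE.
move=> i; case: (split_ordP i) => j ->; last case: (split_ordP j) => l ->.
- apply: (q_eq0 _ gen0) => k; have := D0 (lshift _ k).
  by rewrite /coord_triple vjoinl.
- apply: (q_eq0 _ gen1) => k; have := D0 (rshift m (lshift m k)).
  by rewrite /coord_triple vjoinr vjoinl.
- apply: (q_eq0 _ gen2) => k; have := D0 (rshift m (rshift m k)).
  by rewrite /coord_triple !vjoinr.
Qed.

End GenericTriple.

(** The determinant is algebraic over the etale coordinates of the three points; [a] is the nonzero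
    constant coefficient of its relation, and vanishes wherever the determinant does.
    [prod_vanish_algebra] carries the relation to points with values in [B]. *)
Lemma secant_relation : exists2 a : {mpoly K[m + (m + m)]}, a != 0 &
  forall (B : comNzRingType) (iota : {rmorphism K -> B}) (q0 q1 q2 : 'I_R -> B),
    (forall g, vanishing X g ->
       [/\ mmap iota q0 g = 0, mmap iota q1 g = 0 & mmap iota q2 g = 0]) ->
    \det (sec_matrix iota q0 q1 q2) = 0 -> mmap iota (coord_triple iota q0 q1 q2) a = 0.
Proof.
have pr := pirreducible_aprime X_closed X_irr.
have [E [iota [xi gen]]] := exists_generic_point (aprime_prod pr (aprime_prod pr pr)).
set q0 := fun i => xi (lshift (R + R) i).
set q1 := fun i => xi (rshift R (lshift R i)).
set q2 := fun i => xi (rshift R (rshift R i)).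
have d0 := sec_det_neq0 gen; have zind := frame_coord_indep gen.
have xiE : vjoin q0 (vjoin q1 q2) =1 xi.
  move=> i; case: (split_ordP i) => j ->; rewrite ?(vjoinl, vjoinr) //.
  by case: (split_ordP j) => l ->; rewrite ?(vjoinl, vjoinr).
have dE : \det (sec_matrix iota q0 q1 q2) = mmap iota xi sec_poly.
  by rewrite -mmap_sec_poly (eq_mmap _ _ xiE).
have [|d [a [a0 rel]]] := algebraic_relation gen zind d0.
  move=> D hD Dz; rewrite -/q0 -/q1 -/q2 dE (derD_mmap hD).
  by rewrite big1 // => i _; rewrite (frame_coord_der_eq0 gen hD Dz) mulr0.
exists (a ord0) => // B jo p0' p1 p2 pX det0.
pose F := \sum_i mmap (@mpolyC N3 K) coord_poly (a i) * sec_poly ^+ i.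
have FE (C : comNzRingType) (j : {rmorphism K -> C}) (x y w : 'I_R -> C) :
  mmap j (vjoin x (vjoin y w)) F = \sum_i mmap j (coord_triple j x y w) (a i) *
    \det (sec_matrix j x y w) ^+ i.
  rewrite raddf_sum; apply: eq_bigr => i _.
  by rewrite /= (rmorphM (mmap _ _)) /= mmap_coord_poly (rmorphXn (mmap _ _)) /= mmap_sec_poly.
have F0 : vanish_on X3 F by apply/gen.1; rewrite -(eq_mmap _ _ xiE) FE.
have pX' x : (forall g, vanishing X g -> mmap jo x g = 0) -> 
    forall g, vanish_on (points X) g -> mmap jo x g = 0.
  by move=> xX g /vanish_on_points; apply: xX.
have := prod_vanish_algebra (pX' p0' (fun g gX => let: And3 e _ _ := pX g gX in e))
  (prod_vanish_algebra (pX' p1 (fun g gX => let: And3 _ e _ := pX g gX in e))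
    (pX' p2 (fun g gX => let: And3 _ _ e := pX g gX in e))) F0.
rewrite FE det0 big_ord_recl expr0 mulr1 big1 ?addr0 // => i _.
by rewrite expr0n mulr0.
Qed.

End Secant.

(** Multiplication by the adjugate gives det(M) v = 0, and power series form a domain. *)
Lemma fps_det_eq0 (F : fieldType) s (M : 'M[fps F]_s) (v : 'cV[fps F]_s) :
  v != 0 -> M *m v = 0 -> \det M = 0.
Proof.
move=> /matrix0Pn [j [z vj]] Mv; have := congr1 (fun u => (\adj M *m u) j z) Mv.
rewrite mulmxA mul_adj_mx mulmx0 mul_scalar_mx !mxE => /fps_mul_eq0 [//|v0].
by rewrite v0 eqxx in vj.
Qed.

(** * The formal curve with tangent spaces in a hyperplane *)

Section SecantContradiction.
Variables (K : numFieldType) (r n : nat) (X : set 'rV[K]_r.+1).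
Hypotheses (X_closed : pclosed X) (X_irr : pirreducible X) (X_chain : has_chain X n).
Hypothesis sqrt_exists : forall x : K, exists y, y ^+ 2 = x.
Hypothesis r_ge : (3 * n + 2 <= r)%N.
Hypothesis X_special : forall (k : 'I_r.+1) (gamma : 'rV[{poly K}]_r.+1),
  curvilinear3 (affine_piece X k) gamma -> smooth_locus n X (jet_point gamma) ->
  special_along n X k gamma.
Local Notation m := n.+1.

Lemma secant_coords_not_free p0 (I : 'I_(3 * n + 1) -> 'I_r.+1)
    (J : 'I_(m + (m + m)) -> 'I_r.+1) :
  (0 < n)%N -> smooth_locus n X p0 -> free_coords (osculating_union 2 n X) I ->
  ~ free_coords (secant_union 2 X) J.
Proof.
move=> n0 sm Ifree Jfree; have [Xp0 _] := sm.
have [f [L [Y [fp0 frame]]]] := exists_smooth_frame X_closed X_irr X_chain sm.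
have [E [iota [xi gen]]] := exists_generic_point (jet_set_prime n X_closed X_irr Xp0 fp0).
have [D [d [a [b [e JD]]]]] := exists_jet_derivations X_closed X_irr frame Xp0 fp0 gen.
have [V VE] := exists_vector_field frame gen JD.
pose x := genx xi.
have char0 k : k.+1%:R != 0 :> E by rewrite -(rmorph_nat iota) fmorph_eq0 pnatr_eq0.
have rkW : (3 * n + 1 <= \rank (jetW D d x))%N.
  exact: (osculating_rank X_closed X_irr X_chain sqrt_exists frame Xp0 fp0 gen JD Ifree).
have rkT5 := jet_span_rank X_closed frame fp0 gen JD VE r_ge X_special n0.
pose T := (jetW D d x + jetX D x 4)%MS.
have rkT : (\rank T <= 3 * n + 2)%N by apply: leq_trans rkT5; apply/mxrankS/addsmxSl.
have [|rho] := jet_span_invariant char0 (jet_D JD) (jet_d JD) (jet_a JD) (jet_b JD)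
  (jet_dD frame gen JD) (jet_dd frame gen JD) (jet_aD frame gen JD) (jet_bD frame gen JD)
  (jet_ad frame gen JD) (jet_bd frame gen JD) (jet_ax frame gen JD) (jet_bx frame gen JD).
  by apply: leq_trans rkT5 _; move: rkW; rewrite /x; lia.
set D' := fun z => _; rewrite -/x -/T /= => stT.
have hD' : derivation iota D' := derivation_lincomb rho (jet_D JD) (jet_b JD).
(* T has rank at most 3n+2; once restricted to the 3n+3 columns [J], it has a nonzero kernel
   vector. *)
pose TJ := colsub J T.
have mulJ q (C : 'M_(q, r.+1)) : C *m TJ = colsub J (C *m T).
  by apply/matrixP => i j; rewrite !mxE; apply: eq_bigr => k _; rewrite mxE.
have rkTJ : (\rank TJ < m + (m + m))%N.
  apply: (@leq_ltn_trans (\rank T)); last by move: rkT; lia.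
  have -> : TJ = T *m colsub J 1%:M.
    rewrite /TJ -{1}[T]mulmx1; apply/matrixP => i j; rewrite !mxE.
    by apply: eq_bigr => k _; rewrite !mxE.
  exact: mxrankM_maxl.
have stTJ : (map_mx D' TJ <= TJ)%MS.
  have /submxP [C CE] := stT; apply/submxP; exists C.
  by rewrite mulJ -CE map_mxsub.
(* [H] is the hyperplane of the coordinate space [J], constant along [D']. *)
have [H [H0 TH DH]] := stable_kernel hD' stTJ rkTJ.
(* [tau c] is exp(c t D'); it fixes the constants of [D'], and the points [q c] for c = 0, 1, 2 are
   those of the formal curve at 0, t and 2t. *)
have tau_ex c : exists tau : {rmorphism E -> fps E},
    forall z k, tau z k = c%:R ^+ k * iter k D' z / k`!%:R.
  pose Dc z := c%:R * D' z.
  have [] := @taylor_rmorphism E E idfun char0 Dc.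
  - by move=> y z; rewrite /Dc (derD_add hD') mulrDr.
  - by move=> y z; rewrite /Dc (derD_mul hD'); ring.
  move=> tau tauE; exists tau => z k; rewrite tauE /taylor_series; congr (_ / _).
  elim: k => [|k IH] /=; first by rewrite mul1r.
  rewrite /= in IH; rewrite IH /Dc (derD_mul hD') -natrX (derD_natr hD') mul0r add0r.
  by rewrite natrX exprS mulrA.
have [tau tauE] := choice tau_ex.
have tau_cst c z : D' z = 0 -> tau c z = fps_const z.
  move=> Dz; apply/funext => k; rewrite tauE; case: k => [|k].
    by rewrite expr0 mul1r divr1.
  rewrite iterSr Dz (_ : iter k D' 0 = 0) ?mulr0 ?mul0r //.
  by elim: k => //= k ->; apply: derD_0 hD'.
pose io : {rmorphism K -> fps E} := @fps_const E \o iota.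
pose q c i := tau c (xi (jx n i)).
have qE c g : mmap io (q c) g = tau c (mmap iota (fun i => xi (jx n i)) g).
  symmetry; apply: (rmorph_mmap_comp (f := tau c)) => // k.
  by rewrite /= tau_cst // (derD_cst hD').
have qX g : vanishing X g ->
    [/\ mmap io (q 0%N) g = 0, mmap io (q 1%N) g = 0 & mmap io (q 2%N) g = 0].
  by move=> gX; rewrite !qE (gen_vanishing gen gX) !rmorph0.
have YH w : \sum_j mmap iota (fun i => xi (jx n i)) (Y w (J j)) * H j 0 = 0.
  have Y0T : (jetY D d x 0 <= T)%MS.
    by rewrite /T /jetW -!addsmxA addsmxSl.
  have /submxP [C CE] := Y0T.
  have /matrixP/(_ w 0) : colsub J (jetY D d x 0) *m H = 0.
    by rewrite CE -mulJ -mulmxA TH mulmx0.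
  rewrite [RHS]mxE mxE => e0; apply: (mulfI (_ : xi (js r n) != 0)).
    apply/eqP => s0; have := gen_sf gen; rewrite s0 mul0r => /eqP.
    by rewrite eq_sym oner_eq0.
  rewrite mulr0 -[RHS]e0 mulr_sumr; apply: eq_bigr => j _.
  have /rowP/(_ (J j)) := jet_dx frame gen JD w.
  by rewrite !mxE /= => ->; rewrite mulrA.
have det0 : \det (sec_matrix Y J io (q 0%N) (q 1%N) (q 2%N)) = 0.
  apply: (@fps_det_eq0 _ _ _ (map_mx (@fps_const E) H)).
    apply: contraNneq H0 => H0; apply/eqP/matrixP => i k.
    have /matrixP/(_ i k) := H0; rewrite !mxE => /(congr1 (fun g : fps E => g 0%N)).
    by [].
  have rowH c : (\matrix_(w, j) mmap io (q c) (Y w (J j))) *m map_mx (@fps_const E) H = 0.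
    apply/matrixP => w z; rewrite [z]ord1 [RHS]mxE mxE.
    rewrite -[RHS](rmorph0 (tau c)) -(YH w) rmorph_sum; apply: eq_bigr => j _.
    rewrite /= !mxE qE rmorphM; congr (_ * _); rewrite /= tau_cst //.
    by have /matrixP/(_ j 0) := DH; rewrite !mxE.
  by rewrite /sec_matrix !mul_col_mx !rowH !col_mx0.
have [al al0 alE] := secant_relation X_closed X_irr frame Xp0 fp0 Jfree.
have {}alE := alE _ _ _ _ _ qX det0; move/eqP: al0; apply.
pose u j := u0 L iota xi j.
(* The [b] kill u0 and u1, so that D' u0 = u1 and D' u1 = 2 u2 as for [D]. *)
have DD z : (forall w, b w z = 0) -> D' z = D z.
  by move=> bz; rewrite /D' big1 ?addr0 // => w _; rewrite bz mulr0.
have [D0 D1 _ _] := jet_Du JD.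
have D'u j : D' (u j) = xi (jc1 r j) by rewrite DD ?D0 // => w; case: (jet_bu JD w).
have D'u1 j : D' (xi (jc1 r j)) = 2%:R * xi (jc2 r j).
  by rewrite DD ?D1 // => w; case: (jet_bu JD w).
pose del (k : 'I_3) := match val k with 0%N => d | 1%N => a | _ => b end.
have hdel k w : derivation iota (del k w).
  by case: k => -[|[|[|//]]] i3; [apply: (jet_d JD w)|apply: (jet_a JD w)|apply: (jet_b JD w)].
have del_u (k : 'I_3) w l j : (l < 3)%N ->
    del k w (iter l D' (u j)) = l`!%:R * (k == l :> nat)%:R * (w == j)%:R.
  have [d0 d1 d2 _] := jet_du JD w; have [a0 a1 a2 _] := jet_au JD w.
  have [b0 b1 b2 _] := jet_bu JD w.
  have two (F : E -> E) y : derivation iota F -> F (2%:R * y) = 2%:R * F y.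
    by move=> hF; rewrite (derD_mul hF) (derD_natr hF) mul0r add0r.
  case: l => [|[|[|//]]] _ /=; rewrite ?D'u ?D'u1; case: k => -[|[|[|//]]] i3; rewrite /del /=;
    rewrite ?(two _ _ (jet_d JD w)) ?(two _ _ (jet_a JD w)) ?(two _ _ (jet_b JD w));
    by rewrite ?(d0, d1, d2, a0, a1, a2, b0, b1, b2) ?mulr0 ?mul0r ?mul1r ?mulr1.
apply: (taylor_triple_indep hdel del_u tauE); rewrite -[RHS]alE; apply: eq_mmap => k.
have fcE c j : frame_coord L io (q c) j = tau c (u j).
  rewrite /u /u0 mxE rmorph_sum; apply: eq_bigr => i _.
  by rewrite rmorphM !mxE /= [tau c (iota _)]tau_cst // (derD_cst hD').
rewrite /coord_triple; case: (split_ordP k) => l ->; rewrite ?(vjoinl, vjoinr) ?fcE //.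
by case: (split_ordP l) => l' ->; rewrite ?(vjoinl, vjoinr) ?fcE.
Qed.

End SecantContradiction.

(** * Defectivity of X *)

Section Defect.
Variables (K : numFieldType) (r : nat).
Implicit Types S X : set 'rV[K]_r.+1.

Lemma free_coords_pclosure S k (J : 'I_k -> 'I_r.+1) :
  cone S -> free_coords (pclosure S) J -> free_coords S J.
Proof.
move=> Sc Jfree p p0; apply: Jfree => v Sv.
rewrite -[LHS](mmap_coord_subst idfun (v 0)); apply: (vanishing_pclosure Sc) Sv.
by move=> u Su; rewrite [LHS](mmap_coord_subst idfun (u 0)); apply: p0.
Qed.

Lemma secant_union_cone k X : cone (secant_union k X).
Proof.
move=> v t [v0 [P [PX Pfree vP]]] t0; split; first by rewrite scaler_eq0 negb_or t0.
by exists P; split=> //; apply: scalemx_sub.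
Qed.

Lemma osculating_union_cone k n X : cone (osculating_union k n X).
Proof.
move=> v t [C [i [p [Csm CX Cp dimO [v0 vO]]]]] t0.
exists C, i, p; split=> //; split; first by rewrite scaler_eq0 negb_or t0.
move=> h hO; have := vO h hO; rewrite !meval_linform => e.
rewrite -[RHS](mulr0 t) -[X in t * X]e mulr_sumr; apply: eq_bigr => k' _.
by rewrite mxE mulrCA.
Qed.

Lemma has_chain_sub X S d : (X `<=` S)%classic -> has_chain X d -> has_chain S d.
Proof.
move=> sub [Z [Zp Zi]]; exists Z; split=> // i le.
by have [? ? ZX] := Zp i le; split=> //; apply: subset_trans sub.
Qed.

Lemma pclosure_min S X : pclosed X -> (S `<=` X)%classic -> (pclosure S `<=` X)%classic.
Proof.
move=> Xc sub v [v0 Sv]; rewrite -Xc; split=> // g d gd gX.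
by apply: Sv gd _ => u /sub; apply: gX.
Qed.

(** An osculating space belongs to a curve contained in X, and the closure of this curve gives X a
    chain of length 1. *)
Lemma osculating_dim_gt0 n X : pclosed X -> has_dim X n ->
  (osculating_union 2 n X !=set0)%classic -> (0 < n)%N.
Proof.
case: n => // Xc [_ nX1] [v [C [i [p [[_ _ [C1 _] _] CX _ _ _]]]]].
exfalso; apply: nX1; apply: has_chain_sub C1; apply: pclosure_min => // u /CX.
by case.
Qed.

(** A nonzero column of [cokermx M] is a hyperplane through the rows of [M]; by nondegeneracy some
    point of X lies off it. *)
Lemma nondegenerate_extend X q (M : 'M[K]_(q, r.+1)) : pnondegenerate X ->
    (forall v, X v -> v != 0) -> row_free M -> (q < r.+1)%N ->
  exists2 x, X x & row_free (col_mx M x).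
Proof.
move=> nd Xnz Mfree qr.
have [j cj] : exists j, col j (cokermx M) != 0.
  apply: contrapT => nj; have : cokermx M == 0.
    apply/eqP/matrixP => i j; have [/colP/(_ i)|ne] := eqVneq (col j (cokermx M)) 0.
      by rewrite !mxE.
    by case: nj; exists j.
  rewrite -mxrank_eq0 mxrank_coker (eqP Mfree) subn_eq0.
  by rewrite leqNgt qr.
have h0 : (col j (cokermx M))^T != 0 by rewrite trmx_eq0.
have [x Xx xh] : exists2 x, X x & (linform (col j (cokermx M))^T).@[x 0] != 0.
  apply: contrapT => nx; apply: (nd _ h0) => x Xx; split; first exact: Xnz.
  by apply/eqP/negP => /negP xh; apply: nx; exists x.
exists x => //; have xM : ~~ (x <= M)%MS.
  apply: contra xh; rewrite submxE => /eqP/rowP/(_ j); rewrite [RHS]mxE mxE => e.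
  rewrite meval_linform -[X in _ == X]e; apply/eqP/eq_bigr => k _.
  by rewrite !mxE mulrC.
have lt : (\rank M < \rank (col_mx M x))%N.
  rewrite -addsmxE; have : (M < M + x)%MS by rewrite /ltmx addsmxSl addsmx_sub submx_refl.
  by rewrite ltmxErank => /andP [].
rewrite /row_free eqn_leq rank_leq_row /=; move: lt; rewrite (eqP Mfree).
by move=> lt; apply: leq_trans lt; rewrite addn1.
Qed.

Lemma sub_secant_union X : pnondegenerate X -> (forall v, X v -> v != 0) -> (2 <= r)%N ->
  (X `<=` secant_union 2 X)%classic.
Proof.
move=> nd Xnz r2 p Xp; split; first exact: Xnz.
have pfree : row_free p by rewrite /row_free rank_rV Xnz.
have [|x Xx xfree] := nondegenerate_extend nd Xnz pfree; first by lia.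
have [|y Xy yfree] := nondegenerate_extend nd Xnz xfree; first by lia.
have rows (i : 'I_(1 + 1 + 1)) : X (row i (col_mx (col_mx p x) y)).
  case: (split_ordP i) => j ->; last by rewrite rowKd [j]ord1 row_id.
  rewrite rowKu; case: (split_ordP j) => l ->.
    by rewrite rowKu [l]ord1 row_id.
  by rewrite rowKd [l]ord1 row_id.
have pP : (p <= col_mx (col_mx p x) y)%MS.
  by rewrite -addsmxE (submx_trans _ (addsmxSl _ _)) // -addsmxE addsmxSl.
by exists (col_mx (col_mx p x) y).
Qed.

Lemma has_dim_bounded S d : has_chain S 0 -> ~ has_chain S d ->
  exists2 k, has_dim S k & (k < d)%N.
Proof.
move=> S0; elim: d => [//|d IH] nS; have [Sd|nSd] := pselect (has_chain S d).
  by exists d.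
by have [k Sk kd] := IH nSd; exists k => //; apply: ltnW.
Qed.

(** A chain of length 3n+2 in Sec_2(X) would give 3n+3 free coordinates on the secant planes,
    against [secant_coords_not_free]. As [defective] asks for an actual dimension, Sec_2(X) must
    also be shown to have a chain of length 0. *)
Theorem special_defective n X : (forall x : K, exists y, y ^+ 2 = x) ->
    pclosed X -> pirreducible X -> pnondegenerate X -> has_dim X n ->
    (3 * n + 2 <= r)%N ->
    (forall (k : 'I_r.+1) (gamma : 'rV[{poly K}]_r.+1),
       curvilinear3 (affine_piece X k) gamma -> smooth_locus n X (jet_point gamma) ->
       special_along n X k gamma) ->
    osculating_regular 2 n X ->
  defective 2 n X.
Proof.
move=> sqrtK Xc Xirr nd Xdim r_ge Xspec [Oscn _].
have [Xchain _] := Xdim.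
have [I0 I0free] : exists I : 'I_(3 * n + 1) -> 'I_r.+1, free_coords (Osc 2 n X) I.
  move: Oscn; rewrite (minn_idPl _); last by lia.
  by move=> /chain_free_coords; rewrite -addn1.
have Ifree := free_coords_pclosure (@osculating_union_cone 2 n X) I0free.
have Onz : (osculating_union 2 n X !=set0)%classic.
  apply/set0P/negP => /eqP O0; have /eqP : (1 : {mpoly K[3 * n + 1]}) = 0.
    by apply: Ifree => v; rewrite O0.
  by rewrite oner_eq0.
have n0 := osculating_dim_gt0 Xc Xdim Onz.
have [p sm] : exists p, smooth_locus n X p.
  by have [v /osculating_jet [p [? [? [? [? [? [sm _ _]]]]]]]] := Onz; exists p.
have noSec : ~ has_chain (Sec 2 X) (3 * n + 2).
  move=> /chain_free_coords; rewrite (_ : (3 * n + 2).+1 = (n.+1 + (n.+1 + n.+1))%N); last by lia.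
  move=> [J Jfree].
  apply: (secant_coords_not_free Xc Xirr Xchain sqrtK r_ge Xspec n0 sm Ifree).
  exact: free_coords_pclosure (@secant_union_cone 2 X) Jfree.
(* The chain consists of X alone, which lies in Sec_2(X) because each of its points belongs to a
   plane spanned by three points of X. *)
have Sec0 : has_chain (Sec 2 X) 0.
  exists (fun=> X); split=> // i _; split=> // v Xv.
  have r2 : (2 <= r)%N by lia.
  have vS := sub_secant_union nd (fun v => @pclosed_nz _ _ X v Xc) r2 Xv.
  split; first by case: vS.
  by move=> g d _; apply.
have [k Sk kd] := has_dim_bounded Sec0 noSec.
by exists k => //; rewrite leq_min; apply/andP; split; lia.
Qed.

End Defect.

Theorem theorem5p1 (R : realType) (r n : nat) (X : set 'rV[R[i]]_r.+1)
    (X_closed : pclosed X) (X_irreducible : pirreducible X)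
    (X_nondegenerate : pnondegenerate X) (X_dim : has_dim X n)
    (r_ge : (3 * n + 2 <= r)%N)
    (X_special : forall (k : 'I_r.+1) (gamma : 'rV[{poly R[i]}]_r.+1),
       curvilinear3 (affine_piece X k) gamma ->
       smooth_locus n X (jet_point gamma) ->
       special_along n X k gamma)
    (X_osc_regular : osculating_regular 2 n X) :
  defective 2 n X.
Proof.
by apply: special_defective => // x; exists (sqrtC x); apply: sqrtCK.
Qed.
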